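(* Let $u,w\in S_n$ with $u\le w$ in Bruhat order and $w$ a $k$-Grassmannian permutation, and let $f:=ut_kw^{-1}$ be the corresponding $k$-bounded affine permutation. Then there are isomorphisms of affine algebraic varieties (i) $\Pi_{u,w}\cong X\big(\beta(u^{-1}w_{0,n})\,\beta(w_{0,n}ww_{0,n});\,w_{0,n}\big)$; (ii) $X\big(\beta(u^{-1}w_{0,n})\,\beta(w_{0,n}ww_{0,n});\,w_{0,n}\big)\cong X\big(J_k(f);w_{0,k}\big)\times(\mathbb C^* )^{n-k-\varphi}$, where $\varphi:=\#\{i\in[1,n]: f(i)=i\}$ is the number of fixed points of $f$.
   Context: **Braids and permutations.** Permutations are composed as functions; $s_i=(i\ i+1)$; $w_{0,n}\in S_n$ is the longest element; $\beta(v)$ is the positive braid lift of a reduced expression of $v$ (replace $s_i$ by the Artin generator $\sigma_i$). $w$ is $k$-Grassmannian if $w(1)<\dots<w(k)$ and $w(k+1)<\dots<w(n)$. In diagrams drawn left to right, strand positions are numbered top to bottom, and the rightmost letter of a word is the leftmost (first) crossing. **Bounded affine permutations.** A $k$-bounded affine permutation of size $n$ is a bijection $f:\mathbb Z\to\mathbb Z$ with $f(i+n)=f(i)+n$, $i\le f(i)\le i+n$, $\sum_{i=1}^n(f(i)-i)=nk$. Here $t_k=[1+n,\dots,k+n,k+1,\dots,n]$, and elements of $S_n$ are extended $n$-periodically to $\mathbb Z$. Let $i_1<\dots<i_k$ be the $i\in[1,n]$ with $f(i)>n$, and $j_1<\dots<j_{n-k}$ the remaining elements of $[1,n]$; put $\mathrm{inv}(s)=\#\{t>s:f(j_t)<f(j_s)\}$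 and $\lambda_s^t=k+s-j_s$. **Juggling braid.** For $j\in[1,n]$ with $f(j)\ne j$ let $A_j\subset\mathbb R^2$ be the upper half circle joining $(f^{-1}(j),0)$ and $(j,0)$, oriented from right to left. The union of these arcs, with consecutive arcs joined smoothly at the $x$-axis and all crossings declared positive, is a $k$-stranded positive braid $J_k(f)$; the strands start at $i_k,\dots,i_1$ (positions $1,\dots,k$) and end at $i_1-n,\dots,i_k-n$ (positions $1,\dots,k$); crossings met first are the rightmost letters. Concretely $J_k(f)=\beta(\pi)\,I_1I_2\cdots I_{n-k}$, where $\pi(p)=t$ iff $f(i_t)$ is the $p$-th largest of $f(i_1),\dots,f(i_k)$, and $I_s=\sigma_{\lambda_s^t-1}\sigma_{\lambda_s^t-2}\cdots\sigma_{k-f(j_s)+\mathrm{inv}(s)+s+1}$ (decreasing indices; trivial if the first index is smaller than the last). **Braid varieties.** For a positive braid word $\beta=\sigma_{i_1}\cdots\sigma_{i_\ell}$ on $n$ strands and a permutation $\pi\in S_n$ (viewed as a permutation matrix), $X(\beta;\pi)=\{(z_1,\dots,z_\ell)\in\mathbb C^\ell: B_{i_1}(z_1)\cdots B_{i_\ell}(z_\ell)\,\pi \text{ is upper triangular}\}$, where $B_i(z)\in \mathrm{GL}(n,\mathbb C[z])$ is the identity except for the block $\begin{pmatrix}0&1\\1&z\end{pmatrix}$ in rows and columns $i,i+1$. Up to isomorphism it depends only on the positive braid represented by $\beta$. **Positroid varieties.** Let $G=\mathrm{GL}(n,\mathbb C)$, $B$, $B_-$ the subgroups of upper and lower triangular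 matrices, $P\supset B$ the block upper triangular matrices with blocks of sizes $k,n-k$, so $G/P=\mathrm{Gr}(k,n)$, and $p:G/B\to G/P$ the projection. The open Richardson variety is $\mathcal R^\circ(u,w)=(BwB/B)\cap(B_-uB/B)$, and the open positroid variety is $\Pi_{u,w}:=p(\mathcal R^\circ(u,w))\subset\mathrm{Gr}(k,n)$. *)

(* Defs.v *)
From mathcomp Require Import all_boot all_order all_algebra all_fingroup.
From mathcomp Require Import complex.
From mathcomp Require Import boolp classical_sets reals.
From mathcomp Require Import mpoly.

Set Implicit Arguments.
Unset Strict Implicit.
Unset Printing Implicit Defensive.

Import Order.TTheory GRing.Theory Num.Theory.
Local Open Scope classical_set_scope.
Local Open Scope ring_scope.

(* -------------------------------------------------------------------------- *)
(* Varieties as spaces with functions: a set of points together with its      *)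
(* Zariski open subsets and, for each open U, the regular functions on U.     *)
(* Regular functions are represented by total functions, of which only the    *)
(* values on U matter.                                                        *)

Record fspace (K : closedFieldType) := FSpace {
  points :> Type;
  zopen : set (set points);
  regular : set points -> set (points -> K) }.

Definition morphism (K : closedFieldType) (X Y : fspace K) (F : X -> Y) : Prop :=
  forall V : set Y, zopen V ->
    zopen (F @^-1` V) /\
    forall phi : Y -> K, regular V phi -> regular (F @^-1` V) (phi \o F).

Definition isomorphic (K : closedFieldType) (X Y : fspace K) : Prop :=
  exists (F : X -> Y) (G : Y -> X),
    [/\ morphism F, morphism G, cancel F G & cancel G F].

Definition mxeval (K : closedFieldType) (m n : nat)
    (p : {mpoly K[m * n]}) (x : 'M[K]_(m, n)) : K :=
  p.@[fun i => mxvec x 0 i].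

(* The affine space K^(m * n). Open sets are unions of principal open sets,   *)
(* and regular functions are locally quotients of polynomials.                *)
Definition affine_space (K : closedFieldType) (m n : nat) : fspace K :=
  @FSpace K 'M[K]_(m, n)
    [set U | exists S : set {mpoly K[m * n]},
        U = [set x | exists2 p, S p & mxeval p x != 0]]
    (fun U => [set phi | forall x, U x ->
        exists p q : {mpoly K[m * n]}, mxeval q x != 0 /\
          forall y, U y -> mxeval q y != 0 ->
            phi y = mxeval p y / mxeval q y]).

(* For a locally closed Y, the induced (reduced) subvariety structure. *)
Definition subspace (K : closedFieldType) (X : fspace K) (Y : set X) : fspace K :=
  @FSpace K {x : X | Y x}
    [set U | exists2 V : set X, zopen V & U = @sval X Y @^-1` V]
    (fun U => [set phi | forall x, U x ->
        exists (V : set X) (psi : X -> K),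
          [/\ zopen V, V (sval x), regular V psi &
              forall y, U y -> V (sval y) -> phi y = psi (sval y)]]).

(* The product of subsets of two affine spaces, as a subset of K^(m + n). *)
Definition affine_prod (K : closedFieldType) (m n : nat)
    (X : set 'rV[K]_m) (Y : set 'rV[K]_n) : set (affine_space K 1 (m + n)) :=
  [set z | X (lsubmx z) /\ Y (rsubmx z)].

Definition torus (K : closedFieldType) (m : nat) : set 'rV[K]_m :=
  [set t | forall i, t 0 i != 0].

(* -------------------------------------------------------------------------- *)
(* Permutations and words. The product of {perm T} composes left to right, so *)
(* the composite s \o t of functions is (t * s)%g; letters of words are       *)
(* 1-based, and the position i of [1, n] is the ordinal i - 1.                *)

Definition compp (n : nat) (s t : 'S_n) : 'S_n := (t * s)%g.

Definition longest (n : nat) : 'S_n := perm (@rev_ord_inj n).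

Definition simple_refl (n i : nat) : 'S_n :=
  if (insub i.-1 : option 'I_n, insub i : option 'I_n) is (Some a, Some b)
  then tperm a b else 1%g.

Definition braid_word (n : nat) (s : seq nat) : bool :=
  all (fun i => (0 < i < n)%N) s.

Definition word_perm (n : nat) (s : seq nat) : 'S_n :=
  foldr (fun i v => compp (simple_refl n i) v) 1%g s.

Definition reduced_word (n : nat) (s : seq nat) (v : 'S_n) : Prop :=
  [/\ braid_word n s, word_perm n s = v &
      forall s', braid_word n s' -> word_perm n s' = v ->
        (size s <= size s')%N].

Definition perm_length (n : nat) (v : 'S_n) : nat :=
  #|[set p : 'I_n * 'I_n | (p.1 < p.2)%N && (v p.2 < v p.1)%N]%SET|.

Definition bruhat_step (n : nat) : rel 'S_n := fun u v =>
  [exists i, exists j, v == compp u (tperm i j)] &&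
  (perm_length u < perm_length v)%N.

Definition bruhat_le (n : nat) : rel 'S_n := connect (@bruhat_step n).

Definition grassmannian (n k : nat) (w : 'S_n) : Prop :=
  (forall i j : 'I_n, (i < j)%N -> (j < k)%N -> (w i < w j)%N) /\
  (forall i j : 'I_n, (k <= i)%N -> (i < j)%N -> (w i < w j)%N).

(* The permutation matrix sending e_j to e_(v j); with mathcomp's row-vector  *)
(* convention this is perm_mx v^-1.                                           *)
Definition permutation_mx (K : closedFieldType) (n : nat) (v : 'S_n) : 'M[K]_n :=
  perm_mx v^-1%g.

(* -------------------------------------------------------------------------- *)
(* Bounded affine permutations and their juggling braids.                     *)

(* The n-periodic map on integers with values g 0, ..., g (n - 1) on [1, n]. *)
Definition periodic (n : nat) (g : 'I_n -> int) (i : int) : int :=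
  if insub `|((i - 1) %% n)%Z|%N is Some r
  then g r + ((i - 1) %/ n)%Z * n%:Z else i.

Definition perm_ext (n : nat) (v : 'S_n) : int -> int :=
  periodic (fun r => (v r).+1%:Z).

Definition translation (n k : nat) : int -> int :=
  periodic (fun r : 'I_n => r.+1%:Z + (if (r < k)%N then n%:Z else 0)).

Definition bounded_affine_perm (n k : nat) (u w : 'S_n) : int -> int :=
  perm_ext u \o translation n k \o perm_ext w^-1%g.

(* The sequences i_1 < ... < i_k and j_1 < ... < j_(n-k). *)
Definition iseq (n : nat) (f : int -> int) : seq nat :=
  [seq i <- iota 1 n | n%:Z < f i%:Z].

Definition jseq (n : nat) (f : int -> int) : seq nat :=
  [seq j <- iota 1 n | f j%:Z <= n%:Z].

(* The unique pi such that f i_(pi p) is the p-th largest (counting from 0)   *)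
(* of the f i_t.                                                              *)
Definition juggling_perm (n k : nat) (f : int -> int) : 'S_k :=
  let fi (t : 'I_k) := f (nth 0%N (iseq n f) t)%:Z in
  odflt 1%g [pick pi : 'S_k |
    [forall p : 'I_k, #|[set t | fi (pi p) < fi t]%SET| == p]].

Definition inv_count (n : nat) (f : int -> int) (s : nat) : nat :=
  count (fun j => f j%:Z < f (nth 0%N (jseq n f) s.-1)%:Z) (drop s (jseq n f)).

(* I_s = sigma_hi sigma_(hi - 1) ... sigma_lo, for 1 <= s <= n - k. *)
Definition juggling_block (n k : nat) (f : int -> int) (s : nat) : seq nat :=
  let js := nth 0%N (jseq n f) s.-1 in
  let hi := k%:Z + s%:Z - js%:Z - 1 in
  let lo := k%:Z - f js%:Z + (inv_count n f s)%:Z + s%:Z + 1 in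
  [seq i <- rev (iota 1 k.-1) | lo <= i%:Z <= hi].

Definition juggling_word (n k : nat) (f : int -> int) (J : seq nat) : Prop :=
  exists2 c : seq nat, reduced_word c (juggling_perm n k f) &
    J = c ++ flatten [seq juggling_block n k f s | s <- iota 1 (n - k)].

Definition fixed_points (n : nat) (f : int -> int) : nat :=
  count (fun i : nat => f i%:Z == i%:Z) (iota 1 n).

(* -------------------------------------------------------------------------- *)
(* Braid varieties and open positroid varieties.                              *)

Definition lower_triangular (K : closedFieldType) (n : nat) (A : 'M[K]_n) : bool :=
  is_trig_mx A.

Definition upper_triangular (K : closedFieldType) (n : nat) (A : 'M[K]_n) : bool :=
  is_trig_mx A^T.

Definition braid_mx (K : closedFieldType) (n i : nat) (z : K) : 'M[K]_n :=
  \matrix_(a, b)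
    if (a.+1 == i) && (b.+1 == i) then 0
    else if (a.+1 == i) && (b == i :> nat) then 1
    else if (a == i :> nat) && (b.+1 == i) then 1
    else if (a == i :> nat) && (b == i :> nat) then z
    else (a == b)%:R.

Definition braid_word_mx (K : closedFieldType) (n : nat) (s : seq nat)
    (z : 'rV[K]_(size s)) : 'M[K]_n :=
  \big[mulmx/1%:M]_(j < size s) braid_mx n (nth 0%N s j) (z 0 j).

Definition braid_variety (K : closedFieldType) (n : nat) (s : seq nat)
    (v : 'S_n) : set (affine_space K 1 (size s)) :=
  [set z | upper_triangular (braid_word_mx n z *m permutation_mx K v)].

Definition GL (K : closedFieldType) (n : nat) : fspace K :=
  @subspace K (affine_space K n n) [set g | g \in unitmx].

Definition GLmx (K : closedFieldType) (n : nat) (g : GL K n) : 'M[K]_n := sval g.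

Definition borel (K : closedFieldType) (n : nat) : set (GL K n) :=
  [set b | upper_triangular (GLmx b)].

Definition borel_opp (K : closedFieldType) (n : nat) : set (GL K n) :=
  [set b | lower_triangular (GLmx b)].

Definition parabolic (K : closedFieldType) (n k : nat) : set (GL K n) :=
  [set b | forall i j : 'I_n, (k <= i)%N -> (j < k)%N -> GLmx b i j = 0].

Definition coset (K : closedFieldType) (n : nat) (H : set (GL K n))
    (g : GL K n) : set 'M[K]_n :=
  [set GLmx g *m GLmx h | h in H].

Definition is_coset (K : closedFieldType) (n : nat) (H : set (GL K n)) :
    set (set 'M[K]_n) :=
  [set c | exists g : GL K n, c = coset H g].

Definition to_coset (K : closedFieldType) (n : nat) (H : set (GL K n))
    (g : GL K n) : {c | is_coset H c} :=
  exist _ (coset H g) (ex_intro _ g erefl).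

(* The homogeneous variety GL_n / H for a closed subgroup H: open sets and    *)
(* regular functions are those whose pullbacks to GL_n are.                   *)
Definition GL_quotient (K : closedFieldType) (n : nat) (H : set (GL K n)) :
    fspace K :=
  @FSpace K {c | is_coset H c}
    [set V | zopen (to_coset H @^-1` V)]
    (fun V phi => regular (to_coset H @^-1` V) (phi \o to_coset H)).

Definition flag_variety (K : closedFieldType) (n : nat) : fspace K :=
  GL_quotient (@borel K n).

Definition grassmann_variety (K : closedFieldType) (n k : nat) : fspace K :=
  GL_quotient (@parabolic K n k).

(* The cell H v B / B in the flag variety. *)
Definition schubert_cell (K : closedFieldType) (n : nat) (H : set (GL K n))
    (v : 'S_n) : set (flag_variety K n) :=
  [set c | exists2 g : GL K n, c = to_coset (@borel K n) g &
     exists2 h, H h & GLmx g = GLmx h *m permutation_mx K v].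

Definition open_richardson (K : closedFieldType) (n : nat) (u w : 'S_n) :
    set (flag_variety K n) :=
  schubert_cell (@borel K n) w `&` schubert_cell (@borel_opp K n) u.

(* The image of the open Richardson variety under g B |-> g P. *)
Definition open_positroid (K : closedFieldType) (n k : nat) (u w : 'S_n) :
    set (grassmann_variety K n k) :=
  [set to_coset (@parabolic K n k) g | g in
     [set g : GL K n | open_richardson u w (to_coset (@borel K n) g)]].

Arguments torus K m _ : clear implicits.
Arguments braid_variety K {n} s v _.
Arguments open_positroid K {n} k u w _.

(* Main.v *)
Require Import Defs.
From mathcomp Require Import all_boot all_order all_algebra all_fingroup.
From mathcomp Require Import complex.
From mathcomp Require Import boolp classical_sets reals.
From mathcomp Require Import mpoly zify ring.

(** Both isomorphisms pass through one matrix model of the open Richardson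
    variety. A flag in [B w B / B] has a unique representative [g] in the affine
    space [col_pivots w], and it lies in [B_- u B] exactly when some [L] in the
    affine space [row_leads u] makes [L *m g] upper triangular; [L] is then
    unique, and by Cramer's rule a regular function of [g]. The model, called
    [richardson_slice u w], is the set of these [g].

    The braid variety is this slice ([braid_variety_richardson]). Since
    [B_i(z)] is an elementary unipotent matrix times a simple reflection, the
    matrices of a reduced word for [v] are parametrized without redundancy by
    the matrices [v *m U] with [U] upper and [v *m U *m v^-1] lower
    unitriangular: each letter of the word exchanges two consecutive pivots, and
    its variable is read off one matrix entry. With [W] the longest permutation
    matrix, the second word thus gives [W *m g *m W] and the first [L *m W].

    The positroid variety is this slice as well ([positroid_richardson]): as [w]
    is the shortest element of its coset, the first [k] columns of [g] are the
    echelon form of a basis of the subspace, and the other columns are fixed. On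
    the open set where the pivot minor does not vanish, the echelon form is a
    regular function on the Grassmannian.

    For the juggling braid, write [n = k + m], and consider the rows of the first
    [k] columns of [g]. The pivot rows are the standard basis of [K^k]. The free
    rows, which are those of the numbers [w(k+1) < ... < w(n)], are put back one
    at a time, the last one first. At each stage the rows where the rank jumps,
    read from the bottom up, form an adapted basis of [K^k]. Row [k + s] of [L]
    is a linear relation which says that the free row [w(k+s)] is a combination
    of the basis rows between it and row [u(k+s)], with nonzero coefficient on
    the latter, which it replaces in the basis. This base change is a companion
    matrix, which is the matrix of the word [I_s] of the juggling braid once the
    coefficient on row [u(k+s)] is scaled to one; the scalar is a coordinate of
    the torus. If [f] fixes the number of the free row then
    [w(k+s) = u(k+s)], the free row vanishes, and nothing is inserted. The
    first [k] rows of [L] say that the last basis is in the Bruhat cell of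
    [pi^-1], where [pi] is the permutation of the juggling braid, and this is
    where the word of [pi] appears. The lemmas are [glued_slice],
    [glued_exists], [glued_pivots] and [regf_glued], which combine to
    [juggling_richardson].

    The Bruhat order enters through [w(k+s) <= u(k+s)] only
    ([bruhat_grassmannian_bounded]); the formulas for the letters of [I_s] then
    follow by counting ([juggling_blockE]). *)

Set Implicit Arguments.
Unset Strict Implicit.
Unset Printing Implicit Defensive.

Import Order.TTheory GRing.Theory Num.Theory.
Local Open Scope ring_scope.

(** * Spaces with functions *)

Section SpacesWithFunctions.
Local Open Scope classical_set_scope.

(** Affine space has these properties, and they pass to subspaces and to
    quotients; they are all that is needed to test a map to an affine variety on
    its coordinates. *)
Record ringed (K : closedFieldType) (X : fspace K) : Prop := Ringed {
  zopenT : zopen [set: X];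
  zopenI : forall U V : set X, zopen U -> zopen V -> zopen (U `&` V);
  zopenU : forall P : set (set X), (forall U, P U -> zopen U) ->
    zopen [set x | exists2 U, P U & U x];
  regS : forall (U V : set X) phi, zopen U -> zopen V -> V `<=` U ->
    regular U phi -> regular V phi;
  reg_local : forall (U : set X) phi, zopen U ->
    (forall x, U x -> exists (V : set X) psi,
      [/\ zopen V, V x, regular V psi &
          forall y, U y -> V y -> phi y = psi y]) ->
    regular U phi;
  reg_const : forall (U : set X) c, zopen U -> regular U (fun=> c);
  regD : forall (U : set X) phi psi, zopen U -> regular U phi ->
    regular U psi -> regular U (fun x => phi x + psi x);
  regM : forall (U : set X) phi psi, zopen U -> regular U phi ->
    regular U psi -> regular U (fun x => phi x * psi x);
  reg_nz : forall (U : set X) phi, zopen U -> regular U phi ->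
    zopen [set x | U x /\ phi x != 0];
  regV : forall (U : set X) phi, zopen U -> regular U phi ->
    (forall x, U x -> phi x != 0) -> regular U (fun x => (phi x)^-1) }.

Section MxEval.
Variables (K : closedFieldType) (m n : nat).
Implicit Types (p q : {mpoly K[m * n]}) (x : 'M[K]_(m, n)).

Lemma mxevalD p q x : mxeval (p + q) x = mxeval p x + mxeval q x.
Proof. exact: mevalD. Qed.

Lemma mxevalM p q x : mxeval (p * q) x = mxeval p x * mxeval q x.
Proof. exact: mevalM. Qed.

Lemma mxevalC c x : mxeval (c%:MP : {mpoly K[m * n]}) x = c.
Proof. exact: mevalC. Qed.

Lemma mxevalX i j x : mxeval ('X_(mxvec_index i j) : {mpoly K[m * n]}) x = x i j.
Proof. by rewrite /mxeval mevalXU mxvecE. Qed.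

(** A regular function is locally of the form [p / q], and vanishes where [p]
    does: so its nonvanishing locus is open, and its inverse there is [q / p]. *)
Lemma affine_ringed : ringed (affine_space K m n).
Proof.
split => /=.
- exists [set 1] => /=; apply/seteqP; split=> x //= _.
  by exists 1; rewrite // -[1]/(1%:MP) mxevalC oner_neq0.
- move=> _ _ [S ->] [T ->].
  exists [set r | exists p q, [/\ S p, T q & r = p * q]].
  apply/seteqP; split=> x /=.
    case=> -[p Sp px] [q Tq qx]; exists (p * q); first by exists p, q.
    by rewrite mxevalM mulf_neq0.
  case=> _ [p [q [Sp Tq ->]]]; rewrite mxevalM mulf_eq0 negb_or.
  by case/andP=> px qx; split; [exists p | exists q].
- move=> P PU.
  exists [set r | exists2 U, P U &
     [set x | mxeval r x != 0] `<=` (U : set 'M_(m, n))].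
  apply/seteqP; split=> x /=.
    case=> U PU' Ux; case: (PU _ PU') => S US; move: (Ux); rewrite US.
    case=> p Sp px; exists p => //; exists U => // y /= py.
    by rewrite US; exists p.
  by case=> r [U PU' rU] rx; exists U => //; apply: rU.
- move=> U V phi _ _ VU rphi x /VU /rphi [p [q [qx e]]].
  by exists p, q; split=> // y /VU; apply: e.
- move=> U phi _ H x /[dup] Ux /H [_ [psi [[S ->] [s Ss sx] rpsi e]]].
  case: (rpsi x) => [|p [q [qx e']]]; first by exists s.
  exists (p * s), (q * s); split; first by rewrite mxevalM mulf_neq0.
  move=> y Uy; rewrite !mxevalM mulf_eq0 negb_or => /andP [qy sy].
  rewrite e //; last by exists s.
  by rewrite e' //; [rewrite -mulf_div divff // mulr1 | exists s].
- move=> U c _ x Ux; exists c%:MP, 1.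
  rewrite -[1]/(1%:MP) mxevalC oner_neq0; split=> // y _ _.
  by rewrite !mxevalC divr1.
- move=> U phi psi _ r1 r2 x /[dup] /r1 [p [q [qx e]]] /r2 [p' [q' [qx' e']]].
  exists (p * q' + p' * q), (q * q'); split; first by rewrite mxevalM mulf_neq0.
  move=> y Uy; rewrite mxevalD !mxevalM mulf_eq0 negb_or => /andP [qy qy'].
  by rewrite e // e' // addf_div.
- move=> U phi psi _ r1 r2 x /[dup] /r1 [p [q [qx e]]] /r2 [p' [q' [qx' e']]].
  exists (p * p'), (q * q'); split; first by rewrite mxevalM mulf_neq0.
  move=> y Uy; rewrite !mxevalM mulf_eq0 negb_or => /andP [qy qy'].
  by rewrite e // e' // mulf_div.
- move=> U phi [S ->] r.
  exists [set s | [set x | mxeval s x != 0] `<=`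
     [set x | (exists2 p, S p & mxeval p x != 0) /\ phi x != 0]].
  apply/seteqP; split=> x /=; last by case=> s H sx; apply: H.
  case=> Ux; case: (r _ Ux) => p [q [qx e]]; case: (Ux) => s Ss sx phix.
  exists (s * (p * q)).
    move=> y /=; rewrite !mxevalM !mulf_eq0 !negb_or => /and3P [sy py qy].
    have Uy : exists2 p, S p & mxeval p y != 0 by exists s.
    by split=> //; rewrite e // mulf_neq0 // invr_eq0.
  rewrite !mxevalM !mulf_neq0 //; apply: contraNneq phix => px.
  by rewrite e // px mul0r.
- move=> U phi _ r nz x /[dup] Ux /r [p [q [qx e]]].
  have px : mxeval p x != 0.
    by apply: contraNneq (nz _ Ux) => px; rewrite e // px mul0r.
  exists (q * q), (p * q); split; first by rewrite mxevalM mulf_neq0.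
  move=> y Uy; rewrite !mxevalM mulf_eq0 negb_or => /andP [py qy].
  by rewrite e // invf_div -mulf_div divff // mulr1.
Qed.

End MxEval.

Section Ringed.
Variables (K : closedFieldType).
Implicit Types X Y Z : fspace K.

Lemma zopen_nbhd X (U : set X) : ringed X ->
  (forall x, U x -> exists V : set X, [/\ zopen V, V x & V `<=` U]) -> zopen U.
Proof.
move=> rX H.
suff -> : U = [set x | exists2 V : set X, zopen V /\ V `<=` U & V x].
  by apply: zopenU => // V [].
apply/seteqP; split=> x /=; last by case=> V [_]; apply.
by case/H=> V [? ? ?]; exists V.
Qed.

Lemma regIl X (U V : set X) phi : ringed X -> zopen U -> zopen V ->
  regular U phi -> regular (U `&` V) phi.
Proof.
by move=> rX oU oV; apply: (regS rX oU (zopenI rX oU oV)) => x [].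
Qed.

Lemma regIr X (U V : set X) phi : ringed X -> zopen U -> zopen V ->
  regular V phi -> regular (U `&` V) phi.
Proof. by move=> rX oU oV; rewrite setIC; apply: regIl. Qed.

Lemma subspace_ringed X (S : set X) : ringed X -> ringed (subspace S).
Proof.
move=> rX; split=> /=.
- by exists setT; [exact: zopenT | ].
- move=> _ _ [U oU ->] [V oV ->]; exists (U `&` V) => //; exact: zopenI.
- move=> P H; exists [set x | exists2 V : set X,
     zopen V /\ P (@sval X S @^-1` V) & V x].
    by apply: zopenU => // V [].
  apply/seteqP; split=> x /=.
    case=> U /[dup] PU /H [V oV UE]; rewrite UE => Vx; exists V => //.
    by rewrite -UE.
  by case=> V [oV PV] Vx; exists (@sval X S @^-1` V).
- move=> U V phi _ _ VU r x /VU /r [W [psi [oW Wx rpsi e]]].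
  by exists W, psi; split=> // y /VU; apply: e.
- move=> U phi _ H x /[dup] Ux /H [_ [psi [[V oV ->] Vx r e]]].
  case: (r x Vx) => W [chi [oW Wx rchi e']].
  exists (V `&` W), chi; split=> //; [exact: zopenI|exact: regIr|].
  by move=> y Uy [Vy Wy]; rewrite e // e'.
- move=> U c _ x Ux; exists setT, (fun=> c); split=> //; first exact: zopenT.
  by apply: reg_const => //; exact: zopenT.
- move=> U phi psi _ r1 r2 x /[dup] /r1 [V [f [oV Vx rf e]]]
    /r2 [W [g [oW Wx rg e']]].
  have oI := zopenI rX oV oW.
  exists (V `&` W), (fun x => f x + g x); split=> //.
    by apply: regD => //; [apply: regIl | apply: regIr].
  by move=> y Uy [Vy Wy]; rewrite e // e'.
- move=> U phi psi _ r1 r2 x /[dup] /r1 [V [f [oV Vx rf e]]]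
    /r2 [W [g [oW Wx rg e']]].
  have oI := zopenI rX oV oW.
  exists (V `&` W), (fun x => f x * g x); split=> //.
    by apply: regM => //; [apply: regIl | apply: regIr].
  by move=> y Uy [Vy Wy]; rewrite e // e'.
- move=> _ phi [U oU ->] r.
  exists [set x | exists2 V : set X, zopen V /\
     @sval X S @^-1` V `<=` [set x | U (sval x) /\ phi x != 0] & V x].
    by apply: zopenU => // V [].
  apply/seteqP; split=> x /=; last by case=> V [_]; apply.
  case=> Ux phix; case: (r x Ux) => V [psi [oV Vx rpsi e]].
  exists (U `&` [set y | V y /\ psi y != 0]).
    split; first by apply: zopenI => //; apply: reg_nz.
    by move=> y /= [Uy [Vy psiy]]; rewrite e.
  by rewrite /= -e.
- move=> U phi _ r nz x /[dup] Ux /r [V [psi [oV Vx rpsi e]]].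
  have oW := reg_nz rX oV rpsi.
  exists [set y | V y /\ psi y != 0], (fun y => (psi y)^-1); split=> //.
  + by rewrite /= -e //; split=> //; exact: nz.
  + apply: regV => //; last by move=> ? [].
    by apply: (regS rX oV oW) rpsi => ? [].
  + by move=> y Uy [Vy _]; rewrite e.
Qed.

(** Open sets and regular functions on the quotient are defined by pullback to
    the group, and pullback commutes with all the operations involved. *)
Lemma quotient_ringed n (H : set (GL K n)) : ringed (GL_quotient H).
Proof.
have rG : ringed (GL K n) by apply/subspace_ringed/affine_ringed.
split=> /=.
- exact: (zopenT rG).
- by move=> U V oU oV; apply: (zopenI rG oU oV).
- move=> P oP.
  have -> : to_coset H @^-1` [set x | exists2 U, P U & U x] =
     [set g | exists2 U, [set V | exists2 W, P W & V = to_coset H @^-1` W] U & U g].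
    apply/seteqP; split=> g /=.
      by case=> U PU Ug; exists (to_coset H @^-1` U) => //; exists U.
    by case=> _ [U PU ->] Ug; exists U.
  by apply: (zopenU rG) => _ [W PW ->]; apply: oP.
- move=> U V phi oU oV VU; apply: (regS rG oU oV) => g; exact: VU.
- move=> U phi oU Hl; apply: (reg_local rG oU) => g /Hl [V [psi [oV Vg rpsi e]]].
  exists (to_coset H @^-1` V), (psi \o to_coset H); split=> // y.
  exact: e.
- by move=> U c oU; apply: (reg_const rG c oU).
- by move=> U phi psi oU r1 r2; apply: (regD rG oU r1 r2).
- by move=> U phi psi oU r1 r2; apply: (regM rG oU r1 r2).
- by move=> U phi oU r; apply: (reg_nz rG oU r).
- by move=> U phi oU r nz; apply: (regV rG oU r) => g; apply: nz.
Qed.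

Lemma morphism_comp X Y Z (F : X -> Y) (G : Y -> Z) :
  Defs.morphism F -> Defs.morphism G -> Defs.morphism (G \o F).
Proof.
move=> mF mG V /mG [oV r]; have [oV' r'] := mF _ oV.
by split=> // phi /r /r'.
Qed.

Lemma sval_morphism X (S : set X) : ringed X ->
  Defs.morphism (@sval X S : subspace S -> X).
Proof.
move=> rX V oV; split; first by exists V.
by move=> phi r x Vx; exists V, phi.
Qed.

(** A regular function on a subspace extends locally to the ambient space, so
    that the sheaf property of [X] reduces the claim to the composite with the
    inclusion. *)
Lemma corestrict_morphism X Y (S : set Y) (F : X -> subspace S) : ringed X ->
  Defs.morphism ((@sval Y S : subspace S -> Y) \o F) -> Defs.morphism F.
Proof.
move=> rX mF _ [V oV ->]; have [oW _] := mF _ oV; split=> // phi r.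
apply: reg_local => // x Vx; case: (r (F x) Vx) => W [psi [oW' Wx rpsi e]].
have [oF rF] := mF _ oW'.
by exists ((@sval Y S \o F) @^-1` W), (psi \o (@sval Y S \o F)); split;
   [| | exact: rF | move=> y /= Vy Wy; apply: e].
Qed.

Lemma isomorphic_sym X Y : isomorphic X Y -> isomorphic Y X.
Proof. by case=> F [G [? ? ? ?]]; exists G, F. Qed.

Lemma isomorphic_trans X Y Z : isomorphic X Y -> isomorphic Y Z -> isomorphic X Z.
Proof.
case=> F [G [mF mG FK GK]] [F' [G' [mF' mG' FK' GK']]].
exists (F' \o F), (G \o G'); split; try exact: morphism_comp.
  exact: can_comp.
exact: can_comp.
Qed.

End Ringed.

Section Regular.
Variables (K : closedFieldType) (X : fspace K) (rX : ringed X).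
Implicit Types phi psi : X -> K.

Definition regf phi := regular setT phi.

Lemma eq_regf phi psi : phi =1 psi -> regf phi -> regf psi.
Proof. by move/funext ->. Qed.

Lemma regf_const c : regf (fun=> c).
Proof. by apply: reg_const => //; apply: zopenT. Qed.

Lemma regfD phi psi : regf phi -> regf psi -> regf (fun x => phi x + psi x).
Proof. by apply: regD => //; apply: zopenT. Qed.

Lemma regfM phi psi : regf phi -> regf psi -> regf (fun x => phi x * psi x).
Proof. by apply: regM => //; apply: zopenT. Qed.

Lemma regfN phi : regf phi -> regf (fun x => - phi x).
Proof.
by move=> r; apply: (@eq_regf (fun x => -1 * phi x)) => [x|];
  [rewrite mulN1r | apply: regfM => //; apply: regf_const].
Qed.

Lemma regfB phi psi : regf phi -> regf psi -> regf (fun x => phi x - psi x).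
Proof. by move=> r1 r2; apply: regfD => //; apply: regfN. Qed.

Lemma regfV phi : regf phi -> (forall x, phi x != 0) -> regf (fun x => (phi x)^-1).
Proof. by move=> r nz; apply: regV => //; apply: zopenT. Qed.

Lemma regf_sum (I : Type) (r : seq I) (P : pred I) (F : I -> X -> K) :
  (forall i, P i -> regf (F i)) -> regf (fun x => \sum_(i <- r | P i) F i x).
Proof.
move=> H; elim: r => [|i r IH].
  by apply: (@eq_regf (fun=> 0)) => [x|]; [rewrite big_nil|apply: regf_const].
case Pi: (P i).
  apply: (@eq_regf (fun x => F i x + \sum_(i <- r | P i) F i x)) => [x|].
    by rewrite big_cons Pi.
  by apply: regfD => //; apply: H.
by apply: eq_regf IH => x; rewrite big_cons Pi.
Qed.

Lemma regf_prod (I : Type) (r : seq I) (P : pred I) (F : I -> X -> K) :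
  (forall i, P i -> regf (F i)) -> regf (fun x => \prod_(i <- r | P i) F i x).
Proof.
move=> H; elim: r => [|i r IH].
  by apply: (@eq_regf (fun=> 1)) => [x|]; [rewrite big_nil|apply: regf_const].
case Pi: (P i).
  apply: (@eq_regf (fun x => F i x * \prod_(i <- r | P i) F i x)) => [x|].
    by rewrite big_cons Pi.
  by apply: regfM => //; apply: H.
by apply: eq_regf IH => x; rewrite big_cons Pi.
Qed.

Lemma regf_exp phi d : regf phi -> regf (fun x => phi x ^+ d).
Proof.
move=> r; elim: d => [|d IH].
  by apply: (@eq_regf (fun=> 1)); last exact: regf_const.
apply: (@eq_regf (fun x => phi x * phi x ^+ d)) => [x|]; first by rewrite exprS.
exact: regfM.
Qed.

Definition regmx m n (F : X -> 'M[K]_(m, n)) := forall i j, regf (fun x => F x i j).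

Lemma regmx_const m n (A : 'M_(m, n)) : regmx (fun=> A).
Proof. by move=> i j; apply: regf_const. Qed.

Lemma regmxM m n p (F : X -> 'M_(m, n)) (G : X -> 'M_(n, p)) :
  regmx F -> regmx G -> regmx (fun x => F x *m G x).
Proof.
move=> rF rG i j.
apply: (@eq_regf (fun x => \sum_l F x i l * G x l j)) => [x|].
  by rewrite mxE.
by apply: regf_sum => l _; apply: regfM.
Qed.

Lemma regf_det n (F : X -> 'M_n) : regmx F -> regf (fun x => \det (F x)).
Proof.
move=> rF; rewrite /determinant; apply: regf_sum => s _.
apply: regfM; first exact: regf_const.
exact: regf_prod.
Qed.

Lemma regmx_adj n (F : X -> 'M_n) : regmx F -> regmx (fun x => \adj (F x)).
Proof.
move=> rF i j; apply: (@eq_regf (fun x => cofactor (F x) j i)) => [x|].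
  by rewrite [RHS]mxE.
rewrite /cofactor; apply: regfM; first exact: regf_const.
apply: regf_det => a b.
by apply: (@eq_regf (fun x => F x (lift j a) (lift i b))) => // x; rewrite !mxE.
Qed.

Lemma regmx_inv n (F : X -> 'M_n) : regmx F -> (forall x, F x \in unitmx) ->
  regmx (fun x => invmx (F x)).
Proof.
move=> rF uF i j.
apply: (@eq_regf (fun x => (\det (F x))^-1 * (\adj (F x)) i j)) => [x|].
  by rewrite /invmx uF [RHS]mxE.
apply: regfM; last exact: regmx_adj.
by apply: regfV; [apply: regf_det | move=> x; rewrite -unitfE -unitmxE].
Qed.

Lemma regf_mxeval m n (p : {mpoly K[m * n]}) (F : X -> 'M_(m, n)) :
  regmx F -> regf (fun x => mxeval p (F x)).
Proof.
move=> rF; rewrite /mxeval /meval /mmap; apply: regf_sum => mm _.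
apply: regfM; first exact: regf_const.
rewrite /mmap1; apply: regf_prod => i _; apply: regf_exp.
case/mxvec_indexP: i => i j.
by apply: eq_regf (rF i j) => x; rewrite mxvecE.
Qed.

(** The pullback of [p / q] is obtained by substituting the coordinates of [F]
    into [p] and [q]. *)
Lemma regmx_morphism m n (F : X -> affine_space K m n) :
  regmx (F : X -> 'M_(m, n)) -> Defs.morphism F.
Proof.
move=> rF.
have oD p : zopen [set x | mxeval p (F x) != 0].
  suff -> : [set x | mxeval p (F x) != 0] =
            [set x | setT x /\ mxeval p (F x) != 0].
    by apply: reg_nz => //; [apply: zopenT|apply: regf_mxeval].
  by apply/seteqP; split=> x //= [].
have oF (V : set (affine_space K m n)) : zopen V -> zopen (F @^-1` V).
  case=> S ->; apply: zopen_nbhd => // x /= [p Sp px].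
  exists [set x | mxeval p (F x) != 0]; split=> // y /= py.
  by exists p.
move=> V oV; split; first exact: oF.
move=> phi r; apply: reg_local => //; first exact: oF.
move=> x Vx; case: (r _ Vx) => p [q [qx e]].
exists [set x | mxeval q (F x) != 0], (fun y => mxeval p (F y) / mxeval q (F y)).
split=> //; last by move=> y /= Vy qy; rewrite e.
apply: regM => //; last apply: regV => //.
- by apply: (regS rX (zopenT rX)) => //; apply: regf_mxeval.
- by apply: (regS rX (zopenT rX)) => //; apply: regf_mxeval.
Qed.

End Regular.

Lemma affine_isomorphic (K : closedFieldType) m n m' n'
    (S : set (affine_space K m n)) (T : set (affine_space K m' n'))
    (F : {x : 'M[K]_(m, n) | S x} -> {y : 'M[K]_(m', n') | T y})
    (G : {y : 'M[K]_(m', n') | T y} -> {x : 'M[K]_(m, n) | S x}) :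
  @regmx K (subspace S) m' n' (fun x => sval (F x)) ->
  @regmx K (subspace T) m n (fun y => sval (G y)) ->
  cancel F G -> cancel G F -> isomorphic (subspace S) (subspace T).
Proof.
move=> rF rG FK GK; exists F, G; split=> //; apply: corestrict_morphism;
  by [apply/subspace_ringed/affine_ringed
     | apply: regmx_morphism => //; apply/subspace_ringed/affine_ringed].
Qed.

Lemma regmx_sval (K : closedFieldType) m n (S : set (affine_space K m n)) :
  @regmx K (subspace S) m n (fun x => sval x).
Proof.
move=> i j x _; exists setT, (fun y : 'M_(m, n) => y i j); split=> //.
  exact: (zopenT (affine_ringed K m n)).
move=> y _; exists 'X_(mxvec_index i j), 1.
rewrite -[1]/(1%:MP) mxevalC oner_neq0; split=> // z _ _.
by rewrite mxevalX mxevalC divr1.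
Qed.

(** A bijection given by regular functions is an isomorphism once every
    section of it is given by regular functions. *)
Lemma affine_bijection_isomorphic (K : closedFieldType) m n m' n'
    (S : set (affine_space K m n)) (T : set (affine_space K m' n'))
    (f : 'M[K]_(m, n) -> 'M[K]_(m', n')) :
  (forall x, S x -> T (f x)) ->
  (forall x x', S x -> S x' -> f x = f x' -> x = x') ->
  (forall y, T y -> exists2 x, S x & f x = y) ->
  @regmx K (subspace S) m' n' (fun x => f (sval x)) ->
  (forall g : {y | T y} -> 'M_(m, n), (forall y, S (g y) /\ f (g y) = sval y) ->
     @regmx K (subspace T) m n g) ->
  isomorphic (subspace S) (subspace T).
Proof.
move=> ST inj surj rf rg.
have surj' (y : {y | T y}) : exists x, S x /\ f x = sval y.
  by have [x Sx e] := surj _ (svalP y); exists x.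
have [g gE] := choice surj'.
pose F (x : {x | S x}) : {y | T y} := exist _ (f (sval x)) (ST _ (svalP x)).
pose G (y : {y | T y}) : {x | S x} := exist _ (g y) (gE y).1.
apply: (@affine_isomorphic _ _ _ _ _ _ _ F G) => //.
- exact: rg.
- move=> [x Sx]; apply: eq_exist => /=; apply: inj => //; first exact: (gE _).1.
  by rewrite (gE _).2.
- by move=> [y Ty]; apply: eq_exist => /=; rewrite (gE _).2.
Qed.

End SpacesWithFunctions.

(** * Lengths and reduced words *)

Lemma upperP (K : closedFieldType) n (A : 'M[K]_n) :
  reflect (forall i j : 'I_n, (j < i)%N -> A i j = 0) (upper_triangular A).
Proof.
apply: (iffP is_trig_mxP) => H i j lij; first by rewrite -(H j i) // mxE.
by rewrite mxE H.
Qed.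

Section Length.
Variable n : nat.
Implicit Types (v : 'S_n) (a b : 'I_n) (s : seq nat).

Lemma simple_reflE i a b : a.+1 = i -> b = i :> nat -> simple_refl n i = tperm a b.
Proof.
by move=> <- Eb; rewrite /simple_refl /= valK -Eb valK.
Qed.

(** A letter [i], which counts positions from 1, stands for the consecutive
    ordinals [i - 1] and [i]. *)
Lemma letter_ord i : (0 < i < n)%N -> exists a b : 'I_n, a.+1 = i /\ b = i :> nat.
Proof.
case: i => // i /= lin.
by exists (Ordinal (ltnW lin)), (Ordinal lin).
Qed.

Lemma tperm_adjacent_lt a b (x y : 'I_n) : b = a.+1 :> nat -> x != y ->
  (x, y) != (a, b) -> (y, x) != (a, b) -> (tperm a b y < tperm a b x)%N = (y < x)%N.
Proof.
rewrite !xpair_eqE -!val_eqE /= => ab xy.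
case: (tpermP a b y) => [->|->|/eqP + /eqP]; case: (tpermP a b x) => [->|->|/eqP + /eqP];
  rewrite -?val_eqE /=; lia.
Qed.

(** All other pairs of values keep their relative order, so that the positions
    of [a] and [b] form the only new inversion. *)
Lemma perm_length_ascent v a b : b = a.+1 :> nat ->
  (v^-1%g a < v^-1%g b)%N ->
  perm_length (v * tperm a b)%g = (perm_length v).+1.
Proof.
move=> ab lt; rewrite /perm_length.
set S := [set p : 'I_n * 'I_n | (p.1 < p.2)%N & (v p.2 < v p.1)%N]%SET.
suff -> : [set p : 'I_n * 'I_n | (p.1 < p.2)%N &
     ((v * tperm a b)%g p.2 < (v * tperm a b)%g p.1)%N]%SET =
     ((v^-1%g a, v^-1%g b) |: S)%SET.
  by rewrite cardsU1 !inE /= !permKV ab [(_ < a)%N]ltnNge leqnSn andbF.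
apply/setP=> -[c d]; rewrite !inE /= !permM xpair_eqE.
have [cd|cd] := ltnP c d; last first.
  rewrite orbF; apply/esym/negbTE/negP => /andP [/eqP Ec /eqP Ed].
  by move: cd; rewrite Ec Ed leqNgt lt.
have vE x y : (x == v^-1%g y) = (v x == y).
  by rewrite -(inj_eq (@perm_inj _ v)) permKV.
have [/andP [/eqP -> /eqP ->]|ne] /= := boolP ((c == v^-1%g a) && (d == v^-1%g b)).
  by rewrite !permKV tpermL tpermR ab ltnSn.
rewrite tperm_adjacent_lt // ?(inj_eq perm_inj) ?xpair_eqE -?vE //.
  by rewrite -val_eqE neq_ltn cd.
apply/negP=> /andP [/eqP Ed /eqP Ec]; move: cd.
by rewrite Ed Ec ltnNge ltnW.
Qed.

Lemma perm_length_descent v a b : b = a.+1 :> nat ->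
  (v^-1%g b < v^-1%g a)%N ->
  perm_length v = (perm_length (v * tperm a b)%g).+1.
Proof.
move=> ab lt; rewrite -(@perm_length_ascent _ a b) //.
  by rewrite -mulgA tperm2 mulg1.
by rewrite invMg tpermV !permM tpermL tpermR.
Qed.

(** Being increasing forces [a <= v a] for all [a], and both sides have the
    same sum. *)
Lemma increasing_perm1 v :
  (forall a b, b = a.+1 :> nat -> (v a < v b)%N) -> v = 1%g.
Proof.
move=> inc.
have mono (a b : 'I_n) : (a < b)%N -> (v a < v b)%N.
  case: b => b; elim: b => // b IH lb /=; rewrite ltnS leq_eqVlt.
  have lb' := ltnW lb.
  case/orP=> [/eqP E|l]; first by apply: inc; rewrite /= E.
  by apply: ltn_trans (IH lb' l) (inc (Ordinal lb') (Ordinal lb) erefl).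
have ge (a : 'I_n) : (a <= v a)%N.
  case: a => a; elim: a => // a IH la.
  apply: leq_ltn_trans (IH (ltnW la)) _; exact: inc.
apply/permP => a; rewrite perm1; apply: val_inj => /=.
have [_ ] := leqif_sum (fun (i : 'I_n) (_ : true) => leqif_eq (ge i)).
rewrite [X in (X == _)](reindex_inj (@perm_inj _ v)) eqxx.
by move=> /esym /forallP /(_ a) /= /eqP.
Qed.

Lemma perm_length_word s : braid_word n s -> (perm_length (word_perm n s) <= size s)%N.
Proof.
elim: s => [_|i s IH /= /andP [/letter_ord [a [b [ai bi]]] /IH le]].
  rewrite /perm_length leqn0 cards_eq0; apply/eqP/setP=> -[c d].
  by rewrite !inE /= !perm1; case: ltngtP.
rewrite /compp (simple_reflE ai bi).
have ab : b = a.+1 :> nat by rewrite bi.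
case: (ltngtP (val ((word_perm n s)^-1%g a)) (val ((word_perm n s)^-1%g b))) => lt.
- by rewrite perm_length_ascent.
- by move: le; rewrite (perm_length_descent ab lt) /=; lia.
- by move/val_inj/perm_inj: lt ab => ->; lia.
Qed.

(** Bubble sort: a permutation other than the identity has a descent, which a
    simple reflection removes. *)
Lemma perm_word_exists v :
  exists s, [/\ braid_word n s, word_perm n s = v & size s = perm_length v].
Proof.
elim: {v}(perm_length v) {-2}v (erefl (perm_length v)) => [|l IH] v lv.
  exists [::]; split=> //; apply/esym/invg_inj; rewrite invg1.
  apply: increasing_perm1 => a b ab; case: ltngtP => // lt.
    by rewrite (perm_length_descent ab lt) in lv.
  by move/val_inj/perm_inj: lt ab => ->; lia.
have [a [b [ab lt]]] : exists a b : 'I_n, b = a.+1 :> nat /\ (v^-1%g b < v^-1%g a)%N.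
  have [v1|v1] := eqVneq v^-1%g 1%g.
    move: lv; rewrite -[v]invgK v1 invg1 => /eqP.
    have := @perm_length_word [::] isT; rewrite /= leqn0 => /eqP ->; lia.
  apply: contrapT => H; case/eqP: v1; apply: increasing_perm1 => a b ab.
  case: ltngtP => // lt; first by case: H; exists a, b.
  by move/val_inj/perm_inj: lt ab => ->; lia.
have [|s [ws es ss]] := IH (v * tperm a b)%g.
  by have := perm_length_descent ab lt; rewrite lv; lia.
exists (a.+1 :: s); split=> /=; last 1 first.
- by rewrite ss (perm_length_descent ab lt).
- by rewrite ws andbT -ab /= ltn_ord.
- by rewrite /compp es (@simple_reflE _ a b) // -mulgA tperm2 mulg1.
Qed.

(** Every letter of a reduced word, read from the right, lengthens the
    permutation; this is the only consequence of reducedness used below. *)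
Fixpoint ascending s : Prop :=
  if s is i :: s' then
    [/\ (0 < i < n)%N, ascending s' &
        forall a b : 'I_n, a.+1 = i -> b = i :> nat ->
          ((word_perm n s')^-1%g a < (word_perm n s')^-1%g b)%N]
  else True.

Lemma reduced_ascending s v : reduced_word s v -> ascending s.
Proof.
case=> ws <- min.
have {min} : (size s <= perm_length (word_perm n s))%N.
  by have [s' [ws' es' <-]] := perm_word_exists (word_perm n s); exact: min.
elim: s ws => //= i s IH /andP [/[dup] ii /letter_ord [a [b [ai bi]]] ws].
rewrite /compp (simple_reflE ai bi) => le.
have ab : b = a.+1 :> nat by rewrite bi.
have les := perm_length_word ws.
have lt : ((word_perm n s)^-1%g a < (word_perm n s)^-1%g b)%N.
  case: ltngtP => // lt; first by move: (perm_length_descent ab lt); lia.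
  by move/val_inj/perm_inj: lt ab => ->; lia.
split=> // [|a' b' ea eb]; first by apply: IH => //; move: le; rewrite perm_length_ascent.
have -> : a' = a by apply: val_inj; rewrite /= -[LHS]/(a'.+1.-1) ea -ai.
by have -> : b' = b by apply: val_inj; rewrite /= eb.
Qed.

Lemma ascending_word s : ascending s -> braid_word n s.
Proof. by elim: s => //= i s IH [-> /IH ->]. Qed.

End Length.

(** * Matrices of braid words *)

Section Words.
Variables (K : closedFieldType) (n : nat).
Implicit Types (s : seq nat) (z : nat -> K) (A : 'M[K]_n) (x : 'S_n) (a b : 'I_n).

Fixpoint word_mx s z : 'M[K]_n :=
  if s is i :: s' then braid_mx n i (z 0%N) *m word_mx s' (z \o S) else 1%:M.

(** Coordinates are indexed by natural numbers, and extended by zero, so that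
    words can be cut without casts. *)
Definition coords m (z : 'rV[K]_m) (j : nat) : K :=
  if insub j is Some i then z 0 i else 0.

Lemma coordsE m (z : 'rV[K]_m) (j : 'I_m) : coords z j = z 0 j.
Proof. by rewrite /coords valK. Qed.

Lemma word_mx_big s z :
  \big[mulmx/1%:M]_(j < size s) braid_mx n (nth 0%N s j) (z j) = word_mx s z.
Proof.
elim: s z => [|i s IH] z /=; first by rewrite big_ord0.
by rewrite big_ord_recl /= -IH.
Qed.

Lemma braid_word_mxE s (z : 'rV[K]_(size s)) :
  braid_word_mx n z = word_mx s (coords z).
Proof.
by rewrite -word_mx_big; apply: eq_bigr => j _; rewrite coordsE.
Qed.

Lemma eq_word_mx s z z' : (forall j, (j < size s)%N -> z j = z' j) ->
  word_mx s z = word_mx s z'.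
Proof.
elim: s z z' => //= i s IH z z' E; rewrite E //; congr (_ *m _).
by apply: IH => j lj; apply: E.
Qed.

Lemma word_mx_cat s1 s2 z :
  word_mx (s1 ++ s2) z = word_mx s1 z *m word_mx s2 (fun j => z (size s1 + j)%N).
Proof.
by elim: s1 z => [|i s1 IH] z /=; rewrite ?mul1mx // IH mulmxA.
Qed.

(** On rows, a braid matrix acts as a transvection followed by an exchange. *)
Lemma mul_braid_mx m i c (A : 'M[K]_(n, m)) a b : a.+1 = i -> b = i :> nat ->
  braid_mx n i c *m A = \matrix_(r, j)
    if r == a then A b j else if r == b then A a j + c * A b j else A r j.
Proof.
move=> ai bi; have nab : b != a by rewrite -val_eqE /= bi -ai; lia.
have Ea (r : 'I_n) : (r.+1 == i) = (r == a) by rewrite -ai.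
have Eb (r : 'I_n) : (r == i :> nat) = (r == b) by rewrite -bi.
apply/matrixP=> r j; rewrite !mxE.
under eq_bigr => l _ do rewrite !mxE !Ea !Eb.
have [->|ra] := eqVneq r a.
  rewrite (bigD1 b) //= eqxx (negbTE nab) mul1r big1 ?addr0 // => l lb.
  rewrite [a == b]eq_sym (negbTE nab) [a == l]eq_sym.
  by case: eqP; rewrite ?mul0r // (negbTE lb) mul0r.
have [->|rb] := eqVneq r b.
  rewrite (bigD1 a) //= (bigD1 b) //= !eqxx mul1r (negbTE nab) big1 ?addr0 //.
  move=> l /andP [la lb].
  by rewrite (negbTE la) (negbTE lb) [b == l]eq_sym (negbTE lb) mul0r.
rewrite (bigD1 r) //= eqxx mul1r big1 ?addr0 // => l lr.
by rewrite [r == l]eq_sym (negbTE lr) mul0r.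
Qed.

(** The row operation inverse to that of a braid matrix. *)
Definition peel a b c A : 'M[K]_n :=
  \matrix_(r, j) if r == a then A b j - c * A a j else if r == b then A a j else A r j.

Lemma braid_mx_unit i (c : K) : (0 < i < n)%N -> braid_mx n i c \in unitmx.
Proof.
move/letter_ord => [a [b [ai bi]]].
have nab : b != a by rewrite -val_eqE /= bi -ai; lia.
suff /mulmx1_unit [] : braid_mx n i c *m peel a b c 1%:M = 1%:M by [].
rewrite (mul_braid_mx _ _ ai bi); apply/matrixP=> r j; rewrite !mxE !eqxx.
case: (eqVneq r a) => [->|ra]; first by rewrite (negbTE nab).
case: (eqVneq r b) => [->|rb] //.
by rewrite (negbTE nab); ring.
Qed.

Lemma word_mx_unit s z : braid_word n s -> word_mx s z \in unitmx.
Proof.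
elim: s z => [|i s IH] z /=; first by rewrite unitmx1.
by case/andP=> ii ws; rewrite unitmx_mul braid_mx_unit // IH.
Qed.

(** With [v = x^-1], these are the matrices [v *m U] for which [U] is upper and
    [v *m U *m v^-1] lower unitriangular. Row [c] has its pivot in column [x c]. *)
Definition row_pivots x A := forall c, [/\ A c (x c) = 1,
  (forall j : 'I_n, (j < x c)%N -> A c j = 0) &
  (forall c' : 'I_n, (c < c')%N -> A c (x c') = 0)].

Lemma word_permV s i a b : a.+1 = i -> b = i :> nat ->
  forall c, (word_perm n (i :: s))^-1%g c = (word_perm n s)^-1%g (tperm a b c).
Proof.
by move=> ai bi c; rewrite /= /compp (simple_reflE ai bi) invMg tpermV permM.
Qed.

(** The new letter exchanges the pivots of two consecutive rows and changes the
    second one by a multiple of the first. Since the letter is an ascent, these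
    pivots were in increasing order, and the vanishing conditions persist. *)
Lemma word_row_pivots s z : ascending n s ->
  row_pivots (word_perm n s)^-1%g (word_mx s z).
Proof.
elim: s z => [|i s IH] z.
  move=> _ c; rewrite /= invg1 !perm1 !mxE eqxx; split=> // [j lj|c' lc].
    by rewrite mxE [c == j]eq_sym -val_eqE /= ltn_eqF.
  by rewrite perm1 mxE -val_eqE /= ltn_eqF.
case=> /letter_ord [a [b [ai bi]]] /IH {}IH /(_ a b ai bi) lt c.
rewrite [word_mx _ _]/= (mul_braid_mx _ _ ai bi); move: {IH}(IH (z \o S)) (word_permV s ai bi) lt.
set A := word_mx _ _; set x := (word_perm n s)^-1%g; set y := (_)^-1%g => H E lt.
have ab : b = a.+1 :> nat by rewrite bi.
have nab : b != a by rewrite -val_eqE /= ab; lia.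
have ya : y a = x b by rewrite E tpermL.
have yb : y b = x a by rewrite E tpermR.
have yd (d : 'I_n) : d != a -> d != b -> y d = x d.
  by move=> da db; rewrite E tpermD // eq_sym.
have [Aa Aa0 Aa1] := H a; have [Ab Ab0 Ab1] := H b.
have [->|ca] := eqVneq c a; last have [->|cb] := eqVneq c b.
- split=> [|j|c' lc]; rewrite ?ya mxE eqxx //; first exact: Ab0.
  have [->|c'b] := eqVneq c' b; first by rewrite yb Ab0.
  rewrite yd //; last by rewrite -val_eqE /=; lia.
  by apply: Ab1; move: c'b; rewrite -val_eqE /=; lia.
- split=> [|j lj|c' lc]; rewrite ?yb mxE eqxx (negbTE nab).
  + by rewrite Aa Ab0 // mulr0 addr0.
  + by rewrite yb in lj; rewrite Aa0 // Ab0 ?mulr0 ?addr0 //; lia.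
  + rewrite yd ?Aa1 ?Ab1 ?mulr0 ?addr0 //; rewrite -?val_eqE /=; lia.
- have [Ac Ac0 Ac1] := H c.
  split=> [|j lj|c' lc]; rewrite mxE (negbTE ca) (negbTE cb).
  + by rewrite yd.
  + by rewrite yd // in lj; apply: Ac0.
  + rewrite E; case: tpermP => [c'a|c'b|_ _]; apply: Ac1; rewrite ?ab //;
      by move: ca cb lc; rewrite -!val_eqE /= ?c'a ?c'b; lia.
Qed.

(** The conditions hold again after peeling the first letter, provided that its
    variable is the entry of [A] in row [b] and in the pivot column of row [a]:
    this is the entry to be cleared. *)
Lemma row_pivots_word s A : ascending n s ->
  row_pivots (word_perm n s)^-1%g A -> exists z, word_mx s z = A.
Proof.
elim: s A => [|i s IH] A.
  rewrite /= invg1 => _ H; exists (fun=> 0); apply/matrixP=> c j; rewrite mxE.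
  have [Ac Ac0 Ac1] := H c; rewrite perm1 in Ac Ac0.
  case: (ltngtP c j) => lcj; rewrite -val_eqE /=.
  - by have := Ac1 _ lcj; rewrite perm1 ltn_eqF.
  - by rewrite Ac0 // gtn_eqF.
  - by rewrite lcj eqxx -(val_inj lcj) Ac.
case=> /letter_ord [a [b [ai bi]]] /IH {}IH /(_ a b ai bi) lt H.
move: IH (word_permV s ai bi) lt H.
set x := (word_perm n s)^-1%g; set y := (_)^-1%g => IH E lt H.
have ab : b = a.+1 :> nat by rewrite bi.
have nab : b != a by rewrite -val_eqE /= ab; lia.
have ya : y a = x b by rewrite E tpermL.
have yb : y b = x a by rewrite E tpermR.
have yd (d : 'I_n) : d != a -> d != b -> y d = x d.
  by move=> da db; rewrite E tpermD // eq_sym.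
have [Aa Aa0 Aa1] := H a; have [Ab Ab0 Ab1] := H b.
rewrite ya in Aa Aa0; rewrite yb in Ab Ab0.
pose c0 := A b (x b).
have [|z zE] := IH (peel a b c0 A).
  move=> c; have [->|ca] := eqVneq c a; last have [->|cb] := eqVneq c b.
  - split=> [|j lj|c' lc]; rewrite ?mxE eqxx.
    + by rewrite Ab -yb Aa1 ?ab // mulr0 subr0.
    + by rewrite Ab0 // Aa0 ?mulr0 ?subr0 //; lia.
    + have [->|c'b] := eqVneq c' b; first by rewrite Aa mulr1 subrr.
      have l' : (b < c')%N by move: c'b; rewrite -val_eqE /=; lia.
      rewrite -yd //; last by rewrite -val_eqE /=; lia.
      by rewrite Aa1 // Ab1 // mulr0 subr0.
  - split=> [|j lj|c' lc]; rewrite ?mxE (negbTE nab) eqxx //; first exact: Aa0.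
    by rewrite -yd ?Aa1 // -?val_eqE /=; lia.
  - have [Ac Ac0 Ac1] := H c; rewrite yd // in Ac Ac0.
    split=> [|j lj|c' lc]; rewrite ?mxE (negbTE ca) (negbTE cb) //; first exact: Ac0.
    have -> : x c' = y (tperm a b c') by rewrite E tpermK.
    case: tpermP => [c'a|c'b|_ _]; apply: Ac1; rewrite ?ab //;
      by move: ca cb lc; rewrite -!val_eqE /= ?c'a ?c'b; lia.
exists (fun j => if j is j'.+1 then z j' else c0) => /=.
rewrite [word_mx _ _]zE (mul_braid_mx _ _ ai bi); apply/matrixP=> r j.
rewrite !mxE !eqxx (negbTE nab).
have [->|ra] // := eqVneq r a; have [->|rb] // := eqVneq r b.
ring.
Qed.

(** The variable is the coefficient of the old row [b] in the new one. It is seen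
    in the pivot column of the old row [b], as the old row [a] vanishes there. *)
Lemma word_mx_head s i z a b : ascending n (i :: s) -> a.+1 = i -> b = i :> nat ->
  word_mx (i :: s) z b ((word_perm n (i :: s))^-1%g a) = z 0%N /\
  word_mx s (z \o S) = peel a b (z 0%N) (word_mx (i :: s) z).
Proof.
case=> _ as_s lt ai bi; have ab : b = a.+1 :> nat by rewrite bi.
have nab : b != a by rewrite -val_eqE /= ab; lia.
rewrite (word_permV s ai bi) tpermL /= (mul_braid_mx _ _ ai bi); split; last first.
  apply/matrixP=> r j; rewrite !mxE !eqxx (negbTE nab).
  have [->|ra] // := eqVneq r a; last by have [->|rb] := eqVneq r b.
  ring.
have H := word_row_pivots (z \o S) as_s.
have [Aa Aa0 Aa1] := H a; have [Ab Ab0 Ab1] := H b.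
by rewrite mxE (negbTE nab) eqxx Ab mulr1 Aa1 ?ab // add0r.
Qed.

Lemma word_mx_inj s z z' : ascending n s -> word_mx s z = word_mx s z' ->
  forall j, (j < size s)%N -> z j = z' j.
Proof.
elim: s z z' => [|i s IH] z z' //= as_s; have [/letter_ord [a [b [ai bi]]] as' lt] := as_s.
have [e1 e2] := word_mx_head z as_s ai bi.
have [e1' e2'] := word_mx_head z' as_s ai bi.
move=> /= E; rewrite /= E in e1 e2; move: e1 e2'; rewrite e1' => ez; rewrite ez -e2 => e.
case=> [|j] //= lj.
by have := IH _ _ as' e j lj.
Qed.

End Words.

(** * Reducing matrices as solutions of linear systems *)

Section Pivots.
Variables (K : closedFieldType) (n : nat).
Implicit Types (A h : 'M[K]_n) (x : 'S_n).

Lemma unitmx_left_kernel A : (forall r : 'rV_n, r *m A = 0 -> r = 0) -> A \in unitmx.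
Proof.
move=> H; rewrite -row_free_unit; apply/row_freeP.
have : kermx A = 0.
  by apply/row_matrixP => i; rewrite row0; apply: H; rewrite -row_mul mulmx_ker row0.
move/eqP; rewrite kermx_eq0 => /row_freeP.
exact.
Qed.

(** Up to the order of its rows, [A] is upper unitriangular. *)
Lemma row_pivots_unit x A : row_pivots x A -> A \in unitmx.
Proof.
move=> H; have -> : A = perm_mx x *m row_perm x^-1%g A.
  by rewrite -row_permE -row_permM mulgV row_perm1.
rewrite unitmx_mul unitmx_perm /= -unitmx_tr unitmxE det_trig.
  rewrite big1 ?unitr1 // => i _; rewrite !mxE.
  by have [] := H (x^-1%g i); rewrite permKV.
apply/is_trig_mxP => i j lt; rewrite !mxE.
by have [_ + _] := H (x^-1%g j); rewrite permKV; apply.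
Qed.

Lemma upper_unit_diag A : upper_triangular A -> A \in unitmx -> forall i, A i i != 0.
Proof.
rewrite -unitmx_tr unitmxE => /det_trig ->; rewrite unitfE => + i.
by apply: contraNneq => E; rewrite (bigD1 i) //= mxE E mul0r.
Qed.

(** Row [c] of the reducing matrix solves the linear system whose equations are
    the vanishing of [A *m h] left of the diagonal, and the prescribed values
    of [A] in the pivot columns of the rows [c' >= c]. *)
Definition pivot_system x (c : 'I_n) h : 'M[K]_n :=
  \matrix_(j, c') if (c' < c)%N then h j c' else (j == x c')%:R.

Lemma pivot_systemP x A h c : row_pivots x A -> upper_triangular (A *m h) ->
  row c A *m pivot_system x c h = delta_mx 0 c.
Proof.
move=> H /upperP U; apply/rowP=> c'; rewrite !mxE eqxx /=.
under eq_bigr => j _ do rewrite !mxE.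
case: ltnP => lc.
  rewrite -val_eqE /= ltn_eqF //.
  by move: (U c c' lc); rewrite mxE.
rewrite (bigD1 (x c')) //= eqxx mulr1 big1 ?addr0 => [|j /negbTE ->]; last by rewrite mulr0.
have [Hc _ Hc'] := H c.
move: lc; rewrite leq_eqVlt => /orP [/eqP/val_inj <-|lc]; first by rewrite eqxx.
by rewrite Hc' // -val_eqE /= gtn_eqF.
Qed.

(** In the basis formed by the rows of [A], the system is block diagonal: the
    columns left of [c] give an upper triangular block, with the diagonal entries
    of [A *m h], and the others a lower unitriangular block. *)
Lemma pivot_system_unit x A h c : row_pivots x A -> upper_triangular (A *m h) ->
  h \in unitmx -> pivot_system x c h \in unitmx.
Proof.
move=> H U uh; have uA := row_pivots_unit H.
have uAh : A *m h \in unitmx by rewrite unitmx_mul uA.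
have dg := upper_unit_diag U uAh; move/upperP: U => U.
apply: unitmx_left_kernel => r r0.
have rE : r = r *m invmx A *m A by rewrite mulmxKV.
set sg := r *m invmx A in rE.
have rh (c' : 'I_n) : (c' < c)%N -> (sg *m (A *m h)) 0 c' = 0.
  move=> lc; rewrite mulmxA -rE; move/rowP/(_ c'): r0; rewrite !mxE.
  by apply: etrans; apply: eq_bigr => j _; rewrite mxE lc.
have s0 (c' : 'I_n) : (c' < c)%N -> sg 0 c' = 0.
  elim/ltn_ind: {c'}(val c') {-2}c' (erefl (val c')) => d IH c' /= ed lc.
  move: (rh c' lc); rewrite mxE (bigD1 c') //= big1 ?addr0 => [|j jc'].
    by move/eqP; rewrite mulf_eq0 (negbTE (dg c')) orbF => /eqP.
  case: (ltngtP j c') => lj; last by rewrite (val_inj lj) eqxx in jc'.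
    by rewrite (IH j) ?mul0r -?ed //; lia.
  by rewrite U ?mulr0.
have rx (c' : 'I_n) : (c <= c')%N -> r 0 (x c') = 0.
  move=> lc; move/rowP/(_ c'): r0; rewrite !mxE (bigD1 (x c')) //= mxE ltnNge lc /=.
  rewrite eqxx mulr1 big1 ?addr0 // => j /negbTE jx.
  by rewrite mxE ltnNge lc /= jx mulr0.
have s1 (c' : 'I_n) : (c <= c')%N -> sg 0 c' = 0.
  elim/ltn_ind: {c'}(n - val c')%N {-2}c' (erefl (n - val c')%N) => d IH c' /= ed lc.
  move: (rx c' lc); rewrite rE mxE (bigD1 c') //= big1 ?addr0 => [|j jc'].
    by have [-> _ _] := H c'; rewrite mulr1.
  case: (ltngtP j c') => lj; last by rewrite (val_inj lj) eqxx in jc'.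
    by have [_ _ ->] := H j; rewrite ?mulr0.
  by rewrite (IH (n - j)%N) ?mul0r //; have := ltn_ord j; lia.
suff s_0 : sg = 0 by rewrite rE s_0 mul0mx.
by apply/rowP=> c'; rewrite [RHS]mxE; case: (ltnP c' c) => lc; [apply: s0|apply: s1].
Qed.

Lemma row_pivots_row x A h c : row_pivots x A -> upper_triangular (A *m h) ->
  h \in unitmx -> row c A = delta_mx 0 c *m invmx (pivot_system x c h).
Proof.
move=> H U uh; rewrite -(pivot_systemP c H U) mulmxK //.
exact: pivot_system_unit H U uh.
Qed.

Lemma row_pivots_unique x A A' h : row_pivots x A -> upper_triangular (A *m h) ->
  row_pivots x A' -> upper_triangular (A' *m h) -> h \in unitmx -> A = A'.
Proof.
move=> H U H' U' uh; apply/row_matrixP=> c.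
by rewrite (row_pivots_row c H U uh) (row_pivots_row c H' U' uh).
Qed.

Variables (X : fspace K) (rX : ringed X).

Lemma regmx_row_pivots x (A h : X -> 'M[K]_n) : regmx h ->
  (forall p, [/\ row_pivots x (A p), upper_triangular (A p *m h p) &
              h p \in unitmx]) -> regmx A.
Proof.
move=> rh H c j.
apply: (@eq_regf _ _ (fun p =>
   (delta_mx 0 c *m invmx (pivot_system x c (h p))) (0 : 'I_1) j)) => [p|].
  by have [H1 H2 H3] := H p; rewrite -(row_pivots_row c H1 H2 H3) mxE.
apply: regmxM => //; first exact: regmx_const.
apply: regmx_inv => // [c' j'|p]; last first.
  by have [H1 H2 H3] := H p; apply: pivot_system_unit H1 H2 H3.
case lc: (j' < c)%N.
  by apply: eq_regf (rh c' j') => p; rewrite mxE lc.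
by apply: eq_regf (regf_const rX (c' == x j')%:R) => p; rewrite mxE lc.
Qed.

Lemma regmx_word s (z : X -> nat -> K) : (forall j, (j < size s)%N -> regf (z^~ j)) ->
  regmx (fun p => word_mx n s (z p)).
Proof.
elim: s z => [|i s IH] z rz /=; first exact: regmx_const.
apply: regmxM => //; last by apply: IH => j; apply: (rz j.+1).
move=> a b.
apply: (@eq_regf _ _ (fun p => if (a.+1 == i) && (b.+1 == i) then 0
    else if (a.+1 == i) && (b == i :> nat) then 1
    else if (a == i :> nat) && (b.+1 == i) then 1
    else if (a == i :> nat) && (b == i :> nat) then z p 0%N
    else (a == b)%:R)) => [p|]; first by rewrite mxE.
by do 4![case: (_ && _); first by [apply: regf_const | apply: (rz 0%N)]]; apply: regf_const.
Qed.

Lemma regf_word_coords s (z : X -> nat -> K) : ascending n s ->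
  regmx (fun p => word_mx n s (z p)) -> forall j, (j < size s)%N -> regf (z^~ j).
Proof.
elim: s z => [|i s IH] z //= as_s rA.
have [/letter_ord [a [b [ai bi]]] as' lt] := as_s.
have r0 : regf (z^~ 0%N).
  apply: (eq_regf _ (rA b ((word_perm n (i :: s))^-1%g a))) => p.
  by have [e _] := word_mx_head (z p) as_s ai bi; exact: e.
case=> [|j] // lj; apply: (IH (fun p => z p \o S) as' _ j lj) => r c.
apply: (@eq_regf _ _ (fun p => peel a b (z p 0%N) (word_mx n (i :: s) (z p)) r c)) => [p|].
  by have [_ e] := word_mx_head (z p) as_s ai bi; rewrite -e.
have [ra|ra] := eqVneq r a.
  apply: (@eq_regf _ _ (fun p => word_mx n (i :: s) (z p) b c -
      z p 0%N * word_mx n (i :: s) (z p) a c)) => [p|]; first by rewrite [RHS]mxE ra eqxx.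
  by apply: regfB => //; apply: regfM.
have [rb|rb] := eqVneq r b.
  by apply: eq_regf (rA a c) => p; rewrite [RHS]mxE (negbTE ra) rb eqxx.
by apply: eq_regf (rA r c) => p; rewrite [RHS]mxE (negbTE ra) (negbTE rb).
Qed.

Lemma regf_coords m (z : X -> 'rV[K]_m) : regmx z -> forall j, regf (fun p => coords (z p) j).
Proof.
move=> rz j; rewrite /coords; case: insub => [i|]; first exact: rz.
exact: regf_const.
Qed.

End Pivots.

(** * Braid varieties and Richardson varieties *)

Section Richardson.
Variables (K : closedFieldType) (n : nat).
Implicit Types (A g : 'M[K]_n) (u v w x : 'S_n) (s : seq nat).

(** The image of [row_pivots] under the reversal of the columns. *)
Definition row_leads u A := forall c, [/\ A c (u c) = 1,
  (forall j : 'I_n, (u c < j)%N -> A c j = 0) &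
  (forall c' : 'I_n, (c < c')%N -> A c (u c') = 0)].

(** The canonical representatives of the flags in the cell [B w B / B]. *)
Definition col_pivots w g := forall c, [/\ g (w c) c = 1,
  (forall j : 'I_n, (w c < j)%N -> g j c = 0) &
  (forall c' : 'I_n, (c' < c)%N -> g (w c') c = 0)].

(** The open Richardson variety, realized by canonical representatives: here
    [permutation_mx K u *m L] is lower triangular, so that [g] is in [B_- u B]. *)
Definition richardson_slice u w : set 'M[K]_n := [set g |
  col_pivots w g /\ exists L, row_leads u L /\ upper_triangular (L *m g)].

Local Notation W := (permutation_mx K (longest n)).

Lemma longestE (i : 'I_n) : longest n i = rev_ord i.
Proof. by rewrite permE. Qed.

Lemma longestV : (longest n)^-1%g = longest n.
Proof.
apply/permP => i; apply: (@perm_inj _ (longest n)).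
by rewrite permKV !longestE rev_ordK.
Qed.

Lemma mul_perm_mxr v m (A : 'M[K]_(m, n)) i j : (A *m permutation_mx K v) i j = A i (v j).
Proof. by rewrite -col_permE mxE. Qed.

Lemma mul_perm_mxl v m (A : 'M[K]_(n, m)) i j :
  (permutation_mx K v *m A) i j = A (v^-1%g i) j.
Proof. by rewrite -row_permE mxE. Qed.

Lemma mul_longest_mxr m (A : 'M[K]_(m, n)) i j : (A *m W) i j = A i (rev_ord j).
Proof. by rewrite mul_perm_mxr longestE. Qed.

Lemma mul_longest_mxl m (A : 'M[K]_(n, m)) i j : (W *m A) i j = A (rev_ord i) j.
Proof. by rewrite mul_perm_mxl longestV longestE. Qed.

Lemma longest_mxK : W *m W = 1%:M.
Proof. by rewrite -perm_mxM -invMg -{1}longestV mulVg invg1 perm_mx1. Qed.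

Lemma permutation_mx_unit v : permutation_mx K v \in unitmx.
Proof. exact: unitmx_perm. Qed.

Lemma ltn_rev (i j : 'I_n) : (rev_ord i < rev_ord j)%N = (j < i)%N.
Proof. by rewrite /=; have := ltn_ord i; have := ltn_ord j; lia. Qed.

Lemma row_pivots_leads u x A : (forall c, x c = rev_ord (u c)) ->
  row_pivots x A <-> row_leads u (A *m W).
Proof.
move=> E; split=> H c; have [H1 H2 H3] := H c; rewrite !mul_longest_mxr in H1 H2 H3 *.
  split=> [|j lj|c' lc]; rewrite ?mul_longest_mxr -?E //; last exact: H3.
  by apply: H2; rewrite E ltn_rev.
rewrite E; split=> // [j lj|c' lc].
  by rewrite -[j]rev_ordK -mul_longest_mxr H2 // -ltn_rev rev_ordK.
by rewrite E -mul_longest_mxr H3.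
Qed.

Lemma row_pivots_cols w x A : (forall c, x (rev_ord (w c)) = rev_ord c) ->
  row_pivots x A <-> col_pivots w (W *m A *m W).
Proof.
move=> E; split=> H c.
  have [H1 H2 H3] := H (rev_ord (w c)).
  rewrite E in H1 H2; rewrite mul_longest_mxr mul_longest_mxl.
  split=> // [j lj|c' lc]; rewrite mul_longest_mxr mul_longest_mxl.
    by rewrite -(E c); have [_ _ ->] := H (rev_ord j); rewrite ?ltn_rev.
  by have [_ Hj _] := H (rev_ord (w c')); rewrite Hj // E ltn_rev.
pose d := w^-1%g (rev_ord c).
have cE : c = rev_ord (w d) by rewrite permKV rev_ordK.
have [H1 H2 H3] := H d; rewrite cE E.
rewrite mul_longest_mxr mul_longest_mxl in H1; split=> // [j|c' lc].
  rewrite -{1}[j]rev_ordK ltn_rev => lj.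
  have [_ _ Hj] := H (rev_ord j).
  by have := Hj d lj; rewrite mul_longest_mxr mul_longest_mxl rev_ordK.
pose d' := w^-1%g (rev_ord c').
have cE' : c' = rev_ord (w d') by rewrite permKV rev_ordK.
have [_ Hj _] := H d'; rewrite cE' E.
rewrite cE' ltn_rev in lc.
by have := Hj _ lc; rewrite mul_longest_mxr mul_longest_mxl.
Qed.

Lemma col_pivots_unit w g : col_pivots w g -> g \in unitmx.
Proof.
move=> H; pose x := ((longest n) * w^-1 * (longest n))%g.
have : W *m g *m W \in unitmx.
  apply: (@row_pivots_unit _ _ x); apply/(@row_pivots_cols w x) => [c|].
    by rewrite /x !permM !longestE rev_ordK permK.
  by rewrite -!mulmxA longest_mxK mulmx1 mulmxA longest_mxK mul1mx.
by rewrite !unitmx_mul permutation_mx_unit andbT.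
Qed.

(** The second word parametrizes the representatives [g] of the flags in
    [B w B / B], and the first one the matrices which reduce them. *)
Lemma braid_variety_richardson u w (a b : seq nat) :
  reduced_word a (compp u^-1%g (longest n)) ->
  reduced_word b (compp (longest n) (compp w (longest n))) ->
  isomorphic (subspace (braid_variety K (a ++ b) (longest n)))
    (subspace (richardson_slice u w : set (affine_space K n n))).
Proof.
move=> ra rb.
have asa := reduced_ascending ra; have asb := reduced_ascending rb.
have ea : word_perm n a = compp u^-1%g (longest n) by case: ra.
have eb : word_perm n b = compp (longest n) (compp w (longest n)) by case: rb.
have xa c : (word_perm n a)^-1%g c = rev_ord (u c).
  by rewrite ea /compp invMg invgK permM longestV longestE.
have xb c : (word_perm n b)^-1%g (rev_ord (w c)) = rev_ord c.
  by rewrite eb /compp !invMg !permM longestV !longestE rev_ordK permK.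
pose za (z : 'rV[K]_(size (a ++ b))) j := coords z j.
pose zb (z : 'rV[K]_(size (a ++ b))) j := coords z (size a + j).
have XE (z : 'rV[K]_(size (a ++ b))) : braid_variety K (a ++ b) (longest n) z =
    upper_triangular (word_mx n a (za z) *m W *m (W *m word_mx n b (zb z) *m W)).
  rewrite /braid_variety /= braid_word_mxE word_mx_cat -!mulmxA.
  by rewrite [W *m (W *m _)]mulmxA longest_mxK mul1mx.
have WWK (A : 'M[K]_n) : W *m (W *m A *m W) *m W = A.
  by rewrite -!mulmxA longest_mxK mulmx1 mulmxA longest_mxK mul1mx.
apply: (@affine_bijection_isomorphic _ _ _ _ _ _ _
  (fun z => W *m word_mx n b (zb z) *m W)).
- move=> z; rewrite XE => up; split.
    exact/(row_pivots_cols _ xb)/word_row_pivots.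
  exists (word_mx n a (za z) *m W); split=> //.
  exact/(row_pivots_leads _ xa)/word_row_pivots.
- move=> z z'; rewrite !XE => up up' E.
  have Eb : word_mx n b (zb z) = word_mx n b (zb z').
    by rewrite -[LHS]WWK E WWK.
  have Ea : word_mx n a (za z) = word_mx n a (za z').
    pose h := W *m (W *m word_mx n b (zb z) *m W).
    apply: (@row_pivots_unique _ _ (word_perm n a)^-1%g _ _ h).
    + exact: word_row_pivots.
    + by rewrite mulmxA.
    + exact: word_row_pivots.
    + by rewrite /h E mulmxA.
    + rewrite !unitmx_mul permutation_mx_unit word_mx_unit //.
      exact: ascending_word.
  apply/rowP=> j; rewrite -!coordsE.
  have [lj|lj] := ltnP j (size a); first exact: (word_mx_inj asa Ea lj).
  have := word_mx_inj asb Eb; move=> /(_ (j - size a)%N).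
  rewrite /zb subnKC //; apply; have := ltn_ord j; rewrite {2}size_cat; lia.
- move=> g [gw [L [Lu up]]].
  have [|ya yaE] := @row_pivots_word _ _ _ (L *m W) asa.
    by apply/(row_pivots_leads _ xa); rewrite -mulmxA longest_mxK mulmx1.
  have [|yb ybE] := @row_pivots_word _ _ _ (W *m g *m W) asb.
    by apply/(row_pivots_cols _ xb); rewrite WWK.
  pose z : 'rV[K]_(size (a ++ b)) := \row_j if (j < size a)%N then ya j else yb (j - size a)%N.
  have zE j : (j < size (a ++ b))%N ->
      coords z j = if (j < size a)%N then ya j else yb (j - size a)%N.
    by move=> lj; rewrite -[j]/(val (Ordinal lj)) coordsE mxE.
  have zaE : word_mx n a (za z) = L *m W.
    rewrite -yaE; apply: eq_word_mx => j lj; rewrite /za zE ?lj //.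
    by rewrite size_cat ltn_addr.
  have zbE : word_mx n b (zb z) = W *m g *m W.
    rewrite -ybE; apply: eq_word_mx => j lj; rewrite /zb zE ?size_cat ?ltn_add2l //.
    by rewrite ltnNge leq_addr /= addKn.
  exists z; last by rewrite zbE WWK.
  by rewrite XE zaE zbE WWK -(mulmxA L) longest_mxK mulmx1.
- have rX := subspace_ringed (braid_variety K (a ++ b) (longest n))
     (affine_ringed K 1 (size (a ++ b))).
  apply: regmxM => //; last exact: regmx_const.
  apply: regmxM => //; first exact: regmx_const.
  apply: regmx_word => // j _; apply: (regf_coords rX); exact: regmx_sval.
- move=> z zE.
  set X := subspace (richardson_slice u w : set (affine_space K n n)).
  have rX : ringed X by apply/subspace_ringed/affine_ringed.
  have rg : @regmx K X n n
     (fun p => sval p) by exact: regmx_sval.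
  have rB : @regmx K X n n
     (fun p => word_mx n b (zb (z p))).
    move=> i j; apply: (@eq_regf K X (fun p => (W *m sval p *m W) i j)) => [p|].
      by rewrite -(zE p).2 WWK.
    by apply: regmxM => //; [apply: regmxM => //|]; apply: regmx_const.
  have rA : @regmx K X n n
     (fun p => word_mx n a (za (z p))).
    apply: (@regmx_row_pivots K n X rX (word_perm n a)^-1%g _ (fun p => W *m sval p)).
      by apply: (regmxM rX _ rg); apply: (regmx_const rX).
    move=> p; split; first exact: word_row_pivots.
      by have := (zE p).1; rewrite XE (zE p).2 mulmxA.
    rewrite unitmx_mul permutation_mx_unit.
    by have [/col_pivots_unit gu _] := svalP p.
  move=> i j; rewrite ord1.
  have [lj|lj] := ltnP j (size a).
    apply: (eq_regf _ (regf_word_coords rX asa rA lj)) => p.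
    by rewrite /za coordsE.
  have lj' : (j - size a < size b)%N by have := ltn_ord j; rewrite {2}size_cat; lia.
  apply: (eq_regf _ (regf_word_coords rX asb rB lj')) => p.
  by rewrite /zb subnKC // coordsE.
Qed.

End Richardson.

(** * Elimination in Bruhat cells *)

Section Triangular.
Variables (K : closedFieldType) (n : nat).
Implicit Types (A B g : 'M[K]_n) (u v w : 'S_n).

Local Notation W := (permutation_mx K (longest n)).

Lemma upper_mul A B : upper_triangular A -> upper_triangular B ->
  upper_triangular (A *m B).
Proof.
move=> /upperP uA /upperP uB; apply/upperP=> i j lij; rewrite mxE big1 // => l _.
by case: (ltnP l i) => ll; [rewrite uA ?mul0r | rewrite uB ?mulr0 //; lia].
Qed.

(** The entries of the inverse below the diagonal vanish column after column, by
    comparing the entries of [invmx A *m A = 1]. *)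
Lemma upper_inv A : upper_triangular A -> A \in unitmx -> upper_triangular (invmx A).
Proof.
move=> ua uA; have dA := upper_unit_diag ua uA; move/upperP: ua => ua.
apply/upperP=> i j; elim/ltn_ind: {j}(val j) {-2}j (erefl (val j)) => d IH j /= ed lij.
have /matrixP/(_ i j) := mulVmx uA; rewrite !mxE (bigD1 j) //= big1 ?addr0 => [|l lj].
  by rewrite -val_eqE /= gtn_eqF // => /eqP; rewrite mulf_eq0 (negbTE (dA j)) orbF => /eqP.
case: (ltngtP l j) => ll; last by rewrite (val_inj ll) eqxx in lj.
  by rewrite (IH l) ?mul0r -?ed //; lia.
by rewrite ua ?mulr0.
Qed.

Lemma lower_inv A : lower_triangular A -> A \in unitmx -> lower_triangular (invmx A).
Proof.
move=> la uA; have := @upper_inv A^T; rewrite /upper_triangular trmxK unitmx_tr.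
by rewrite -trmx_inv trmxK; apply.
Qed.

Lemma lower_unit_diag A : lower_triangular A -> A \in unitmx -> forall i, A i i != 0.
Proof.
move=> la uA i; have := @upper_unit_diag _ _ A^T.
by rewrite /upper_triangular trmxK unitmx_tr => /(_ la uA i); rewrite mxE.
Qed.

(** The rows are treated from the last one up: each is cleared, by multiples of
    later rows, in the pivot columns of these. A later row whose pivot is to the
    right of the last nonzero entry is not called for, so that the shape is kept. *)
Lemma row_leads_exists u A : (forall c, A c (u c) != 0) ->
  (forall c j : 'I_n, (u c < j)%N -> A c j = 0) ->
  exists U, upper_triangular U /\ row_leads u (U *m A).
Proof.
move=> nz tri.
pose good (c : 'I_n) e (r : 'rV[K]_n) := [/\ (r *m A) 0 (u c) = 1,
  (forall j : 'I_n, (j < c)%N -> r 0 j = 0),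
  (forall j : 'I_n, (u c < j)%N -> (r *m A) 0 j = 0) &
  (forall c' : 'I_n, (c < c')%N -> (e <= c')%N -> (r *m A) 0 (u c') = 0)].
suff H c : exists r, good c 0%N r.
  have [U UE] := choice H; exists (\matrix_c U c); split.
    by apply/upperP=> i j lij; rewrite mxE; have [_ r0 _ _] := UE i; exact: r0.
  have E c j : ((\matrix_c U c) *m A) c j = (U c *m A) 0 j.
    have -> : U c = row c (\matrix_c U c) by rewrite rowK.
    by rewrite -row_mul [RHS]mxE.
  move=> c; have [H1 _ H2 H3] := UE c.
  by split=> [|j|c' lc]; rewrite E //; [exact: H2 | exact: H3].
elim/ltn_ind: {c}(n - val c)%N {-2}c (erefl (n - val c)%N) => d IH c /= ed.
have {}IH (c' : 'I_n) : (c < c')%N -> exists r, good c' 0%N r.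
  by move=> lc; apply: (IH (n - c')%N) => //; have := ltn_ord c'; lia.
(* Column by column, starting with the pivot of the last row: a row cleared
   earlier vanishes at the pivots after its own, which stay cleared. *)
suff main f : (f <= n)%N -> exists r, good c (n - f)%N r.
  by have := main n (leqnn n); rewrite subnn.
elim: f => [_|f IHf lf].
  have E j : (((A c (u c))^-1 *: delta_mx 0 c) *m A) (0 : 'I_1) j = (A c (u c))^-1 * A c j.
    by rewrite -scalemxAl -rowE !mxE.
  exists ((A c (u c))^-1 *: delta_mx 0 c); split=> [|j lj|j lj|c' _].
  - by rewrite E mulVf.
  - by rewrite !mxE eqxx /= -val_eqE /= ltn_eqF // mulr0.
  - by rewrite E (tri c j lj) mulr0.
  - by rewrite subn0 leqNgt ltn_ord.
have [r [r1 r2 r3 r4]] := IHf (ltnW lf).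
have lf' : (n - f.+1 < n)%N by lia.
pose e := Ordinal lf'; have [lce|lec] := ltnP c e; last first.
  exists r; split=> // c' lc lc'; apply: r4 => //; move: lec lc' lc; rewrite /=; lia.
have [re|re] := eqVneq ((r *m A) 0 (u e)) 0.
  exists r; split=> // c' lc; have [/val_inj <- //|ne lc'] := eqVneq (val e) (val c').
  by apply: r4 => //; move: ne lc'; rewrite /=; lia.
have [t [t1 t2 t3 t4]] := IH _ lce.
have lu : (u e < u c)%N.
  case: (ltngtP (u e) (u c)) => // [lt|/val_inj/perm_inj E]; first by rewrite r3 ?eqxx in re.
  by rewrite E ltnn in lce.
have E j : ((r - (r *m A) 0 (u e) *: t) *m A) 0 j =
    (r *m A) 0 j - (r *m A) 0 (u e) * (t *m A) 0 j.
  by rewrite mulmxBl -scalemxAl !mxE.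
exists (r - (r *m A) 0 (u e) *: t); split=> [|j lj|j lj|c' lc lc'].
- by rewrite E r1 t3 // mulr0 subr0.
- by rewrite !mxE r2 // t2 ?mulr0 ?subr0 //; exact: ltn_trans lce.
- by rewrite E r3 // t3 ?mulr0 ?subr0 //; exact: ltn_trans lj.
- rewrite E; have [/val_inj <-|ne] := eqVneq (val e) (val c'); first by rewrite t1 mulr1 subrr.
  have l1 : (n - f <= c')%N by move: ne lc'; rewrite /=; lia.
  rewrite r4 // t4 ?mulr0 ?subr0 //=; lia.
Qed.

(** Transposition and the reversal of the rows turn this into
    [row_leads_exists]. *)
Lemma col_pivots_exists w A : (forall c, A (w c) c != 0) ->
  (forall c j : 'I_n, (w c < j)%N -> A j c = 0) ->
  exists U, upper_triangular U /\ col_pivots w (A *m U).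
Proof.
move=> nz tri; pose x := (longest n * w)%g.
have xE c : x c = w (rev_ord c) by rewrite permM longestE.
have [c|c j lj|U [/upperP uU UE]] := @row_leads_exists x (W *m A^T).
- by rewrite mul_longest_mxl mxE xE.
- by rewrite mul_longest_mxl mxE tri // -xE.
have tE v : (permutation_mx K v)^T = permutation_mx K v^-1%g by rewrite tr_perm_mx.
have E : A *m (W *m U^T *m W) = (U *m (W *m A^T))^T *m W.
  by rewrite !trmx_mul trmxK tE longestV !mulmxA.
exists (W *m U^T *m W); rewrite E; split.
  apply/upperP=> i j lij; rewrite mul_longest_mxr mul_longest_mxl mxE uU //.
  by rewrite ltn_rev.
move=> c; have [H1 H2 H3] := UE (rev_ord c); rewrite xE rev_ordK in H1 H2.
split=> [|j lj|c' lc]; rewrite mul_longest_mxr mxE //; first exact: H2.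
by have := H3 (rev_ord c'); rewrite xE rev_ordK ltn_rev; apply.
Qed.

End Triangular.

(** * Projection to the Grassmannian *)

Section Positroid.
Variables (K : closedFieldType) (n k : nat).
Implicit Types (A B m : 'M[K]_n) (u v w : 'S_n) (g h x y z : GL K n).

Definition gl A (uA : A \in unitmx) : GL K n := exist _ A uA.

Lemma GL_unit g : GLmx g \in unitmx.
Proof. exact: (svalP g). Qed.

Lemma to_coset_eq (H : set (GL K n)) g g' b c : H b -> H c ->
  (forall x y z, H x -> H y -> GLmx z = GLmx x *m GLmx y -> H z) ->
  GLmx b *m GLmx c = 1%:M -> GLmx g = GLmx g' *m GLmx b ->
  to_coset H g = to_coset H g'.
Proof.
move=> Hb Hc HM bc E.
have cb := mulmx1C bc.
have umul (x y : GL K n) : GLmx x *m GLmx y \in unitmx.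
  by rewrite unitmx_mul; apply/andP; split; apply: GL_unit.
apply: eq_exist; rewrite /Defs.coset; apply/seteqP; split=> A [h Hh <-].
  exists (gl (umul b h)); first exact: HM Hb Hh _.
  by rewrite /GLmx /= -!/(GLmx _) E mulmxA.
exists (gl (umul c h)); first exact: HM Hc Hh _.
by rewrite /GLmx /= -!/(GLmx _) E -mulmxA [GLmx b *m (_ *m _)]mulmxA bc mul1mx.
Qed.

Lemma to_coset_inv (H : set (GL K n)) g g' : (forall h, GLmx h = 1%:M -> H h) ->
  to_coset H g = to_coset H g' -> exists2 h, H h & GLmx g' = GLmx g *m GLmx h.
Proof.
move=> H1 /(congr1 sval) /= E.
have : Defs.coset H g' (GLmx g').
  by exists (gl (unitmx1 K n)); [apply: H1 | rewrite [X in _ *m X]/GLmx /= mulmx1].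
by rewrite -E => -[h Hh <-]; exists h.
Qed.

Lemma borel1 g : GLmx g = 1%:M -> borel g.
Proof. by move=> E; apply/upperP=> i j lij; rewrite E mxE -val_eqE /= gtn_eqF. Qed.

Lemma borelM x y z : borel x -> borel y -> GLmx z = GLmx x *m GLmx y -> borel z.
Proof. by rewrite /borel /= => bx b_y ->; apply: upper_mul. Qed.

Lemma parabolic1 g : GLmx g = 1%:M -> parabolic k g.
Proof. by move=> E i j ki jk; rewrite E mxE -val_eqE /= gtn_eqF //; lia. Qed.

Lemma parabolicM x y z : parabolic k x -> parabolic k y ->
  GLmx z = GLmx x *m GLmx y -> parabolic k z.
Proof.
move=> px py E i j ki jk; rewrite E mxE big1 // => l _.
by case: (ltnP l k) => ll; [rewrite px ?mul0r | rewrite py ?mulr0].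
Qed.

Lemma borel_parabolic g : borel g -> parabolic k g.
Proof. by move/upperP=> H i j ki jk; apply: H; lia. Qed.

Lemma to_coset_upper (H : set (GL K n)) g g' B :
  (forall x, borel x -> H x) ->
  (forall x y z, H x -> H y -> GLmx z = GLmx x *m GLmx y -> H z) ->
  upper_triangular B -> GLmx g = GLmx g' *m B -> to_coset H g = to_coset H g'.
Proof.
move=> HB HM uB E.
have B1 : B \in unitmx by have := GL_unit g; rewrite E unitmx_mul => /andP [].
have B2 : invmx B \in unitmx by rewrite unitmx_inv.
apply: (@to_coset_eq _ _ _ (gl B1) (gl B2)) => //; try apply: HB.
- exact: uB.
- exact: upper_inv.
- exact: mulmxV.
Qed.

(** For [w] minimal in its coset, a matrix of the slice is determined by its
    first [k] columns, and these by their span. *)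
Definition echelon_frame w A : 'M[K]_n :=
  \matrix_(i, j) if (j < k)%N then A i j else (i == w j)%:R.

(** The rows [w(1), ..., w(k)] of the first [k] columns, completed by an identity
    block in order to stay in size [n]; its determinant is a Pluecker
    coordinate. *)
Definition echelon_minor w A : 'M[K]_n :=
  \matrix_(a, b) if (a < k)%N && (b < k)%N then A (w a) b else (a == b)%:R.

(** The upper left block of an element of the parabolic subgroup, completed by
    an identity block: the rest of it does not affect the first [k] columns. *)
Definition levi_part A : 'M[K]_n :=
  \matrix_(a, b) if (a < k)%N && (b < k)%N then A a b else (a == b)%:R.

(** A vector of the kernel of the block is, extended by zero, in the kernel of
    the whole matrix. *)
Lemma levi_part_unit g : parabolic k g -> levi_part (GLmx g) \in unitmx.
Proof.
move=> pg; rewrite -unitmx_tr; apply: unitmx_left_kernel => r r0.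
have rk (a : 'I_n) : (k <= a)%N -> r 0 a = 0.
  move=> ka; move/rowP/(_ a): r0; rewrite !mxE (bigD1 a) //= !mxE ltnNge ka /= eqxx mulr1.
  rewrite big1 ?addr0 // => b ba.
  by rewrite !mxE [(a < k)%N]ltnNge ka /= eq_sym (negbTE ba) mulr0.
suff rg : r *m (GLmx g)^T = 0.
  by rewrite -[r](@mulmxK _ _ _ (GLmx g)^T) ?rg ?mul0mx // unitmx_tr GL_unit.
apply/rowP=> a; rewrite !mxE; have [ka|ka] := leqP k a.
  rewrite big1 // => b _; rewrite mxE.
  by have [kb|kb] := leqP k b; [rewrite rk // mul0r | rewrite pg // mulr0].
move/rowP/(_ a): r0; rewrite !mxE => r0; rewrite -[RHS]r0; apply: eq_bigr => b _.
rewrite !mxE ka /=; case: ltnP => // kb.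
by rewrite rk // !mul0r.
Qed.

Lemma echelon_frameM w A g : parabolic k g ->
  echelon_frame w (A *m GLmx g) = echelon_frame w A *m levi_part (GLmx g).
Proof.
move=> pg; apply/matrixP=> i j; rewrite !mxE; case: ltnP => jk.
  apply: eq_bigr => l _; rewrite !mxE jk andbT; case: ltnP => // lk.
  by rewrite pg // mulr0 -[l == j]val_eqE /= gtn_eqF ?mulr0 //; lia.
rewrite (bigD1 j) //= !mxE ltnNge jk /= eqxx mulr1 big1 ?addr0 // => l lj.
by rewrite !mxE [(j < k)%N]ltnNge jk andbF (negbTE lj) mulr0.
Qed.

Lemma echelon_minorM w A g : parabolic k g ->
  echelon_minor w (A *m GLmx g) = echelon_minor w A *m levi_part (GLmx g).
Proof.
move=> pg; apply/matrixP=> i j; rewrite mxE [RHS]mxE.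
have [ik|ik] := ltnP i k; last first.
  rewrite [RHS](bigD1 i) //= !mxE ltnNge ik /= eqxx mul1r big1 ?addr0 // => l li.
  by rewrite mxE ltnNge ik /= eq_sym (negbTE li) mul0r.
have [jk|jk] := ltnP j k; last first.
  rewrite [RHS](bigD1 j) //= !mxE [(j < k)%N]ltnNge jk !andbF /= eqxx mulr1.
  rewrite big1 ?addr0 // => l lj.
  by rewrite [X in _ * X]mxE [(j < k)%N]ltnNge jk andbF (negbTE lj) mulr0.
rewrite mxE; apply: eq_bigr => l _; rewrite !mxE ik jk andbT /=; case: ltnP => // lk.
by rewrite pg // mulr0 -[l == j]val_eqE /= gtn_eqF ?mulr0 //; lia.
Qed.

Section Slice.
Variables (u w : 'S_n).
Hypothesis wG : grassmannian k w.

(** Here [w] is increasing on the last positions, so that the vanishing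
    conditions leave only the pivot in each of the last columns. *)
Lemma echelon_frame_slice m : col_pivots w m -> echelon_frame w m = m.
Proof.
move=> H; apply/matrixP=> i c; rewrite mxE; case: ltnP => // kc.
have [H1 H2 H3] := H c; rewrite -(permKV w i).
set c' := w^-1%g i; rewrite (inj_eq perm_inj).
case: (ltngtP c' c) => lc.
- by rewrite H3 // -val_eqE /= ltn_eqF.
- by rewrite H2 ?(proj2 wG _ _ kc lc) // -val_eqE /= gtn_eqF.
- by rewrite (val_inj lc) eqxx H1.
Qed.

Lemma echelon_minor_slice m : col_pivots w m -> echelon_minor w m = 1%:M.
Proof.
move=> H; apply/matrixP=> c' c; rewrite !mxE; case: ifP => // /andP [kc' kc].
have [H1 H2 H3] := H c.
case: (ltngtP c' c) => lc.
- by rewrite H3 // -val_eqE /= ltn_eqF.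
- by rewrite H2 ?(proj1 wG _ _ lc) // -val_eqE /= gtn_eqF.
- by rewrite (val_inj lc) eqxx H1.
Qed.

(** Column reduction of the first [k] columns to echelon form, which makes the
    rows [w(1), ..., w(k)] an identity block. *)
Definition canonical_form A := echelon_frame w A *m invmx (echelon_minor w A).

Lemma canonical_form_slice m g : col_pivots w m -> parabolic k g ->
  canonical_form (m *m GLmx g) = m.
Proof.
move=> H pg; rewrite /canonical_form echelon_frameM // echelon_minorM //.
rewrite echelon_frame_slice // echelon_minor_slice // mul1mx mulmxK //.
exact: levi_part_unit.
Qed.

Lemma row_leads_unit (L : 'M[K]_n) : row_leads u L -> L \in unitmx.
Proof.
pose x := (u * longest n)%g.
have xE c : x c = rev_ord (u c) by rewrite permM longestE.
move=> Lu; suff : L *m permutation_mx K (longest n) \in unitmx.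
  by rewrite unitmx_mul => /andP [].
apply: (@row_pivots_unit _ _ x); apply/(row_pivots_leads _ xE).
by rewrite -mulmxA longest_mxK mulmx1.
Qed.

Lemma slice_richardson m (um : m \in unitmx) : richardson_slice u w m ->
  open_richardson u w (to_coset (@borel K n) (gl um)).
Proof.
case=> H [L [Lu up]]; have uL := row_leads_unit Lu.
have uL' : invmx L \in unitmx by rewrite unitmx_inv.
have pV v : permutation_mx K v^-1%g *m permutation_mx K v = 1%:M.
  by rewrite -perm_mxM -invMg mulgV invg1 perm_mx1.
have um1 : m *m permutation_mx K w^-1%g \in unitmx.
  by rewrite unitmx_mul um permutation_mx_unit.
have uL1 : invmx L *m permutation_mx K u^-1%g \in unitmx.
  by rewrite unitmx_mul uL' permutation_mx_unit.
split.
  exists (gl um) => //; exists (gl um1); last by rewrite /GLmx /= -mulmxA pV mulmx1.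
  apply/upperP=> i j lij; rewrite /GLmx /= mul_perm_mxr.
  by have [_ H2 _] := H (w^-1%g j); apply: H2; rewrite permKV.
exists (gl uL').
  apply: (@to_coset_upper _ _ _ (L *m m)) => //; first exact: borelM.
  by rewrite /GLmx /= mulKmx.
exists (gl uL1); last by rewrite /GLmx /= -mulmxA pV mulmx1.
rewrite -[borel_opp _]/(is_true (lower_triangular (GLmx (gl uL1)))).
have -> : GLmx (gl uL1) = invmx (permutation_mx K u *m L).
  rewrite /GLmx /=; have uP := permutation_mx_unit K u.
  apply: (can_inj (mulKmx uL)); rewrite mulKVmx //.
  apply: (can_inj (mulKmx uP)); rewrite !mulmxA mulmxV ?unitmx_mul ?uP //.
  by rewrite -[X in _ = X](pV u^-1%g) invgK.
apply: lower_inv; last by rewrite unitmx_mul permutation_mx_unit.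
apply/is_trig_mxP=> i j lij; rewrite mul_perm_mxl.
by have [_ H2 _] := Lu (u^-1%g i); apply: H2; rewrite permKV.
Qed.

(** Both membership conditions are brought to canonical form by elimination,
    the first on columns and the second on rows. *)
Lemma richardson_representative g :
  open_richardson u w (to_coset (@borel K n) g) ->
  exists B, upper_triangular B /\ richardson_slice u w (GLmx g *m B).
Proof.
case=> -[g1 /(to_coset_inv borel1) [b1 b1b e1] [h1 /upperP h1b e1']].
case=> g2 /(to_coset_inv borel1) [b2 b2b e2] [h2 h2b e2'].
have dh1 := upper_unit_diag (introT (upperP _) h1b) (GL_unit h1).
have [c|c j lj|U [uU HU]] := @col_pivots_exists _ _ w (GLmx g1).
- by rewrite e1' mul_perm_mxr.
- by rewrite e1' mul_perm_mxr h1b.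
have h2i := lower_inv h2b (GL_unit h2).
have iE : invmx (GLmx g2) = permutation_mx K u^-1%g *m invmx (GLmx h2).
  apply: (can_inj (mulKmx (GL_unit g2))); rewrite mulmxV ?GL_unit // e2'.
  rewrite -!mulmxA [permutation_mx K u *m _]mulmxA.
  by rewrite -perm_mxM -invMg mulVg invg1 perm_mx1 mul1mx mulmxV ?GL_unit.
have dh2 := lower_unit_diag h2i.
have [c|c j lj|U2 [uU2 HU2]] := @row_leads_exists _ _ u (invmx (GLmx g2)).
- by rewrite iE mul_perm_mxl invgK dh2 // unitmx_inv GL_unit.
- by rewrite iE mul_perm_mxl invgK; move/is_trig_mxP: h2i; apply.
exists (GLmx b1 *m U); split; first exact: upper_mul.
rewrite mulmxA -e1; split=> //; exists (U2 *m invmx (GLmx g2)); split=> //.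
rewrite e1 e2 -!mulmxA; apply: upper_mul => //.
have -> : invmx (GLmx g *m GLmx b2) *m (GLmx g *m (GLmx b1 *m U)) =
    invmx (GLmx b2) *m (GLmx b1 *m U).
  apply: (can_inj (mulKmx (GL_unit g2))); rewrite e2 mulKVmx -?e2 ?GL_unit //.
  by rewrite e2 -!mulmxA mulKVmx // GL_unit.
apply: upper_mul; first exact: (upper_inv b2b (GL_unit b2)).
exact: upper_mul.
Qed.

Notation slice := (richardson_slice u w : set (affine_space K n n)).

Lemma slice_unit m : slice m -> m \in unitmx.
Proof. by case=> /col_pivots_unit. Qed.

Lemma slice_positroid m (sm : slice m) :
  open_positroid K k u w (to_coset (@parabolic K n k) (gl (slice_unit sm))).
Proof. by exists (gl (slice_unit sm)) => //; apply: slice_richardson. Qed.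

Definition slice_point (m : {m : 'M[K]_n | slice m}) :
    {c | open_positroid K k u w c} := exist _ _ (slice_positroid (svalP m)).

Lemma slice_point_morphism :
  Defs.morphism (slice_point :
     subspace slice -> subspace (open_positroid K k u w)).
Proof.
have rX : ringed (subspace slice) by apply/subspace_ringed/affine_ringed.
apply: corestrict_morphism => //.
pose F (m : subspace slice) : GL K n := gl (slice_unit (svalP m)).
have mF : Defs.morphism F.
  apply: corestrict_morphism => //; apply: sval_morphism; exact: affine_ringed.
move=> V oV; have [oF rF] := mF _ oV; split; first exact: oF.
by move=> phi rphi; exact: (rF _ rphi).
Qed.

Lemma slice_point_surj c : exists p, slice_point p = c.
Proof.
case: c => c cY; have [g /= /richardson_representative [B [uB sB]] gc] := cY.
exists (exist _ _ sB); apply: eq_exist => /=; rewrite -gc.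
apply: (@to_coset_upper _ _ _ B) => //; first exact: borel_parabolic.
exact: parabolicM.
Qed.

Lemma slice_point_canonical p g : sval (slice_point p) = to_coset (@parabolic K n k) g ->
  exists h, parabolic k h /\ GLmx g = sval p *m GLmx h.
Proof. by case/(to_coset_inv parabolic1) => h ph E; exists h. Qed.

(** The representative of a point is the canonical form of any matrix in its
    coset. This is regular on the locus where the pivot minor does not vanish,
    which is open and a union of cosets, and contains the positroid variety. *)
Lemma positroid_richardson :
  isomorphic (subspace (open_positroid K k u w)) (subspace slice).
Proof.
have rG : ringed (GL K n) by apply/subspace_ringed/affine_ringed.
have rQ : ringed (grassmann_variety K n k) by exact: quotient_ringed.
have rY := subspace_ringed (open_positroid K k u w) rQ.
have [G GE] := choice slice_point_surj.
have rep_ex (c : grassmann_variety K n k) : exists g, c = to_coset (@parabolic K n k) g.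
  by case: c => c cc; have [g cE] := cc; exists g; apply: eq_exist.
have [rep repE] := choice rep_ex.
have repP g : exists h, parabolic k h /\
    GLmx (rep (to_coset (@parabolic K n k) g)) = GLmx g *m GLmx h.
  have [h ph E] := to_coset_inv parabolic1 (repE (to_coset (@parabolic K n k) g)).
  by exists h.
exists G, slice_point; split; [ | exact: slice_point_morphism | exact: GE | ]; last first.
- move=> m; have E := GE (slice_point m).
  have [h [ph hE]] := slice_point_canonical (repE (sval (slice_point m))).
  have [h' [ph' hE']] := @slice_point_canonical (G (slice_point m)) _
    (etrans (congr1 sval E) (repE _)).
  have [Hm _] := svalP m; have [Hm' _] := svalP (G (slice_point m)).
  case: m (G _) {E} Hm Hm' hE hE' => [m sm] [m' sm'] /= Hm Hm' hE hE'.
  apply: eq_exist; rewrite -(canonical_form_slice Hm ph).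
  by rewrite -(canonical_form_slice Hm' ph') -hE' hE.
- apply: corestrict_morphism => //; apply: regmx_morphism => // i j.
  pose d (g : GL K n) := \det (echelon_minor w (GLmx g)).
  pose num (g : GL K n) := (echelon_frame w (GLmx g) *m \adj (echelon_minor w (GLmx g))) i j.
  have rg : @regmx K (GL K n) n n (@GLmx K n) by exact: regmx_sval.
  have rminor : @regmx K (GL K n) n n (fun g => echelon_minor w (GLmx g)).
    move=> a b; apply: (@eq_regf K (GL K n) (fun g => if (a < k)%N && (b < k)%N
      then GLmx g (w a) b else (a == b)%:R)) => [g|]; first by rewrite mxE.
    by case: (_ && _); [apply: rg | apply: regf_const].
  have rframe : @regmx K (GL K n) n n (fun g => echelon_frame w (GLmx g)).
    move=> a b; apply: (@eq_regf K (GL K n) (fun g => if (b < k)%N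
      then GLmx g a b else (a == w b)%:R)) => [g|]; first by rewrite mxE.
    by case: (b < k)%N; [apply: rg | apply: regf_const].
  have rd : @regf K (GL K n) d by apply: (regf_det rG).
  have rnum : @regf K (GL K n) num.
    by apply: (regmxM rG rframe (regmx_adj rG rminor)).
  have oD := reg_nz rG (zopenT rG) rd.
  pose D : set (GL K n) := [set g | setT g /\ d g != 0]%classic.
  pose V : set (grassmann_variety K n k) := [set c | d (rep c) != 0]%classic.
  (* Another representative changes the minor by a factor in the units. *)
  have VD : (to_coset (@parabolic K n k) @^-1` V)%classic = D.
    apply/seteqP; split=> g /=; have [h [ph E]] := repP g.
      rewrite /V /= /d E echelon_minorM // det_mulmx mulf_eq0 negb_or.
      by case/andP=> dg _; split.
    case=> _ dg; rewrite /V /= /d E echelon_minorM // det_mulmx mulf_neq0 //.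
    by have := levi_part_unit ph; rewrite unitmxE unitfE.
  move=> c _; exists V, (fun c => canonical_form (GLmx (rep c)) i j); split.
  + rewrite -[zopen V]/(zopen (to_coset (@parabolic K n k) @^-1` V)%classic) VD.
    exact: oD.
  + have [h [ph E]] := slice_point_canonical (etrans (congr1 sval (GE c)) (repE _)).
    rewrite /V /= /d E echelon_minorM // echelon_minor_slice ?mul1mx; last first.
      by have [] := svalP (G c).
    by have := levi_part_unit ph; rewrite unitmxE unitfE.
  + rewrite -[regular V _]/(regular (to_coset (@parabolic K n k) @^-1` V)%classic _) VD.
    apply: (reg_local rG oD) => g Dg.
    exists D, (fun g => num g * (d g)^-1); split=> //.
      apply: (regM rG oD); first exact: (regS rG (zopenT rG) oD _ rnum).
      apply: (regV rG oD); last by move=> ? [].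
      exact: (regS rG (zopenT rG) oD _ rd).
    move=> {Dg}g [_ dg] _; have [h [ph E]] := repP g.
    have ug : echelon_minor w (GLmx g) \in unitmx by rewrite unitmxE unitfE.
    rewrite /= E /canonical_form echelon_frameM // echelon_minorM //.
    have lE : levi_part (GLmx h) *m invmx (echelon_minor w (GLmx g) *m levi_part (GLmx h)) =
        invmx (echelon_minor w (GLmx g)).
      apply: (can_inj (mulKmx ug)).
      by rewrite mulmxA !mulmxV // unitmx_mul ug levi_part_unit.
    by rewrite -mulmxA lE /invmx ug -scalemxAr mxE mulrC.
  + move=> c' _ _ /=.
    have [h [ph E]] := slice_point_canonical (etrans (congr1 sval (GE c')) (repE _)).
    by rewrite E canonical_form_slice //; have [] := svalP (G c').
Qed.

End Slice.
End Positroid.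

(** * Rank jumps *)

Section Rank.
Variable n : nat.
Implicit Types (S : {set 'I_n}) (x y : 'I_n).

Lemma card_ord_lt d : (d <= n)%N -> #|[set t : 'I_n | (t < d)%N]%SET| = d.
Proof. by move=> dn; rewrite -sum1dep_card (big_ord_narrow dn) sum1_card card_ord. Qed.

Lemma card_ord_gt d : (d < n)%N -> #|[set t : 'I_n | (d < t)%N]%SET| = (n - d.+1)%N.
Proof.
move=> dn; rewrite cardsCs.
suff -> : (~: [set t : 'I_n | (d < t)%N] = [set t : 'I_n | (t < d.+1)%N])%SET.
  by rewrite card_ord_lt ?card_ord.
by apply/setP=> t; rewrite !inE -leqNgt ltnS.
Qed.

(** The position of [x] when [S] is read from the bottom of the matrix up. *)
Definition rank_above S x := #|[set y in S | (x < y)%N]%SET|.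

Lemma in_above S x y : (y \in [set z in S | (x < z)%N]%SET) = (y \in S) && (x < y)%N.
Proof. by rewrite finset.in_set. Qed.

Lemma rank_above_le S x y : (x <= y)%N -> (rank_above S y <= rank_above S x)%N.
Proof.
move=> xy; apply/subset_leq_card/fintype.subsetP => z; rewrite !inE => /andP [-> yz] /=; lia.
Qed.

Lemma rank_above_lt S x y : y \in S -> (x < y)%N -> (rank_above S y < rank_above S x)%N.
Proof.
move=> yS xy; apply/proper_card/properP; split.
  apply/fintype.subsetP => z; rewrite !inE => /andP [-> yz] /=; lia.
by exists y; rewrite !inE ?yS ?xy // ltnn andbF.
Qed.

Lemma rank_above_inj S : {in S &, injective (rank_above S)}.
Proof.
move=> x y xS yS E; apply: val_inj; case: (ltngtP x y) => // l.
  by have := rank_above_lt yS l; rewrite E ltnn.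
by have := rank_above_lt xS l; rewrite E ltnn.
Qed.

Lemma rank_above_card S x : x \in S -> (rank_above S x < #|S|)%N.
Proof.
move=> xS; apply/proper_card/properP; split.
  by apply/fintype.subsetP => z; rewrite !inE => /andP [].
by exists x; rewrite // !inE ltnn andbF.
Qed.

Lemma decreasing_enum k S : #|S| = k ->
  exists a : 'I_k -> 'I_n, forall i, a i \in S /\ rank_above S (a i) = i.
Proof.
case: k / => //; set k := #|S|.
pose f (i : 'I_k) := Ordinal (rank_above_card (enum_valP i)).
have fi : injective f.
  by move=> i j [/(rank_above_inj (enum_valP i) (enum_valP j))/enum_val_inj].
have [g fK gK] := injF_bij fi.
exists (fun i => enum_val (g i)) => i; split; first exact: enum_valP.
by have := gK i => /(congr1 val).
Qed.

End Rank.

Section Juggling.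
Variables (k m : nat) (u w : 'S_(k + m)).
Hypothesis wG : grassmannian k w.
Hypothesis wu : forall s : 'I_m, (w (rshift k s) <= u (rshift k s))%N.
Implicit Types (s : 'I_m) (x y : 'I_(k + m)).

Local Notation pivot t := (w (lshift m t)).
Local Notation free s := (w (rshift k s)).
Local Notation image s := (u (rshift k s)).

Lemma pivot_lt (t t' : 'I_k) : (t < t')%N -> (pivot t < pivot t')%N.
Proof. by move=> lt; apply: (proj1 wG) => //=. Qed.

Lemma free_lt (s s' : 'I_m) : (s < s')%N -> (free s < free s')%N.
Proof. by move=> lt; apply: (proj2 wG) => /=; lia. Qed.

(** For a matrix of the slice in which the rows [j_1, ..., j_s] are deleted,
    these are the rows where the rank of the rows read from the top jumps. *)
Definition jump_set (s : nat) : {set 'I_(k + m)} :=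
  [set x | (u^-1%g x < k + s)%N && ~~ (k <= w^-1%g x < k + s)%N].

Lemma free_notin_later s (s' : nat) : (s < s')%N -> free s \notin jump_set s'.
Proof. by move=> lt; rewrite inE permK /= leq_addr ltn_add2l lt andbF. Qed.

Lemma free_notin s : free s \notin jump_set s.+1.
Proof. exact: free_notin_later. Qed.

Lemma image_notin s (s' : nat) : (s' <= s)%N -> image s \notin jump_set s'.
Proof. by move=> lt; rewrite inE permK /= ltn_add2l ltnNge lt. Qed.

Lemma image_in s : free s != image s -> image s \in jump_set s.+1.
Proof.
move=> ne; rewrite inE permK /= ltn_add2l ltnS leqnn /=; apply/negP => /andP [kx xs].
have xk : (w^-1%g (image s) - k < m)%N by have := ltn_ord (w^-1%g (image s)); lia.
have xE : image s = free (Ordinal xk).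
  by rewrite -[LHS](permKV w); congr (w _); apply: val_inj => /=; rewrite subnKC.
have := wu s; rewrite xE; have [lt|] := ltnP (Ordinal xk) s.
  by have := free_lt lt; lia.
rewrite /= => ge; case/eqP: ne; rewrite xE; congr (w (rshift _ _)).
by apply: val_inj => /=; move: ge xs => /=; lia.
Qed.

Lemma image_preimage s : (u^-1%g (free s) <= k + s)%N.
Proof.
rewrite leqNgt; apply/negP => lt.
have xk : (u^-1%g (free s) - k < m)%N by have := ltn_ord (u^-1%g (free s)); lia.
have xE : image (Ordinal xk) = free s.
  by rewrite -[RHS](permKV u); congr (u _); apply: val_inj => /=; rewrite subnKC //; lia.
have ls : (s < Ordinal xk)%N by move: lt => /=; lia.
by have := wu (Ordinal xk); rewrite xE leqNgt free_lt.
Qed.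

(** Putting back row [free s] creates a rank jump there, and destroys the one
    at row [image s], where that row becomes redundant. *)
Lemma jump_set_step s : jump_set s = ((free s |: jump_set s.+1) :\ image s)%SET.
Proof.
apply/setP=> x; rewrite !inE.
have xE : (u^-1%g x == rshift k s) = (x == image s).
  by rewrite -(inj_eq (@perm_inj _ u)) permKV.
have xF : (w^-1%g x == rshift k s) = (x == free s).
  by rewrite -(inj_eq (@perm_inj _ w)) permKV.
rewrite -xE -xF -!val_eqE /=.
have [E|] := eqVneq x (free s); last by rewrite -xF -val_eqE /=; lia.
by rewrite E permK /=; have := image_preimage s; lia.
Qed.

Lemma rank_above_step s x :
  (rank_above (jump_set s) x + (x < image s) = rank_above (jump_set s.+1) x + (x < free s))%N.
Proof.
pose A := [set y in free s |: jump_set s.+1 | (x < y)%N]%SET.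
have im : image s \in (free s |: jump_set s.+1)%SET.
  by rewrite in_setU1; case: (eqVneq (free s) (image s)) => // /image_in ->; rewrite ?orbT.
transitivity #|A|.
  have imA : (image s \in A) = (x < image s)%N by rewrite in_above im.
  rewrite addnC (cardsD1 (image s) A) imA; congr (_ + _)%N; apply: eq_card => y.
  by rewrite jump_set_step in_setD1 !in_above in_setD1 andbA.
have [lt|le] := ltnP x (free s); last first.
  rewrite addn0; apply: eq_card => y; rewrite !inE.
  by have [->|] //= := eqVneq y (free s); rewrite ltnNge le !andbF.
have nin : free s \notin [set y in jump_set s.+1 | (x < y)%N]%SET.
  by rewrite in_above (negbTE (free_notin s)).
have -> : A = (free s |: [set y in jump_set s.+1 | (x < y)%N])%SET.
  apply/setP=> y; rewrite in_setU1 !in_above in_setU1.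
  by case: (eqVneq y (free s)) => [->|].
by rewrite cardsU1 nin addnC.
Qed.

Lemma jump_set_top : jump_set m = [set pivot t | t in 'I_k]%SET.
Proof.
apply/setP=> x; rewrite inE !ltn_ord andbT /= -ltnNge.
apply/idP/imsetP => [lt|[t _ ->]]; last by rewrite permK /=.
exists (Ordinal lt) => //; rewrite -[LHS](permKV w); congr (w _); exact: val_inj.
Qed.

Lemma jump_set_bottom x : (x \in jump_set 0) = (u^-1%g x < k)%N.
Proof. by rewrite inE addn0; case: (ltnP (w^-1%g x) k); rewrite ?andbF ?andbT. Qed.

(** The rank at the bottom is [k] at every stage. *)
Lemma card_jump_set (s : nat) : (s <= m)%N -> #|jump_set s| = k.
Proof.
move=> sm; rewrite -(subKn sm); elim: (m - s)%N (leq_subr s m) => [|d IH] dm.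
  rewrite subn0 jump_set_top card_imset ?card_ord // => t t' /perm_inj.
  exact: lshift_inj.
have lt : (m - d.+1 < m)%N by lia.
have := jump_set_step (Ordinal lt); rewrite /= -subSn // subSS => E.
set s' := Ordinal lt in E.
have im : image s' \in (free s' |: jump_set (m - d))%SET.
  rewrite in_setU1; case: (eqVneq (free s') (image s')) => //= /image_in.
  by rewrite /= -subSn // subSS => ->; rewrite orbT.
have := cardsD1 (image s') (free s' |: jump_set (m - d))%SET.
rewrite -E im cardsU1 IH ?(ltnW dm) //.
have := free_notin s'; rewrite /= -subSn // subSS => ->.
by move=> [].
Qed.

(** The later exchanges replace a row by another one, both below [free s]. *)
Lemma rank_above_top s (s' : nat) : (s < s')%N -> (s' <= m)%N ->
  rank_above (jump_set s') (free s) = rank_above (jump_set s.+1) (free s).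
Proof.
elim: s' => // s' IH; rewrite ltnS leq_eqVlt => /orP [/eqP -> //|lt] lm.
rewrite -(IH lt) ?(ltnW lm) //; have := rank_above_step (Ordinal lm) (free s).
have lf : (free s < free (Ordinal lm))%N by apply: free_lt.
by rewrite lf (leq_trans lf (wu _)) /=; lia.
Qed.

Lemma rank_above_pivot (t : 'I_k) : rank_above (jump_set m) (pivot t) = rev_ord t.
Proof.
rewrite /= -(card_ord_gt (ltn_ord t)) /rank_above jump_set_top.
rewrite -[RHS](card_imset _ (inj_comp (@perm_inj _ w) (@lshift_inj k m))).
apply: eq_card => x; rewrite in_above; apply/andP/imsetP => /=.
  case=> /imsetP [t' _ ->] lt; exists t' => //; rewrite finset.in_set.
  by rewrite ltnNge leq_eqVlt; apply/negP => /orP [/eqP/val_inj E|/pivot_lt];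
    [rewrite E ltnn in lt | lia].
by case=> t'; rewrite finset.in_set => lt ->; split; [apply: imset_f|apply: pivot_lt].
Qed.

Lemma pivot_lt_free s (t : 'I_k) :
  (pivot t < free s)%N = (rank_above (jump_set s.+1) (free s) <= rev_ord t)%N.
Proof.
have lm := ltn_ord s.
rewrite -(rank_above_top (ltn_ord s)) // -rank_above_pivot.
apply/idP/idP => [lt|]; first exact: rank_above_le (ltnW lt).
rewrite leqNgt => /negP H; rewrite ltnNge; apply/negP => le; apply: H.
apply: rank_above_lt; first by rewrite jump_set_top imset_f.
rewrite ltn_neqAle le andbT; apply/eqP => /val_inj/perm_inj/eqP.
by rewrite eq_sym eq_lrshift.
Qed.

Lemma rank_above_image_free s :
  (rank_above (jump_set s.+1) (image s) <= rank_above (jump_set s.+1) (free s))%N.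
Proof. exact: rank_above_le (wu s). Qed.

Lemma rank_above_image_lt s : (rank_above (jump_set s.+1) (image s) <
  rank_above (jump_set s.+1) (free s))%N = (free s != image s).
Proof.
have [->|ne] := eqVneq (free s) (image s); first by rewrite ltnn.
apply: rank_above_lt (image_in ne) _.
by move: ne; rewrite -val_eqE /=; have := wu s; lia.
Qed.

Lemma rank_above_bound (s : nat) x : (s <= m)%N -> (rank_above (jump_set s) x <= k)%N.
Proof.
move=> /card_jump_set E; rewrite -[X in (_ <= X)%N]E.
apply/subset_leq_card/fintype.subsetP => y; by rewrite in_above => /andP [].
Qed.

(** Both numbers may be counted at the stage of [s'], by [rank_above_top]. *)
Lemma rank_above_free_le s s' : (s <= s')%N ->
  (rank_above (jump_set s'.+1) (free s') <= rank_above (jump_set s.+1) (free s))%N.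
Proof.
rewrite leq_eqVlt => /orP [/eqP/val_inj -> //|lt].
rewrite -(@rank_above_top s s'.+1 (leqW lt) (ltn_ord s')); exact: rank_above_le (ltnW (free_lt lt)).
Qed.

End Juggling.

(** * Matrices of juggling blocks *)

Section Block.
Variables (K : closedFieldType) (k : nat).

(** The coefficients of the row produced by a block with letters
    [e, ..., p + 1]; its variables appear from right to left. *)
Definition block_coef (p e : nat) (z : nat -> K) (i : nat) : K :=
  if i == p then 1 else if (p < i <= e)%N then z (e - i)%N else 0.

Lemma block_coef_in p e z i : (p < i <= e)%N -> block_coef p e z i = z (e - i)%N.
Proof. by move=> pie; rewrite /block_coef pie ifF //; lia. Qed.

(** A block moves the rows below row [p] up by one, and inserts row [p], plus a
    combination of the rows it has passed, after them. *)
Lemma block_mx_rows d p z c (A : 'M[K]_(k, c)) (r : 'I_k) j : (p + d < k)%N ->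
  let B := word_mx k (rev (iota p.+1 d)) z *m A in
  [/\ (r < p)%N || (p + d < r)%N -> B r j = A r j,
      forall r' : 'I_k, r' = r.+1 :> nat -> (p <= r)%N -> (r' <= p + d)%N -> B r j = A r' j &
      r = (p + d)%N :> nat -> B r j = \sum_(i < k) block_coef p (p + d) z i * A i j].
Proof.
elim: d z r => [|d IH] z r lt /=.
  rewrite mul1mx addn0; split=> // [r'|rp]; first by lia.
  rewrite (bigD1 r) //= /block_coef rp eqxx mul1r big1 ?addr0 // => i.
  rewrite -val_eqE /= rp => /negbTE ->.
  by case: ifP; rewrite ?mul0r //; lia.
have -> : rev (iota p.+1 d.+1) = (p + d).+1 :: rev (iota p.+1 d).
  by rewrite -[d.+1]addn1 iotaD rev_cat.
have la : (p + d < k)%N by lia.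
have lb : ((p + d).+1 < k)%N by lia.
pose a := Ordinal la; pose b := Ordinal lb.
rewrite /= -mulmxA (@mul_braid_mx _ _ _ _ _ _ a b) //.
have nba : (b == a) = false by rewrite -val_eqE /=; lia.
have Ib := IH (z \o S) b la; have Ia := IH (z \o S) a la.
have [Ib1 _ _] := Ib; have [_ Ia2 Ia3] := Ia.
split.
- move=> out; rewrite mxE.
  have -> : (r == a) = false by rewrite -val_eqE /=; lia.
  have -> : (r == b) = false by rewrite -val_eqE /=; lia.
  by have [-> //] := IH (z \o S) r la; lia.
- move=> r' r'E pr r'd; rewrite mxE.
  have [ra|ra] := eqVneq r a.
    rewrite Ib1 /=; last by lia.
    by congr (A _ _); apply: val_inj; rewrite /= r'E ra.
  have -> : (r == b) = false by rewrite -val_eqE /=; lia.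
  have [_ I2 _] := IH (z \o S) r la; apply: I2 => //.
  by move: ra; rewrite -val_eqE /=; lia.
- move=> rE; rewrite mxE.
  have -> : (r == a) = false by rewrite -val_eqE /=; lia.
  have -> : (r == b) = true by rewrite -val_eqE /=; lia.
  rewrite Ia3 // Ib1 /=; last by lia.
  have c0 : block_coef p (p + d) (z \o S) b = 0.
    by rewrite /block_coef /= !ifF //; lia.
  have c1 : block_coef p (p + d.+1) z b = z 0%N.
    by rewrite /block_coef /= ifF ?ifT ?addnS ?subnn //; lia.
  rewrite [RHS](bigD1 b) //= c1 (bigD1 b) //= c0 mul0r add0r addrC; congr (_ + _).
  apply: eq_bigr => i.
  rewrite -val_eqE /= => ib; congr (_ * _).
  rewrite /block_coef; case: (i == p :> nat) => //.
  have [l|l] := boolP (p < i <= p + d)%N.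
    by rewrite ifT; [congr z; lia | lia].
  by rewrite ifF //; lia.
Qed.

End Block.

Section Slides.
Variables (K : closedFieldType) (k m : nat) (p q : nat -> nat).
Hypothesis pq : forall s, (s < m)%N -> (p s <= q s <= k)%N.

Local Notation W := (permutation_mx K (longest k)).

Definition block (s : nat) : seq nat := rev (iota (p s).+1 (q s - p s).-1).
Definition blocks s := flatten [seq block t | t <- iota s (m - s)].
Definition offset s := size (flatten [seq block t | t <- iota 0 s]).

(** The adapted basis of the row space reached after the blocks [s, ..., m - 1];
    the variables of block [s] start at position [offset s]. *)
Definition slide z s : 'M[K]_k := word_mx k (blocks s) (fun j => z (offset s + j)%N) *m W.

Lemma offsetS s : offset s.+1 = (offset s + (q s - p s).-1)%N.
Proof.
rewrite /offset -[s.+1]addn1 iotaD map_cat flatten_cat size_cat /= cats0.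
by rewrite size_rev size_iota.
Qed.

Lemma offset_le s s' : (s <= s')%N -> (offset s <= offset s')%N.
Proof.
elim: s' => [|s' IH]; first by case: s.
rewrite leq_eqVlt => /orP [/eqP -> //|/IH]; rewrite offsetS; lia.
Qed.

Lemma blocksS s : (s < m)%N -> blocks s = block s ++ blocks s.+1.
Proof. by move=> sm; rewrite /blocks -(subnSK sm). Qed.

Lemma blocks_top : blocks m = [::].
Proof. by rewrite /blocks subnn. Qed.

Lemma size_blocks s : (s <= m)%N -> (offset s + size (blocks s) = offset m)%N.
Proof.
by move=> sm; rewrite /offset -size_cat -flatten_cat -map_cat -{2}[s]add0n -iotaD subnKC.
Qed.

Lemma blocks_word s : (s <= m)%N -> braid_word k (blocks s).
Proof.
move=> sm; apply/allP => i /flattenP [_ /mapP [t + ->]].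
rewrite mem_iota mem_rev mem_iota => tm.
by have /pq : (t < m)%N by [lia]; lia.
Qed.

Lemma slide_top z : slide z m = W.
Proof. by rewrite /slide blocks_top mul1mx. Qed.

Lemma slide_unit z s : (s <= m)%N -> slide z s \in unitmx.
Proof. by move=> sm; rewrite unitmx_mul permutation_mx_unit word_mx_unit ?blocks_word. Qed.

Lemma eq_slide z z' s : (forall j, (offset s <= j < offset m)%N -> z j = z' j) ->
  (s <= m)%N -> slide z s = slide z' s.
Proof.
move=> E sm; congr (_ *m _); apply: eq_word_mx => j lj; apply: E.
by have := size_blocks sm; lia.
Qed.

Lemma slideS z s : (s < m)%N ->
  slide z s = word_mx k (block s) (fun j => z (offset s + j)%N) *m slide z s.+1.
Proof.
move=> sm; rewrite /slide blocksS // word_mx_cat -!mulmxA; congr (_ *m (_ *m _)).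
by apply: eq_word_mx => j _; rewrite offsetS addnA size_rev size_iota.
Qed.

Lemma slide_fixed z s : (s < m)%N -> p s = q s -> slide z s = slide z s.+1.
Proof. by move=> sm E; rewrite slideS // /block E subnn /= mul1mx. Qed.

Lemma slide_rows z s (r : 'I_k) j : (s < m)%N -> (p s < q s)%N ->
  [/\ (r < p s)%N || (q s <= r)%N -> slide z s r j = slide z s.+1 r j,
      forall r' : 'I_k, r' = r.+1 :> nat -> (p s <= r)%N -> (r' < q s)%N ->
        slide z s r j = slide z s.+1 r' j &
      r.+1 = q s -> slide z s r j = \sum_(i < k)
         block_coef (p s) (q s).-1 (fun j => z (offset s + j)%N) i * slide z s.+1 i j].
Proof.
move=> sm lt; have := pq sm => qk; rewrite slideS //.
have E : (p s + (q s - p s).-1 = (q s).-1)%N by lia.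
have [|H1 H2 H3] := @block_mx_rows K k (q s - p s).-1 (p s)
   (fun j => z (offset s + j)%N) k (slide z s.+1) r j; first by lia.
split=> [out|r' r'E pr r'q|rq].
- by apply: H1; lia.
- by apply: H2 => //; lia.
- by rewrite H3 ?E //; lia.
Qed.

(** The blocks involved act on the first [e] rows only. *)
Lemma slide_shape z s e (i c : 'I_k) : (s <= m)%N ->
  (forall s', (s <= s' < m)%N -> (q s' <= e)%N) -> (e <= rev_ord c)%N ->
  slide z s i c = (i == rev_ord c)%:R.
Proof.
move=> sm qe ec.
have WE (r : 'I_k) : (W : 'M[K]_k) r c = (r == rev_ord c)%:R.
  by rewrite -[W]mul1mx mul_longest_mxr mxE.
suff main d s' : (m - s' = d)%N -> (s <= s' <= m)%N -> forall r : 'I_k,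
    slide z s' r c = (r == rev_ord c)%:R by apply: (main (m - s)%N); rewrite ?leqnn.
elim: d s' => [|d IH] s' ds /andP [ss' sm'] {}i.
  by have -> : s' = m by [lia]; rewrite slide_top WE.
have lt : (s' < m)%N by lia.
have {}IH (r : 'I_k) : slide z s'.+1 r c = (r == rev_ord c)%:R.
  by apply: IH => //; lia.
have qs : (q s' <= e)%N by apply: qe; rewrite ss'.
have zero (r : 'I_k) : (r < q s')%N -> (r == rev_ord c) = false.
  by move=> lr; rewrite -val_eqE; move: ec => /=; lia.
have [ple|plt] := leqP (q s') (p s').
  by rewrite slide_fixed //; have := pq lt; lia.
have [H1 H2 H3] := slide_rows z i c lt plt.
have [out|ins] := boolP ((i < p s')%N || (q s' <= i)%N); first by rewrite H1.
rewrite zero; last by lia.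
have [iq|iq] := eqVneq i.+1 (q s'); last first.
  have li : (i.+1 < k)%N by have := pq lt; lia.
  by rewrite (H2 (Ordinal li)) ?IH ?zero //=; lia.
rewrite H3 // big1 // => r _; rewrite IH.
have [/zero ->|qr] := ltnP r (q s'); first by rewrite mulr0.
rewrite /block_coef !ifF ?mul0r //; lia.
Qed.

End Slides.

(** * Inserting a row into the adapted basis *)

Section Gluing.
Variables (K : closedFieldType) (k m : nat) (u w : 'S_(k + m)).
Hypothesis wG : grassmannian k w.
Hypothesis wu : forall s : 'I_m, (w (rshift k s) <= u (rshift k s))%N.
Implicit Types (s : 'I_m) (g : 'M[K]_(k + m)) (z t : nat -> K).

Local Notation pivot t := (w (lshift m t)).
Local Notation free s := (w (rshift k s)).
Local Notation image s := (u (rshift k s)).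
Local Notation jumps := (jump_set u w).

(** Block [s] acts on the positions from [image_rank s] up to [free_rank s],
    excluded, of the adapted basis; only the values for [s < m] matter. *)
Definition image_rank (s : nat) : nat :=
  if (insub s : option 'I_m) is Some s' then rank_above (jumps s'.+1) (image s') else 0%N.

Definition free_rank (s : nat) : nat :=
  if (insub s : option 'I_m) is Some s' then rank_above (jumps s'.+1) (free s') else 0%N.

Local Notation p := image_rank.
Local Notation q := free_rank.

Lemma image_rankE s : p s = rank_above (jumps s.+1) (image s).
Proof. by rewrite /image_rank valK. Qed.

Lemma free_rankE s : q s = rank_above (jumps s.+1) (free s).
Proof. by rewrite /free_rank valK. Qed.

Lemma image_free_rank (s : nat) : (s < m)%N -> (p s <= q s <= k)%N.
Proof.
move=> sm; have -> : s = Ordinal sm by [].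
rewrite image_rankE free_rankE rank_above_image_free //=.
exact: (rank_above_bound wG wu).
Qed.

Lemma free_rank_le (s s' : nat) : (s <= s' < m)%N -> (q s' <= q s)%N.
Proof.
case/andP=> le lt; have sm : (s < m)%N by lia.
have -> : s = Ordinal sm by []; have -> : s' = Ordinal lt by [].
rewrite !free_rankE; exact: (rank_above_free_le wG wu).
Qed.

Lemma moved_rank s : (p s < q s)%N = (free s != image s).
Proof. by rewrite image_rankE free_rankE (rank_above_image_lt wG wu). Qed.

(** The row of the matrix at position [i] of the adapted basis; for
    [s <= m] there is such a row, and the default is not used. *)
Definition jump_row (s : nat) (i : 'I_k) : 'I_(k + m) :=
  odflt (lshift m i) [pick x in jumps s | rank_above (jumps s) x == i].

Lemma jump_rowP (s : nat) i : (s <= m)%N ->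
  jump_row s i \in jumps s /\ rank_above (jumps s) (jump_row s i) = i.
Proof.
move=> sm; rewrite /jump_row; case: pickP => [x /andP [xS /eqP //]|none].
have [a aP] := decreasing_enum (card_jump_set wG wu sm).
by have [aS aE] := aP i; have := none (a i); rewrite /= aS aE eqxx.
Qed.

Lemma jump_row_rank (s : nat) (i : 'I_k) x : (s <= m)%N -> x \in jumps s ->
  rank_above (jumps s) x = i -> jump_row s i = x.
Proof.
move=> sm xS xE; have [yS yE] := jump_rowP i sm.
by apply: (rank_above_inj yS xS); rewrite yE xE.
Qed.

Lemma jump_row_lt (s : nat) (i i' : 'I_k) : (s <= m)%N -> (i < i')%N ->
  (jump_row s i' < jump_row s i)%N.
Proof.
move=> sm lt; have [yS yE] := jump_rowP i sm; have [xS xE] := jump_rowP i' sm.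
by rewrite ltnNge; apply/negP => /(rank_above_le (jumps s)); rewrite yE xE; lia.
Qed.

Lemma jump_row_inj (s : nat) : (s <= m)%N -> injective (jump_row s).
Proof.
move=> sm i i' E; apply: val_inj => /=; have [_ <-] := jump_rowP i sm.
by have [_ <-] := jump_rowP i' sm; rewrite E.
Qed.

(** The exchange of [image s] for [free s] shifts the positions in between by
    one, exactly as the block [s] does. *)
Lemma jump_row_step s (i : 'I_k) : (p s < q s)%N ->
  [/\ (i < p s)%N || (q s <= i)%N -> jump_row s i = jump_row s.+1 i,
      forall i' : 'I_k, i' = i.+1 :> nat -> (p s <= i)%N -> (i' < q s)%N ->
        jump_row s i = jump_row s.+1 i' &
      i.+1 = q s -> jump_row s i = free s].
Proof.
move=> lt; have ne := lt; rewrite moved_rank in ne; have sm := ltn_ord s.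
have fi : (free s < image s)%N.
  by move: ne; rewrite -val_eqE /=; have := wu s; lia.
have St x := rank_above_step wG wu s x.
have inS x : x \in jumps s.+1 -> x != image s -> x \in jumps s.
  by move=> xS xi; rewrite (jump_set_step wG wu) in_setD1 xi in_setU1 xS orbT.
have pE := image_rankE s; have qE := free_rankE s.
split.
- have [yS yE] := jump_rowP i sm; set y := jump_row s.+1 i in yS yE *.
  have yf : y != free s by apply: contraTneq yS => ->; exact: free_notin.
  case/orP=> il.
    have iy : (image s < y)%N.
      by rewrite ltnNge; apply/negP => /(rank_above_le (jumps s.+1)); lia.
    apply: jump_row_rank; [exact: ltnW|apply: inS => //|].
      by rewrite -val_eqE /= gtn_eqF.
    by have := St y; lia.
  have yl : (y < free s)%N.
    rewrite ltnNge; apply/negP; rewrite leq_eqVlt => /orP [/eqP/val_inj E|].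
      by rewrite E eqxx in yf.
    by move/(rank_above_lt yS); lia.
  apply: jump_row_rank; [exact: ltnW|apply: inS => //|].
    by rewrite -val_eqE /= ltn_eqF //; lia.
  by have := St y; lia.
- move=> i' i'E pi iq; have [yS yE] := jump_rowP i' sm; set y := jump_row s.+1 i' in yS yE *.
  have yf : (free s < y)%N.
    by rewrite ltnNge; apply/negP => /(rank_above_le (jumps s.+1)); lia.
  have yi : (y < image s)%N.
    by rewrite ltnNge; apply/negP => /(rank_above_le (jumps s.+1)); lia.
  apply: jump_row_rank; [exact: ltnW|apply: inS => //|].
    by rewrite -val_eqE /= ltn_eqF.
  by have := St y; lia.
- move=> iq; apply: jump_row_rank; first exact: ltnW.
    by rewrite (jump_set_step wG wu) in_setD1 ne in_setU1 eqxx.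
  by have := St (free s); rewrite ltnn fi; lia.
Qed.

Lemma jump_set_fixed s : p s = q s -> jumps s = jumps s.+1.
Proof.
move=> E; have := moved_rank s; rewrite E ltnn => /esym/negbFE/eqP fi.
rewrite (jump_set_step wG wu) fi setU1K // -fi; exact: free_notin.
Qed.

(** The equation [i.+1 = q s] selects the row which block [s] inserts; the block
    inserts nothing if [p s = q s]. *)
Definition glued g z t s : Prop :=
  if (p s < q s)%N then
    t s != 0 /\ forall i c : 'I_k, i.+1 = q s ->
      g (free s) (lshift m c) = t s * slide k m p q z s i c
  else forall c : 'I_k, g (free s) (lshift m c) = 0.

Local Notation slide := (slide k m p q).

(** The matrix [slide z s] is, up to the scaling of its rows, the submatrix of
    [g] on the jump set: by descending induction, both change by the same
    exchange. *)
Lemma slide_jump_row g z t (s : nat) : (s <= m)%N -> col_pivots w g ->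
  (forall s' : 'I_m, (s <= s')%N -> glued g z t s') ->
  forall i, exists2 d, d != 0 & forall c, slide z s i c = d * g (jump_row s i) (lshift m c).
Proof.
move=> sm gw; suff main e (s' : nat) : (m - s' = e)%N -> (s <= s' <= m)%N ->
    (forall s'' : 'I_m, (s' <= s'')%N -> glued g z t s'') -> forall i, exists2 d, d != 0 &
    forall c, slide z s' i c = d * g (jump_row s' i) (lshift m c).
  by move=> G i; apply: (main (m - s)%N s _ _ G i); rewrite ?leqnn.
elim: e s' => [|e IH] s' es /andP [ss' sm'] G i.
  have -> : s' = m by lia.
  exists 1; first exact: oner_neq0.
  move=> c; rewrite slide_top mul1r -[permutation_mx _ _]mul1mx mul_longest_mxr mxE.
  have -> : jump_row m i = pivot (rev_ord i).
    apply: jump_row_rank => //; first by rewrite jump_set_top imset_f.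
    by rewrite (rank_above_pivot u wG) rev_ordK.
  have [H1 _ H3] := gw (lshift m c).
  rewrite -(inj_eq (@rev_ord_inj k)) rev_ordK.
  case: (ltngtP (rev_ord i) c) => lc.
  - by rewrite H3 // -val_eqE ltn_eqF.
  - have [_ H2 _] := gw (lshift m c).
    by rewrite H2 ?(pivot_lt wG lc) // -val_eqE gtn_eqF.
  - by rewrite (val_inj lc) eqxx H1.
have lt : (s' < m)%N by lia.
pose s0 := Ordinal lt.
have {}IH := IH s'.+1 _ _ (fun s'' h => G s'' (ltnW h)).
have {}IH : forall i, exists2 d, d != 0 & forall c,
    slide z s'.+1 i c = d * g (jump_row s'.+1 i) (lshift m c) by apply: IH; lia.
have [ple|plt] := leqP (q s') (p s').
  have E : p s0 = q s0 by have := image_free_rank lt; rewrite /=; lia.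
  have [d d0 dE] := IH i; exists d => // c; rewrite (@slide_fixed K k m p q z s' lt E) dE.
  by congr (_ * g _ _); rewrite /jump_row (jump_set_fixed E).
have R := fun c => slide_rows image_free_rank z i c lt plt.
have [J1 J2 J3] := @jump_row_step s0 i plt.
have [out|ins] := boolP ((i < p s')%N || (q s' <= i)%N).
  have [d d0 dE] := IH i; exists d => // c.
  by have [-> // _ _] := R c; rewrite dE J1.
have [iq|iq] := eqVneq i.+1 (q s'); last first.
  have li : (i.+1 < k)%N by have := image_free_rank lt; lia.
  have [d d0 dE] := IH (Ordinal li); exists d => // c.
  have [_ R2 _] := R c; rewrite (R2 (Ordinal li)) //=; try lia.
  by rewrite dE (J2 (Ordinal li)) //=; lia.
have := G s0 (leqnn _); rewrite /glued plt => -[t0 tE].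
exists (t s')^-1; first by rewrite invr_eq0.
by move=> c; rewrite J3 // (tE i c iq) mulKf.
Qed.

Lemma glued_row g z t s : glued g z t s -> (p s < q s)%N ->
  row (free s) (lsubmx g) =
  t s *: ((\row_(i < k) block_coef (p s) (q s).-1 (fun j => z (offset p q s + j)%N) i)
     *m slide z s.+1).
Proof.
rewrite /glued => + lt; rewrite lt => -[t0 tE]; have sm := ltn_ord s.
have li : ((q s).-1 < k)%N by have := image_free_rank sm; lia.
apply/rowP=> c; rewrite !mxE (tE (Ordinal li)) /=; last by lia.
have [_ _ R3] := slide_rows image_free_rank z (Ordinal li) c sm lt.
rewrite R3 /=; last by lia.
by congr (_ * _); apply: eq_bigr => i _; rewrite mxE.
Qed.

(** The variables of block [s] are ratios of the coordinates of the row
    [free s] in the basis reached after the later blocks. *)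
Lemma glued_coords g z t s : glued g z t s -> (p s < q s)%N -> forall i : 'I_k,
  (row (free s) (lsubmx g) *m invmx (slide z s.+1)) 0 i =
  t s * block_coef (p s) (q s).-1 (fun j => z (offset p q s + j)%N) i.
Proof.
move=> G lt i; rewrite (glued_row G lt) -scalemxAl mulmxK ?mxE ?mxE //.
exact: (slide_unit image_free_rank).
Qed.

End Gluing.

(** * From inserted rows to the Richardson slice *)

Section Slice.
Variables (K : closedFieldType) (k m : nat) (u w : 'S_(k + m)).
Hypothesis wG : grassmannian k w.
Hypothesis wu : forall s : 'I_m, (w (rshift k s) <= u (rshift k s))%N.
Variable pi : 'S_k.
Hypothesis piE : forall t : 'I_k, jump_row u w 0 (pi^-1%g t) = u (lshift m t).
Implicit Types (s : 'I_m) (g L : 'M[K]_(k + m)) (z t : nat -> K).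

Local Notation free s := (w (rshift k s)).
Local Notation image s := (u (rshift k s)).
Local Notation jumps := (jump_set u w).
Local Notation jump_row := (jump_row u w).
Local Notation p := (image_rank u w).
Local Notation q := (free_rank u w).
Local Notation slide := (slide k m p q).
Local Notation glued := (glued u w).

Let pq := image_free_rank wG wu.

Lemma slice_right_col g x s : col_pivots w g -> g x (rshift k s) = (x == free s)%:R.
Proof.
move=> gw; rewrite -{1}(echelon_frame_slice wG gw) mxE ifF //.
by rewrite /= ltnNge leq_addr.
Qed.

Lemma mul_slice_right (r : 'rV[K]_(k + m)) g s : col_pivots w g ->
  (r *m g) 0 (rshift k s) = r 0 (free s).
Proof.
move=> gw; rewrite mxE (bigD1 (free s)) //= slice_right_col // eqxx mulr1.
rewrite big1 ?addr0 // => x /negbTE xs.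
by rewrite slice_right_col // xs mulr0.
Qed.

(** A relation between the rows in the jump set, given by its coefficients. *)
Definition comb (s : nat) (mu : 'I_k -> K) : 'rV[K]_(k + m) :=
  \row_x \sum_i (x == jump_row s i)%:R * mu i.

Lemma comb_jump_row (s : nat) mu i : (s <= m)%N -> comb s mu 0 (jump_row s i) = mu i.
Proof.
move=> sm; rewrite mxE (bigD1 i) //= eqxx mul1r big1 ?addr0 // => i' /negbTE ii'.
by rewrite (inj_eq (jump_row_inj wG wu sm)) eq_sym ii' mul0r.
Qed.

Lemma comb_notin (s : nat) mu x : (s <= m)%N -> x \notin jumps s -> comb s mu 0 x = 0.
Proof.
move=> sm xS; rewrite mxE big1 // => i _; case: eqP => [xE|]; last by rewrite mul0r.
by have [jS _] := jump_rowP wG wu i sm; rewrite xE jS in xS.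
Qed.

Lemma comb_mul (s : nat) mu c (A : 'M[K]_(k + m, c)) j :
  (comb s mu *m A) 0 j = \sum_i mu i * A (jump_row s i) j.
Proof.
rewrite mxE; under eq_bigr => x _ do rewrite mxE mulr_suml.
rewrite exchange_big /=; apply: eq_bigr => i _.
rewrite (bigD1 (jump_row s i)) //= eqxx mul1r big1 ?addr0 // => x /negbTE ->.
by rewrite !mul0r.
Qed.

Lemma comb_support (s : nat) (r : 'rV[K]_(k + m)) : (s <= m)%N ->
  (forall x, x \notin jumps s -> r 0 x = 0) -> r = comb s (fun i => r 0 (jump_row s i)).
Proof.
move=> sm r0; apply/rowP => x; have [xS|xS] := boolP (x \in jumps s); last first.
  by rewrite r0 // comb_notin.
have lx : (rank_above (jumps s) x < k)%N.
  by rewrite -[X in (_ < X)%N](card_jump_set wG wu sm) rank_above_card.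
have <- : jump_row s (Ordinal lx) = x by exact: (jump_row_rank wG wu).
by rewrite comb_jump_row.
Qed.

(** The conditions on row [c] of [L]; no two rows interact in them. *)
Definition leading_row g (c : 'I_(k + m)) (r : 'rV[K]_(k + m)) := [/\ r 0 (u c) = 1,
  (forall x : 'I_(k + m), (u c < x)%N -> r 0 x = 0),
  (forall c' : 'I_(k + m), (c < c')%N -> r 0 (u c') = 0) &
  (forall c' : 'I_(k + m), (c' < c)%N -> (r *m g) 0 c' = 0)].

Lemma leading_rowsP g : (forall c, exists r, leading_row g c r) <->
  (exists L, row_leads u L /\ upper_triangular (L *m g)).
Proof.
split=> [/choice [r rE]|[L [Lu /upperP up]] c].
  have E c (A : 'M_(k + m)) j : ((\matrix_c r c) *m A) c j = (r c *m A) 0 j.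
    have -> : r c = row c (\matrix_c r c) by rewrite rowK.
    by rewrite -row_mul [RHS]mxE.
  exists (\matrix_c r c); split; last first.
    by apply/upperP=> i j ij; rewrite E; have [_ _ _] := rE i; apply.
  move=> c; have [H1 H2 H3 _] := rE c.
  by split=> [|j lj|c' lc]; rewrite mxE //; [exact: H2|exact: H3].
have [H1 H2 H3] := Lu c; exists (row c L).
split=> [|x lx|c' lc|c' lc]; rewrite ?mxE; [exact: H1|exact: H2|exact: H3|].
by move: (up _ _ lc); rewrite mxE; apply: etrans; apply: eq_bigr => x _; rewrite mxE.
Qed.

Section Glued.
Variables (g : 'M[K]_(k + m)) (z t : nat -> K).
Hypothesis gw : col_pivots w g.

(** Row [k + s] of [L] is the linear relation which expresses row [free s] in
    the adapted basis reached before it. *)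
Lemma glued_leading_right s : (forall s' : 'I_m, (s <= s')%N -> glued g z t s') ->
  exists r, leading_row g (rshift k s) r.
Proof.
move=> G; have sm := ltn_ord s; have Gs := G s (leqnn _).
have right_image (c' : 'I_(k + m)) : (rshift k s < c')%N -> exists2 s' : 'I_m, (s < s')%N & c' = rshift k s'.
  case: (split_ordP c') => [i|i] -> /=; first by have := ltn_ord i; lia.
  by rewrite ltn_add2l; exists i.
have free_ne (s' : 'I_m) : (s < s')%N -> (free s < image s')%N.
  by move=> lt; apply: leq_trans (wu s'); apply: free_lt.
have [plt|ple] := boolP (p s < q s)%N; last first.
  have fi : free s = image s by apply/eqP; rewrite -[_ == _]negbK -(moved_rank wG wu).
  have g0 (c : 'I_k) : g (free s) (lshift m c) = 0 by move: Gs; rewrite /glued (negbTE ple).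
  exists (delta_mx 0 (free s)); rewrite /leading_row -fi; split.
  - by rewrite mxE !eqxx.
  - by move=> x lx; rewrite mxE -[x == _]val_eqE /= gtn_eqF ?andbF.
  - move=> c'' /right_image [s' lt ->].
    by rewrite mxE -[image s' == _]val_eqE /= gtn_eqF ?andbF ?free_ne.
  - move=> c'; rewrite -rowE mxE; case: (split_ordP c') => [i|i] -> /=; rewrite ?g0 //.
    rewrite ltn_add2l slice_right_col // (inj_eq perm_inj) (inj_eq (@rshift_inj _ _)).
    by rewrite -val_eqE => lt; rewrite gtn_eqF.
have ne := plt; rewrite (moved_rank wG wu) in ne.
have fi : (free s < image s)%N.
  by move: ne; rewrite -val_eqE /=; have := wu s; lia.
have lip : (p s < k)%N by have := pq sm; lia.
pose ip := Ordinal lip.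
have ipE : jump_row s.+1 ip = image s.
  apply: (jump_row_rank wG wu) => //; first exact: (image_in wG wu).
  by rewrite -image_rankE.
have D i : exists d, d != 0 /\ forall c,
    slide z s.+1 i c = d * g (jump_row s.+1 i) (lshift m c).
  have G' s' : (s < s')%N -> glued g z t s' by move=> lt; apply: G; exact: ltnW.
  by have [d d0 dE] := slide_jump_row wG wu (ltn_ord s) gw G' i; exists d.
have [d dP] := choice D.
pose cf (i : 'I_k) := block_coef (p s) (q s).-1 (fun j => z (offset p q s + j)%N) i.
have cfp : cf ip = 1 by rewrite /cf /block_coef eqxx.
have cf0 (i : 'I_k) : (i < p s)%N -> cf i = 0.
  by move=> li; rewrite /cf /block_coef ltn_eqF // ltnNge (ltnW li).
pose mu i := t s * cf i * d i.
have t0 : t s != 0 by move: Gs; rewrite /glued plt => -[].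
have mup : mu ip != 0 by rewrite /mu cfp mulr1 mulf_neq0 // (dP ip).1.
have free_rowE c : g (free s) (lshift m c) = \sum_i mu i * g (jump_row s.+1 i) (lshift m c).
  have /rowP/(_ c) := glued_row wG wu Gs plt; rewrite !mxE => ->.
  rewrite mulr_sumr; apply: eq_bigr => i _.
  by rewrite mxE (dP i).2 /mu /cf !mulrA.
have combim : comb s.+1 mu 0 (image s) = mu ip by rewrite -ipE comb_jump_row.
pose r := (mu ip)^-1 *: (comb s.+1 mu - delta_mx 0 (free s)).
have rE x : r 0 x = (mu ip)^-1 * (comb s.+1 mu 0 x - (x == free s)%:R) by rewrite !mxE eqxx.
have rM c' : (r *m g) 0 c' = (mu ip)^-1 * ((comb s.+1 mu *m g) 0 c' - g (free s) c').
  by rewrite -scalemxAl mulmxBl -rowE !mxE.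
exists r; split.
- by rewrite rE combim eq_sym (negbTE ne) subr0 mulVf.
- move=> x lx; rewrite rE -[x == _]val_eqE /= gtn_eqF ?(ltn_trans fi) // subr0.
  have [xS|xS] := boolP (x \in jumps s.+1); last by rewrite comb_notin // mulr0.
  have lxk : (rank_above (jumps s.+1) x < k)%N.
    by rewrite -[X in (_ < X)%N](card_jump_set wG wu sm) rank_above_card.
  have <- : jump_row s.+1 (Ordinal lxk) = x by exact: (jump_row_rank wG wu).
  have li : (Ordinal lxk < p s)%N by rewrite image_rankE; apply: rank_above_lt.
  by rewrite comb_jump_row // {2}/mu (cf0 _ li) mulr0 mul0r mulr0.
- move=> c'' /right_image [s' lt ->].
  rewrite rE comb_notin //; last by apply: image_notin.
  by rewrite -[image s' == _]val_eqE /= gtn_eqF ?free_ne // subr0 mulr0.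
- move=> c'; rewrite rM; case: (split_ordP c') => [i|i] -> /=.
    by rewrite free_rowE comb_mul subrr mulr0.
  rewrite ltn_add2l => lt; rewrite mul_slice_right // slice_right_col //.
  rewrite comb_notin //; last by apply: free_notin_later; exact: ltnW.
  rewrite (inj_eq perm_inj) (inj_eq (@rshift_inj _ _)) -val_eqE gtn_eqF //.
  by rewrite subr0 mulr0.
Qed.

Hypothesis G : forall s, glued g z t s.

Lemma glued_bottom : exists d : 'I_k -> K, forall i, d i != 0 /\ forall c,
  slide z 0 i c = d i * g (jump_row 0 i) (lshift m c).
Proof.
have D i : exists d, d != 0 /\ forall c,
    slide z 0 i c = d * g (jump_row 0 i) (lshift m c).
  by have [d d0 dE] := slide_jump_row wG wu (leq0n m) gw (fun s' _ => G s') i; exists d.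
by have [d dP] := choice D; exists d.
Qed.

(** The first [k] rows of [L] are relations supported on the last adapted basis,
    given by the rows of the matrix which reduces it. *)
Lemma glued_leading_left A : row_pivots pi^-1%g A -> upper_triangular (A *m slide z 0) ->
  forall c : 'I_k, exists r, leading_row g (lshift m c) r.
Proof.
move=> Api /upperP up c; have [d dP] := glued_bottom.
pose x := pi^-1%g; have [A1 A2 A3] := Api c.
pose mu i := (d (x c))^-1 * (A c i * d i).
have dx : d (x c) != 0 by have [] := dP (x c).
exists (comb 0 mu); split.
- by rewrite -piE comb_jump_row // /mu A1 mul1r mulVf.
- move=> y ly; have [yS|yS] := boolP (y \in jumps 0); last by rewrite comb_notin.
  have ly' : (rank_above (jumps 0) y < k)%N.
    by rewrite -[X in (_ < X)%N](card_jump_set wG wu (leq0n m)) rank_above_card.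
  have yE : jump_row 0 (Ordinal ly') = y by exact: (jump_row_rank wG wu).
  rewrite -yE comb_jump_row // /mu A2 ?mul0r ?mulr0 //=.
  have [jS jE] := jump_rowP wG wu (x c) (leq0n m); rewrite -jE piE.
  exact: rank_above_lt.
- move=> c' lc; case: (split_ordP c') lc => [i|i] -> /= lc.
    by rewrite -piE comb_jump_row // /mu A3 ?mul0r ?mulr0.
  by rewrite comb_notin //; apply: image_notin.
- move=> c' lc; case: (split_ordP c') lc => [i|i] -> /= lc; last first.
    by have := ltn_ord c; lia.
  rewrite comb_mul; have := up c i lc; rewrite mxE => E.
  rewrite -[RHS](mulr0 (d (x c))^-1) -[in RHS]E mulr_sumr; apply: eq_bigr => j _.
  by rewrite (dP j).2 /mu !mulrA.
Qed.

Lemma glued_slice A : row_pivots pi^-1%g A -> upper_triangular (A *m slide z 0) ->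
  richardson_slice u w g.
Proof.
move=> Api up; split=> //; apply/leading_rowsP => c.
case: (split_ordP c) => [i|i] ->; first exact: glued_leading_left Api up i.
by apply: glued_leading_right => s' _; apply: G.
Qed.

(** Conversely, the first [k] rows of [L] are supported on the last adapted
    basis; the scalars relating it to [slide z 0] are divided out. *)
Lemma glued_pivots L : row_leads u L -> upper_triangular (L *m g) ->
  exists A, row_pivots pi^-1%g A /\ upper_triangular (A *m slide z 0).
Proof.
move=> Lu /upperP up; have [d dP] := glued_bottom; pose x := pi^-1%g.
pose A : 'M[K]_k := \matrix_(c, i) (d (x c) * L (lshift m c) (jump_row 0 i) / d i).
exists A; split.
  move=> c; have [L1 L2 L3] := Lu (lshift m c); split=> [|j lj|c' lc]; rewrite mxE.
  - by rewrite piE L1 mulr1 divff // (dP _).1.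
  - by rewrite L2 ?mulr0 ?mul0r // -piE; apply: (jump_row_lt wG wu).
  - by rewrite piE L3 ?mulr0 ?mul0r.
apply/upperP => c j lj; rewrite mxE.
have L0 y : y \notin jumps 0 -> (row (lshift m c) L) 0 y = 0.
  rewrite jump_set_bottom => yk; rewrite mxE -[y](permKV u).
  by have [_ _ ->] := Lu (lshift m c) => //=; have := ltn_ord c; lia.
have := up (lshift m c) (lshift m j) lj; rewrite mxE => E.
have {}E : (row (lshift m c) L *m g) 0 (lshift m j) = 0.
  by rewrite mxE -[RHS]E; apply: eq_bigr => y _; rewrite mxE.
rewrite (comb_support (leq0n m) L0) comb_mul in E.
rewrite -[RHS](mulr0 (d (x c))) -[in RHS]E mulr_sumr; apply: eq_bigr => i _.
by rewrite (dP i).2 !mxE mulrA divfK ?(dP i).1 // mulrA.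
Qed.

End Glued.
End Slice.

(** * From the Richardson slice to inserted rows *)

Section Exists.
Variables (K : closedFieldType) (k m : nat) (u w : 'S_(k + m)).
Hypothesis wG : grassmannian k w.
Hypothesis wu : forall s : 'I_m, (w (rshift k s) <= u (rshift k s))%N.
Implicit Types (s : 'I_m) (g L : 'M[K]_(k + m)) (z t : nat -> K).

Local Notation free s := (w (rshift k s)).
Local Notation image s := (u (rshift k s)).
Local Notation jumps := (jump_set u w).
Local Notation jump_row := (jump_row u w).
Local Notation p := (image_rank u w).
Local Notation q := (free_rank u w).
Local Notation slide := (slide k m p q).
Local Notation glued := (glued u w).
Local Notation offset := (offset p q).

Let pq := image_free_rank wG wu.

(** The blocks from [s0] on act on positions smaller than [free_rank s0]. *)
Lemma slide_free_shape z (s : nat) (i c : 'I_k) (s0 : 'I_m) : (s0 <= s <= m)%N ->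
  (q s0 <= rev_ord c)%N -> slide z s i c = (i == rev_ord c)%:R.
Proof.
case/andP=> ls sm; apply: (slide_shape pq) => // s' /andP [ss' s'm].
by apply: (free_rank_le wG wu); rewrite s'm andbT; lia.
Qed.

Lemma eq_glued g z z' t t' s :
  (forall j, (offset s <= j < offset m)%N -> z j = z' j) ->
  ((p s < q s)%N -> t s = t' s) -> glued g z t s -> glued g z' t' s.
Proof.
move=> zz tt; rewrite /glued; case: ifP => // lt [t0 tE].
split=> [|i c iq]; first by rewrite -tt.
by rewrite (tE i c iq) tt // (@eq_slide K k m p q z z' s zz) // ltnW.
Qed.

(** Descending induction on the stage. Row [k + s] of [L] is a relation between
    row [free s] and the adapted basis, and can be solved for row [free s]. Only
    positions from [image_rank s] up to [free_rank s] occur: the relation stops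
    at row [image s], and the basis is the reversed identity in the columns of
    the pivots above row [free s], where that row vanishes. *)
Lemma glued_exists g L : col_pivots w g -> row_leads u L -> upper_triangular (L *m g) ->
  exists z t, forall s, glued g z t s.
Proof.
move=> gw Lu /upperP up.
suff main e (s' : nat) : (m - s' = e)%N -> (s' <= m)%N ->
    exists z t, forall s, (s' <= s)%N -> glued g z t s.
  by have [|//|z [t zt]] := main m 0%N; [rewrite subn0 | exists z, t => s; exact: zt].
elim: e s' => [|e IH] s' es sm.
  by exists (fun=> 0), (fun=> 0) => s ls; have := ltn_ord s; lia.
have lt : (s' < m)%N by lia.
pose s := Ordinal lt.
have [||z [t G]] := IH s'.+1; [by lia|by []|].
have [L1 L2 L3] := Lu (rshift k s).
pose r := row (rshift k s) L; pose b := r 0 (free s).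
have rL x : r 0 x = L (rshift k s) x by rewrite mxE.
have rg (c : 'I_(k + m)) : (c < rshift k s)%N -> (r *m g) 0 c = 0.
  by move=> lc; rewrite -row_mul mxE up.
have r0 x : x != free s -> x \notin jumps s.+1 -> r 0 x = 0.
  rewrite inE negb_and negbK -leqNgt => xs /orP [ux|/andP [kx xk]].
    by rewrite rL -(permKV u x) L3 //=; move: ux => /=; lia.
  have lx : (w^-1%g x - k < m)%N by have := ltn_ord (w^-1%g x); lia.
  have xE : x = free (Ordinal lx).
    by rewrite -[LHS](permKV w); congr (w _); apply: val_inj => /=; rewrite subnKC.
  have xs' : (Ordinal lx < s)%N.
    rewrite ltn_neqAle; apply/andP; split; last by move: xk => /=; lia.
    by apply: contraNneq xs => /val_inj E; rewrite xE E.
  by rewrite xE -(mul_slice_right wG _ _ gw) rg //= ltn_add2l.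
pose r' := r - b *: delta_mx 0 (free s).
have r'E x : x != free s -> r' 0 x = r 0 x.
  by move=> /negbTE xs; rewrite !mxE xs andbF mulr0 subr0.
have r'0 x : x \notin jumps s.+1 -> r' 0 x = 0.
  by have [->|xs] := eqVneq x (free s); [rewrite !mxE !eqxx mulr1 -rL subrr|rewrite r'E // => /r0 ->].
have jf i : jump_row s.+1 i != free s.
  have [jS _] := jump_rowP wG wu i lt.
  by apply: contraTneq jS => ->; exact: free_notin.
have r'C := comb_support wG wu lt r'0.
set nu := (fun i => _) in r'C.
have nuE i : nu i = r 0 (jump_row s.+1 i) by rewrite /nu r'E.
have rel j : b * g (free s) (lshift m j) + \sum_i nu i * g (jump_row s.+1 i) (lshift m j) = 0.
  rewrite -(comb_mul u w) -r'C mulmxBl -scalemxAl -rowE.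
  rewrite [X in _ + X]mxE rg /=; last by have := ltn_ord j; lia.
  by rewrite !mxE add0r subrr.
have D i : exists d, d != 0 /\ forall c,
    slide z s.+1 i c = d * g (jump_row s.+1 i) (lshift m c).
  by have [d d0 dE] := slide_jump_row wG wu lt gw G i; exists d.
have [d dP] := choice D.
have relS j : b * g (free s) (lshift m j) + \sum_i (nu i / d i) * slide z s.+1 i j = 0.
  rewrite -[RHS](rel j); congr (_ + _); apply: eq_bigr => i _.
  by rewrite (dP i).2 mulrA divfK // (dP i).1.
have b0 : b != 0.
  apply/eqP => bz.
  have nz i : nu i = 0.
    have : (\row_i (nu i / d i)) *m slide z s.+1 = 0.
      apply/rowP => j; rewrite !mxE -[RHS](relS j) bz mul0r add0r.
      by apply: eq_bigr => i' _; rewrite mxE.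
    move/(congr1 (mulmx^~ (invmx (slide z s.+1)))).
    rewrite mul0mx mulmxK ?(slide_unit pq) // => /rowP/(_ i).
    by rewrite !mxE => /eqP; rewrite mulf_eq0 invr_eq0 (negbTE (dP i).1) orbF => /eqP.
  have : r' 0 (image s) = 0.
    by rewrite r'C mxE big1 // => i _; rewrite nz mulr0.
  rewrite /r' bz scale0r subr0 rL L1 => /eqP; by rewrite oner_eq0.
pose zeta i := - (nu i / d i) / b.
have gE j : g (free s) (lshift m j) = \sum_i zeta i * slide z s.+1 i j.
  apply: (mulfI b0); rewrite -[LHS](addrK (\sum_i (nu i / d i) * slide z s.+1 i j)) relS.
  rewrite sub0r mulr_sumr -sumrN; apply: eq_bigr => i _.
  by rewrite /zeta -mulNr mulrA [b * _]mulrC divfK.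
have zeta0 (i : 'I_k) : (i < p s)%N -> zeta i = 0.
  move=> li; suff E : nu i = 0 by rewrite /zeta E mul0r oppr0 mul0r.
  rewrite nuE rL L2 // ltnNge; apply/negP => /(rank_above_le (jumps s.+1)).
  have [_ ->] := jump_rowP wG wu i lt; rewrite -image_rankE; lia.
have zeta1 (i : 'I_k) : (q s <= i)%N -> zeta i = 0.
  move=> li; have := gE (rev_ord i).
  have shape i' : slide z s.+1 i' (rev_ord i) = (i' == i)%:R.
    rewrite (@slide_free_shape z s.+1 i' (rev_ord i) s) ?rev_ordK //.
    by rewrite leqnSn.
  rewrite (bigD1 i) //= shape eqxx mulr1 big1 ?addr0 => [<-|i' /negbTE ii']; last first.
    by rewrite shape ii' mulr0.
  have [_ g0 _] := gw (lshift m (rev_ord i)); apply: g0.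
  by rewrite (pivot_lt_free wG wu) rev_ordK -free_rankE.
have [plt|ple] := boolP (p s < q s)%N; last first.
  exists z, t => s1; rewrite leq_eqVlt => /orP [/eqP E|]; last exact: G.
  have -> : s1 = s by apply: val_inj; rewrite /= E.
  rewrite /glued (negbTE ple) => c; rewrite gE big1 // => i _.
  by have [li|li] := ltnP i (p s); [rewrite zeta0 ?mul0r | rewrite zeta1 ?mul0r //; lia].
have qk := pq (ltn_ord s).
have lip : (p s < k)%N by lia.
pose ip := Ordinal lip.
have ne := plt; rewrite (moved_rank wG wu) in ne.
have zp : zeta ip != 0.
  rewrite /zeta mulf_neq0 ?invr_eq0 // oppr_eq0 mulf_neq0 ?invr_eq0 ?(dP _).1 // nuE.
  have -> : jump_row s.+1 ip = image s.
    apply: (jump_row_rank wG wu) => //; first exact: (image_in wG wu).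
    by rewrite -image_rankE.
  by rewrite rL L1 oner_neq0.
(* The inverse of [block_coef]: the variable at distance [i] from the end of
   the block is the coefficient at position [image_rank s + 1 + i]. *)
pose z' j := if (j < offset s'.+1)%N then
  coords (\row_i zeta i) ((q s).-1 - (j - offset s'))%N / zeta ip else z j.
pose t' j := if j == s' then zeta ip else t j.
have cfE (i : 'I_k) : block_coef (p s) (q s).-1 (fun j => z' (offset s' + j)%N) i = zeta i / zeta ip.
  rewrite /block_coef; case: eqP => [E|/eqP ne'].
    by have -> : i = ip; [exact: val_inj | rewrite divff].
  case: ifP => [/andP [pi iq]|out].
    rewrite /z' ifT; last by rewrite offsetS; move: plt iq pi; rewrite /=; lia.
    have -> : ((q s).-1 - (offset s' + ((q s).-1 - i) - offset s') = i)%N by lia.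
    by rewrite coordsE mxE.
  have [li|li] := ltnP i (p s); first by rewrite zeta0 ?mul0r.
  by rewrite zeta1 ?mul0r //; lia.
exists z', t' => s1; rewrite leq_eqVlt => /orP [/eqP E|l1]; last first.
  apply: (eq_glued _ _ (G s1 l1)) => [j /andP [oj _]|_].
    by rewrite /z' ifF //; have := offset_le p q l1; lia.
  by rewrite /t' gtn_eqF.
have -> : s1 = s by apply: val_inj; rewrite /= E.
rewrite /glued plt; split; first by rewrite /t' eqxx.
move=> i c iq; have [_ _ R3] := slide_rows pq z' i c lt plt.
rewrite R3 // gE /t' eqxx mulr_sumr; apply: eq_bigr => i' _.
rewrite cfE mulrA mulrCA divff // mulr1; congr (_ * _).
rewrite (@eq_slide _ _ _ _ _ z z') // => j /andP [oj _].
by rewrite /z' ltnNge (oj : (offset s'.+1 <= j)%N).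
Qed.

(** The later variables determine the adapted basis, and the coordinates of the
    next row in it determine the scalar and the variables of its block. *)
Lemma glued_unique g z t z' t' : (forall s, glued g z t s) -> (forall s, glued g z' t' s) ->
  (forall j, (j < offset m)%N -> z j = z' j) /\
  (forall s, (p s < q s)%N -> t s = t' s).
Proof.
move=> G G'; suff main e (s' : nat) : (m - s' = e)%N -> (s' <= m)%N ->
    (forall j, (offset s' <= j < offset m)%N -> z j = z' j) /\
    (forall s, (s' <= s)%N -> (p s < q s)%N -> t s = t' s).
  have [||H1 H2] := main m 0%N; rewrite ?subn0 //.
  by split=> [j|s]; [apply: H1 | apply: H2].
elim: e s' => [|e IH] s' es sm.
  have -> : s' = m by lia.
  by split=> [j|s]; [lia | have := ltn_ord s; lia].
have lt : (s' < m)%N by lia.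
pose s := Ordinal lt.
have [||H1 H2] := IH s'.+1; [by lia|by []|].
have S : slide z s.+1 = slide z' s.+1 by exact: (@eq_slide K k m p q z z' s.+1 H1).
have E : (p s < q s)%N -> t s = t' s /\ forall i : 'I_k,
    block_coef (p s) (q s).-1 (fun j => z (offset s + j)%N) i =
    block_coef (p s) (q s).-1 (fun j => z' (offset s + j)%N) i.
  move=> plt; have lip : (p s < k)%N by have := pq (ltn_ord s); lia.
  have C (i : 'I_k) := etrans (esym (glued_coords wG wu (G s) plt i))
    (etrans (congr1 (fun S => (row (free s) (lsubmx g) *m invmx S) 0 i) S)
            (glued_coords wG wu (G' s) plt i)).
  have tt : t s = t' s.
    by have := C (Ordinal lip); rewrite /block_coef eqxx !mulr1.
  split=> // i; have := C i; rewrite tt; apply: mulfI.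
  by have := G' s; rewrite /glued plt => -[].
split=> [j /andP [oj jm]|s1].
  have [lj|] := leqP (offset s'.+1) j; first by apply: H1; rewrite lj.
  rewrite offsetS => lj.
  have plt : (p s < q s)%N by rewrite -[nat_of_ord s]/s'; lia.
  have [_ cf] := E plt.
  have li : ((q s).-1 - (j - offset s') < k)%N by have := pq (ltn_ord s); lia.
  have := cf (Ordinal li); rewrite !block_coef_in; [|by rewrite /=; lia..].
  by rewrite (_ : (offset s + ((q s).-1 - Ordinal li))%N = j) //=; lia.
rewrite leq_eqVlt => /orP [/eqP e1|]; last exact: H2.
have -> : s1 = s by apply: val_inj; rewrite /= e1.
by case/E.
Qed.

Variables (X : fspace K) (rX : ringed X).

Lemma regmx_slide (z : X -> nat -> K) (s : nat) : (s <= m)%N ->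
  (forall j, (offset s <= j < offset m)%N -> regf (z^~ j)) ->
  regmx (fun x => slide (z x) s).
Proof.
move=> sm rz; apply: regmxM => //; last exact: regmx_const.
apply: (regmx_word rX) => j lj; apply: rz.
by have := size_blocks p q sm; lia.
Qed.

(** The inverse of [slide] is regular in the later variables, so that descending
    induction applies to the coordinates of the rows. *)
Lemma regf_glued (g : X -> 'M[K]_(k + m)) (z t : X -> nat -> K) :
  regmx g -> (forall x s, glued (g x) (z x) (t x) s) ->
  (forall j, (j < offset m)%N -> regf (z^~ j)) /\
  (forall s, (p s < q s)%N -> regf (t^~ s)).
Proof.
move=> rg G; suff main e (s' : nat) : (m - s' = e)%N -> (s' <= m)%N ->
    (forall j, (offset s' <= j < offset m)%N -> regf (z^~ j)) /\
    (forall s, (s' <= s)%N -> (p s < q s)%N -> regf (t^~ s)).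
  have [||H1 H2] := main m 0%N; rewrite ?subn0 //.
  by split=> [j|s]; [apply: H1 | apply: H2].
elim: e s' => [|e IH] s' es sm.
  have -> : s' = m by lia.
  by split=> [j|s]; [lia | have := ltn_ord s; lia].
have lt : (s' < m)%N by lia.
pose s := Ordinal lt.
have [||H1 H2] := IH s'.+1; [by lia|by []|].
have rS : regmx (fun x => slide (z x) s.+1) by exact: (regmx_slide lt).
have rC : regmx (fun x => row (free s) (lsubmx (g x)) *m invmx (slide (z x) s.+1)).
  apply: (regmxM rX); last first.
    by apply: (regmx_inv rX) => // x; apply: (slide_unit pq).
  move=> i c; apply: (@eq_regf _ _ (fun x => g x (free s) (lshift m c))) => [x|].
    by rewrite !mxE.
  exact: rg.
have E : (p s < q s)%N -> regf (t^~ s) /\ forall i : 'I_k,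
    regf (fun x => block_coef (p s) (q s).-1 (fun j => z x (offset s + j)%N) i).
  move=> plt; have lip : (p s < k)%N by have := pq (ltn_ord s); lia.
  have t0 x : t x s != 0 by have := G x s; rewrite /glued plt => -[].
  have rt : regf (t^~ s).
    apply: (eq_regf _ (rC 0 (Ordinal lip))) => x.
    by rewrite (glued_coords wG wu (G x s) plt) /block_coef eqxx mulr1.
  split=> // i; apply: (@eq_regf _ _ (fun x =>
    (row (free s) (lsubmx (g x)) *m invmx (slide (z x) s.+1)) 0 i * (t x s)^-1)) => [x|].
    by rewrite (glued_coords wG wu (G x s) plt) mulrC mulKf.
  apply: (regfM rX); first exact: rC.
  exact: (regfV rX).
split=> [j /andP [oj jm]|s1].
  have [lj|] := leqP (offset s'.+1) j; first by apply: H1; rewrite lj.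
  rewrite offsetS => lj.
  have plt : (p s < q s)%N by rewrite -[nat_of_ord s]/s'; lia.
  have [_ cf] := E plt.
  have li : ((q s).-1 - (j - offset s') < k)%N by have := pq (ltn_ord s); lia.
  apply: (eq_regf _ (cf (Ordinal li))) => x.
  by rewrite block_coef_in /=; [congr (z x _); lia | lia].
rewrite leq_eqVlt => /orP [/eqP e1|]; last exact: H2.
have -> : s1 = s by apply: val_inj; rewrite /= e1.
by case/E.
Qed.

End Exists.

(** * The juggling variety *)

Section JugglingVariety.
Variables (K : closedFieldType) (k m : nat) (u w : 'S_(k + m)).
Hypothesis wG : grassmannian k w.
Hypothesis wu : forall s : 'I_m, (w (rshift k s) <= u (rshift k s))%N.
Variables (pi : 'S_k) (cw : seq nat) (J : seq nat) (mu : nat).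
Hypothesis piE : forall t : 'I_k, jump_row u w 0 (pi^-1%g t) = u (lshift m t).
Hypothesis cw_reduced : reduced_word cw pi.
Implicit Types (s : 'I_m) (z t : nat -> K).

Local Notation pivot t := (w (lshift m t)).
Local Notation free s := (w (rshift k s)).
Local Notation p := (image_rank u w).
Local Notation q := (free_rank u w).
Local Notation slide := (slide k m p q).
Local Notation glued := (glued u w).
Local Notation offset := (offset p q).
Local Notation W := (permutation_mx K (longest k)).

Let pq := image_free_rank wG wu.

(** The free rows whose numbers are not fixed by the affine permutation. *)
Definition moved : seq nat := [seq s : nat <- iota 0 m | (p s < q s)%N].

Hypothesis JE : J = cw ++ blocks m p q 0.
Hypothesis muE : mu = size moved.

Lemma mem_moved (s : 'I_m) : ((s : nat) \in moved) = (p s < q s)%N.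
Proof. by rewrite mem_filter mem_iota add0n leq0n ltn_ord !andbT. Qed.

(** The sum has a single term, at position [free_rank s - 1]; in this form no
    ordinal has to be built. *)
Definition inserted_row (z t : nat -> K) (s : 'I_m) (c : 'I_k) : K :=
  if (p s < q s)%N then t s * \sum_(i < k | i.+1 == q s) slide z s i c else 0.

Definition glue (z t : nat -> K) : 'M[K]_(k + m) := \matrix_(x, c)
  match split c with
  | inl c' => match split (w^-1%g x) with
              | inl i => (i == c')%:R
              | inr s => inserted_row z t s c'
              end
  | inr s => (x == free s)%:R
  end.

Lemma glue_pivot z t (i c : 'I_k) : glue z t (pivot i) (lshift m c) = (i == c)%:R.
Proof. by rewrite mxE permK (unsplitK (inl c)) (unsplitK (inl i)). Qed.

Lemma glue_free z t s (c : 'I_k) : glue z t (free s) (lshift m c) = inserted_row z t s c.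
Proof. by rewrite mxE permK (unsplitK (inl c)) (unsplitK (inr s)). Qed.

Lemma glue_right z t x s : glue z t x (rshift k s) = (x == free s)%:R.
Proof. by rewrite mxE (unsplitK (inr s)). Qed.

Lemma sum_last (s : 'I_m) (i : 'I_k) (F : 'I_k -> K) : i.+1 = q s ->
  \sum_(i' < k | i'.+1 == q s) F i' = F i.
Proof.
move=> <-; rewrite (bigD1 i) //= big1 ?addr0 // => i' /andP [].
by rewrite eqSS => /eqP/val_inj ->; rewrite eqxx.
Qed.

Lemma glue_glued z t (s : 'I_m) : ((p s < q s)%N -> t s != 0) -> glued (glue z t) z t s.
Proof.
move=> t0; rewrite /glued; case: ifP => lt => [|c]; last by rewrite glue_free /inserted_row lt.
split=> [|i c iq]; first exact: t0.
by rewrite glue_free /inserted_row lt (sum_last _ iq).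
Qed.

Lemma glue_col_pivots z t : col_pivots w (glue z t).
Proof.
move=> c; case: (split_ordP c) => [i|s] ->; last first.
  rewrite !glue_right eqxx; split=> // [j lj|c' lc].
    by rewrite glue_right -val_eqE /= gtn_eqF.
  by rewrite glue_right (inj_eq perm_inj) -val_eqE ltn_eqF.
rewrite glue_pivot eqxx; split=> // [j|c'].
  rewrite -{1 2}(permKV w j); case: (split_ordP (w^-1%g j)) => [i'|s] -> lj.
    rewrite glue_pivot; case: eqP => // E; by rewrite E ltnn in lj.
  rewrite glue_free /inserted_row; case: ifP => // plt.
  rewrite big1 ?mulr0 // => i' /eqP iq.
  have lq : (q s <= rev_ord i)%N by rewrite free_rankE -(pivot_lt_free wG wu).
  have sm : (s <= s <= m)%N by rewrite leqnn ltnW.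
  rewrite (slide_free_shape wG wu z i' sm lq) -val_eqE ltn_eqF //.
  by rewrite -iq in lq.
case: (split_ordP c') => [i'|s] -> /= lc; last by have := ltn_ord i; lia.
by rewrite glue_pivot -val_eqE ltn_eqF.
Qed.

Lemma glued_glue g z t : col_pivots w g -> (forall s, glued g z t s) -> g = glue z t.
Proof.
move=> gw G; apply/matrixP=> x c; case: (split_ordP c) => [i|s] ->; last first.
  by rewrite glue_right (slice_right_col wG).
rewrite -(permKV w x); case: (split_ordP (w^-1%g x)) => [i'|s] ->.
  rewrite glue_pivot; have [H1 H2 H3] := gw (lshift m i).
  case: (ltngtP i' i) => li.
  - by rewrite H3 // -val_eqE ltn_eqF.
  - by rewrite H2 ?(pivot_lt wG li) // -val_eqE gtn_eqF.
  - by rewrite (val_inj li) eqxx H1.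
rewrite glue_free /inserted_row; have := G s; rewrite /glued; case: ifP => // lt [t0 tE].
have li : ((q s).-1 < k)%N by have := pq (ltn_ord s); lia.
by rewrite (@sum_last s (Ordinal li)) ?(tE (Ordinal li)) //=; lia.
Qed.

Lemma eq_glue z z' t t' : (forall j, (j < offset m)%N -> z j = z' j) ->
  (forall s : 'I_m, (p s < q s)%N -> t s = t' s) -> glue z t = glue z' t'.
Proof.
move=> zz tt; apply/matrixP=> x c; rewrite !mxE; case: split => // i.
case: split => // s; rewrite /inserted_row; case: ifP => // lt; rewrite tt //.
by rewrite (@eq_slide K k m p q z z') 1?ltnW // => j /andP [_]; apply: zz.
Qed.

Definition word_coords (v : 'rV[K]_(size J + mu)) (j : nat) := coords (lsubmx v) j.
Definition block_coords (v : 'rV[K]_(size J + mu)) (j : nat) :=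
  coords (lsubmx v) (size cw + j).
Definition torus_coords (v : 'rV[K]_(size J + mu)) (s : nat) :=
  coords (rsubmx v) (index s moved).

Local Notation product :=
  (affine_prod (braid_variety K J (longest k)) (torus K mu)).

Lemma size_J : size J = (size cw + offset m)%N.
Proof. by rewrite JE size_cat -(@size_blocks m p q 0). Qed.

(** The word of [pi] contributes the reducing matrix of the last adapted basis. *)
Lemma productP v : product v <->
  upper_triangular (word_mx k cw (word_coords v) *m slide (block_coords v) 0) /\
  (forall s : 'I_m, (p s < q s)%N -> torus_coords v s != 0).
Proof.
rewrite /affine_prod /=; split=> -[H1 H2]; split.
- move: H1; rewrite /braid_variety /= braid_word_mxE.
  suff -> : word_mx k J (coords (lsubmx v)) *m W =
     word_mx k cw (word_coords v) *m slide (block_coords v) 0 by [].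
  by rewrite /slide {1}JE word_mx_cat -mulmxA.
- move=> s plt; rewrite /torus_coords.
  have ls : (index (s : nat) moved < mu)%N by rewrite muE index_mem mem_moved.
  by rewrite -[index _ _]/(val (Ordinal ls)) coordsE; apply: H2.
- rewrite /braid_variety /= braid_word_mxE.
  suff -> : word_mx k J (coords (lsubmx v)) *m W =
     word_mx k cw (word_coords v) *m slide (block_coords v) 0 by [].
  by rewrite /slide {1}JE word_mx_cat -mulmxA.
- move=> j; have lj : (j < size moved)%N by rewrite -muE.
  have : nth 0%N moved j \in moved by rewrite mem_nth.
  rewrite mem_filter mem_iota => /andP [plt /= lm].
  have := H2 (Ordinal lm) plt; rewrite /torus_coords /= index_uniq //.
    by rewrite coordsE.
  by rewrite filter_uniq ?iota_uniq.
Qed.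

(** The variables of the blocks and the scalars give the matrix [g]. The
    variables of the word of [pi] are those of the matrix which reduces the last
    adapted basis, and are determined by it. *)
Lemma juggling_richardson : isomorphic (subspace product)
  (subspace (richardson_slice u w : set (affine_space K (k + m) (k + m)))).
Proof.
have asc := reduced_ascending cw_reduced.
have cwE : word_perm k cw = pi by case: cw_reduced.
have cpiv z : row_pivots pi^-1%g (word_mx k cw z : 'M[K]_k).
  by rewrite -cwE; apply: word_row_pivots.
have glues v : product v -> forall s, glued (glue (block_coords v) (torus_coords v))
    (block_coords v) (torus_coords v) s.
  by move=> /productP [_ tv] s; apply: glue_glued; apply: tv.
apply: (@affine_bijection_isomorphic _ _ _ _ _ _ _
  (fun v => glue (block_coords v) (torus_coords v))).
- move=> v Pv; have /productP [up _] := Pv.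
  apply: (glued_slice wG wu piE _ (glues v Pv) (cpiv (word_coords v)) up).
  exact: glue_col_pivots.
- move=> v v' Pv Pv' E; have Gv := glues v Pv; have Gv' := glues v' Pv'.
  rewrite E in Gv; have [zz tt] := glued_unique wG wu Gv Gv'.
  have SE : slide (block_coords v) 0 = slide (block_coords v') 0.
    by apply: eq_slide => // j /andP [_]; apply: zz.
  have /productP [up _] := Pv; have /productP [up' _] := Pv'.
  rewrite SE in up; have WE : word_mx k cw (word_coords v) = word_mx k cw (word_coords v').
    exact: (row_pivots_unique (cpiv _) up (cpiv _) up' (slide_unit pq _ (leq0n m))).
  have cc := word_mx_inj asc WE.
  rewrite -[v]hsubmxK -[v']hsubmxK; congr row_mx; apply/rowP => j.
    rewrite -!coordsE; have [lj|lj] := ltnP j (size cw); first exact: cc.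
    have := zz (j - size cw)%N; rewrite /block_coords subnKC //; apply.
    by have := ltn_ord j; rewrite {2}size_J; lia.
  rewrite -!coordsE; have lj : (j < size moved)%N by rewrite -muE.
  have : nth 0%N moved j \in moved by rewrite mem_nth.
  rewrite mem_filter mem_iota => /andP [plt /= lm].
  have := tt (Ordinal lm) plt; rewrite /torus_coords /= index_uniq //.
  by rewrite filter_uniq ?iota_uniq.
- move=> g [gw [L [Lu up]]].
  have [z [t G]] := glued_exists wG wu gw Lu up.
  have [A [Api Aup]] := glued_pivots wG wu piE gw G Lu up.
  have [|y yE] := @row_pivots_word _ _ _ A asc; first by rewrite cwE.
  pose v : 'rV[K]_(size J + mu) := row_mx
    (\row_j if (j < size cw)%N then y j else z (j - size cw)%N) (\row_j t (nth 0%N moved j)).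
  have cv j : (j < size J)%N -> coords (lsubmx v) j =
      if (j < size cw)%N then y j else z (j - size cw)%N.
    by move=> lj; rewrite -[j]/(val (Ordinal lj)) coordsE row_mxKl mxE.
  have zv j : (j < offset m)%N -> block_coords v j = z j.
    move=> lj; rewrite /block_coords cv ?size_J ?ltn_add2l //.
    by rewrite ltnNge leq_addr /= addKn.
  have tv (s : 'I_m) : (p s < q s)%N -> torus_coords v s = t s.
    move=> plt; have ls : (index (s : nat) moved < mu)%N by rewrite muE index_mem mem_moved.
    rewrite /torus_coords -[index _ _]/(val (Ordinal ls)) coordsE row_mxKr mxE /=.
    by rewrite nth_index // mem_moved.
  exists v; last by rewrite (glued_glue gw G); apply: eq_glue.
  apply/productP; split.
    have -> : slide (block_coords v) 0 = slide z 0.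
      by apply: eq_slide => // j /andP [_] /zv.
    rewrite (_ : word_mx k cw (word_coords v) = A) // -yE; apply: eq_word_mx => j lj.
    by rewrite /word_coords cv ?lj // size_J ltn_addr.
  by move=> s plt; rewrite tv //; have := G s; rewrite /glued plt => -[].
- set X := subspace _; have rX : ringed X by apply/subspace_ringed/affine_ringed.
  have rv : @regmx K X 1 (size J + mu) (fun v => sval v) by exact: regmx_sval.
  have rl : @regmx K X 1 (size J) (fun v => lsubmx (sval v)).
    by move=> i j; apply: (eq_regf _ (rv i (lshift mu j))) => v; rewrite mxE.
  have rr : @regmx K X 1 mu (fun v => rsubmx (sval v)).
    by move=> i j; apply: (eq_regf _ (rv i (rshift (size J) j))) => v; rewrite mxE.
  have rs (s : 'I_m) : @regmx K X k k (fun v => slide (block_coords (sval v)) s).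
    apply: (regmx_slide rX) => [|j _]; first exact: ltnW.
    exact: (regf_coords rX rl).
  move=> x c; case: (split_ordP c) => [c'|s] ->; last first.
    apply: (eq_regf _ (regf_const rX (x == free s)%:R)) => v.
    by rewrite glue_right.
  rewrite -(permKV w x); case: (split_ordP (w^-1%g x)) => [i|s] ->.
    apply: (eq_regf _ (regf_const rX (i == c')%:R)) => v.
    by rewrite glue_pivot.
  apply: (@eq_regf K X (fun v => inserted_row (block_coords (sval v))
     (torus_coords (sval v)) s c')) => [v|]; first by rewrite glue_free.
  rewrite /inserted_row; case: (p s < q s)%N; last exact: (regf_const rX).
  apply: (regfM rX); first exact: (regf_coords rX rr).
  by apply: (regf_sum rX) => i _; apply: rs.
- set X := subspace _; have rX : ringed X by apply/subspace_ringed/affine_ringed.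
  move=> v vP.
  have rg : @regmx K X (k + m) (k + m) (fun x => sval x) by exact: regmx_sval.
  have G x s : glued (sval x) (block_coords (v x)) (torus_coords (v x)) s.
    by have [Pv <-] := vP x; apply: glues.
  have [rz rt] := regf_glued wG wu rX rg G.
  have rS : @regmx K X k k (fun x => slide (block_coords (v x)) 0).
    by apply: (regmx_slide rX) => // j /andP [_]; apply: rz.
  have rA : @regmx K X k k (fun x => word_mx k cw (word_coords (v x))).
    apply: (@regmx_row_pivots K k X rX pi^-1%g _ (fun x => slide (block_coords (v x)) 0)) => //.
    move=> x; split; [exact: cpiv| |exact: (slide_unit pq)].
    by have [/productP []] := vP x.
  move=> i j; rewrite (ord1 i); case: (split_ordP j) => j' ->.
    have [lj|lj] := ltnP j' (size cw).
      apply: (eq_regf _ (regf_word_coords rX asc rA lj)) => x.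
      by rewrite /word_coords coordsE mxE.
    have lj' : (j' - size cw < offset m)%N by have := ltn_ord j'; rewrite {2}size_J; lia.
    apply: (eq_regf _ (rz _ lj')) => x.
    by rewrite /block_coords subnKC // coordsE mxE.
  have lj : (j' < size moved)%N by rewrite -muE.
  have : nth 0%N moved j' \in moved by rewrite mem_nth.
  rewrite mem_filter mem_iota => /andP [plt /= lm].
  apply: (eq_regf _ (rt (Ordinal lm) plt)) => x.
  rewrite /torus_coords /= index_uniq ?filter_uniq ?iota_uniq //.
  by rewrite coordsE mxE.
Qed.

End JugglingVariety.

(** * Bruhat order and boundedness *)

Section Bruhat.
Variable n : nat.
Implicit Types (u v w : 'S_n) (i j x : 'I_n).

Definition inversions v : {set 'I_n * 'I_n} :=
  [set c : 'I_n * 'I_n | (c.1 < c.2)%N && (v c.2 < v c.1)%N]%SET.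

(** The map [phi] sends inversions after the exchange to inversions before it:
    it applies the transposition to both positions if this keeps their order, and
    nothing otherwise. Applying the transposition to an image gives an ordered
    pair in the first case only, whence injectivity. *)
Lemma perm_length_swap_le u i j : (i < j)%N -> (u j < u i)%N ->
  (perm_length (tperm i j * u)%g <= perm_length u)%N.
Proof.
move=> ij uji; pose t := tperm i j.
pose phi (c : 'I_n * 'I_n) := if (t c.1 < t c.2)%N then (t c.1, t c.2) else c.
have phi_inj : {in inversions (t * u)%g &, injective phi}.
  move=> [a b] [c d]; rewrite !inE /= => /andP [ab _] /andP [cd _]; rewrite /phi /=.
  case: ifP => l1; case: ifP => l2 [].
  - by move=> /perm_inj -> /perm_inj ->.
  - by move=> e1 e2; move: l2; rewrite -e1 -e2 !tpermK ab.
  - by move=> e1 e2; move: l1; rewrite e1 e2 !tpermK cd.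
  - by move=> -> ->.
rewrite /perm_length -/(inversions _) -/(inversions u) -(card_in_imset phi_inj).
apply/subset_leq_card/fintype.subsetP => _ /imsetP [[a b] + ->].
rewrite !inE /= !permM => /andP [ab]; rewrite -/t /phi /= => uab.
case: ifP => l /=; first by rewrite l.
rewrite ab /=; move: l uab; rewrite /t.
case: (tpermP i j a) => [ai|aj|/eqP ai /eqP aj];
  case: (tpermP i j b) => [bi|bj|/eqP bi /eqP bj]; move: ab ij uji;
  rewrite ?ai ?aj ?bi ?bj; move=> *; try lia.
Qed.

Lemma bruhat_step_swap u v : bruhat_step u v ->
  exists i j, [/\ (i < j)%N, (u i < u j)%N & v = (tperm i j * u)%g].
Proof.
case/andP=> /existsP [i /existsP [j /eqP ->]]; rewrite /compp => lt.
wlog ij : i j lt / (i < j)%N.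
  move=> H; case: (ltngtP i j) => ij; first exact: H ij.
    by have := H j i; rewrite tpermC; apply.
  by move: lt; rewrite (val_inj ij) tperm1 mul1g ltnn.
exists i, j; split=> //; rewrite ltnNge leq_eqVlt; apply/negP => /orP [/eqP/val_inj/perm_inj E|l].
  by rewrite E ltnn in ij.
by have := perm_length_swap_le ij l; rewrite leqNgt lt.
Qed.

(** The rank function which characterizes the Bruhat order. *)
Definition excess u (a b : nat) := #|[set x : 'I_n | (x < a)%N && (b <= u x)%N]%SET|.

(** Putting a larger value in an earlier position cannot decrease the number of
    large values among the first [a]. *)
Lemma bruhat_excess u w a b : bruhat_le u w -> (excess u a b <= excess w a b)%N.
Proof.
case/connectP => c; elim: c u => [|v c IH] u /=; first by move=> _ ->.
case/andP=> /bruhat_step_swap [i [j [ij uij vE]]] pc lc.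
apply: leq_trans (IH _ pc lc).
have [ja|aj] := ltnP j a; last have [ai|ia] := leqP a i.
- rewrite /excess -[X in (X <= _)%N](card_preimset _ (@perm_inj _ (tperm i j))).
  apply/subset_leq_card/fintype.subsetP => x; rewrite !inE vE permM => /andP [+ ->].
  by rewrite andbT; case: tpermP => [->|->|//] _; lia.
- apply/subset_leq_card/fintype.subsetP => x; rewrite !inE vE permM => /andP [xa bx].
  by rewrite xa tpermD //; apply: contraTneq xa => <-; rewrite -leqNgt //; lia.
- apply/subset_leq_card/fintype.subsetP => x; rewrite !inE vE permM => /andP [xa].
  rewrite xa /=; case: tpermP => [->|E|//]; first by lia.
  by move: xa; rewrite E; lia.
Qed.

End Bruhat.

(** If [u(k+s) = y < w(k+s)], all values up to [y] of [w] are taken before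
    position [k + s], since [w] increases from there on; but [u] takes the value
    [y] at that position, which contradicts the rank condition. *)
Lemma bruhat_grassmannian_bounded k m (u w : 'S_(k + m)) :
  grassmannian k w -> bruhat_le u w ->
  forall s : 'I_m, (w (rshift k s) <= u (rshift k s))%N.
Proof.
move=> wG uw s; rewrite leqNgt; apply/negP => lt.
set c := rshift k s in lt; set y : nat := u c in lt.
have split_card (v : 'S_(k + m)) :
    (excess v c y.+1 + #|[set x : 'I_(k + m) | (x < c)%N && (v x <= y)%N]%SET| = c)%N.
  rewrite -[RHS](card_ord_lt (ltnW (ltn_ord c))).
  rewrite -[RHS](cardsID [set x : 'I_(k + m) | (y < v x)%N]%SET); congr (_ + _)%N; apply: eq_card => x.
    by rewrite !inE.
  by rewrite !inE -leqNgt andbC.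
have := bruhat_excess c y.+1 uw; have := split_card u; have := split_card w.
have pre (v : 'S_(k + m)) : #|[set x : 'I_(k + m) | (v x < y.+1)%N]%SET| = y.+1.
  rewrite -[RHS](@card_ord_lt (k + m)) ?ltn_ord //.
  by rewrite -[RHS](card_preimset _ (@perm_inj _ v)); apply: eq_card => x; rewrite !inE.
have -> : #|[set x : 'I_(k + m) | (x < c)%N && (w x <= y)%N]%SET| = y.+1.
  rewrite -(pre w); apply: eq_card => x; rewrite !inE ltnS; apply/andP/idP => [[]//|wx].
  split=> //; rewrite ltnNge; apply/negP; rewrite leq_eqVlt => /orP [/eqP/val_inj E|cx].
    by move: lt; rewrite E ltnNge wx.
  by have := proj2 wG c x (leq_addr _ _) cx; lia.
have : (#|[set x : 'I_(k + m) | (x < c)%N && (u x <= y)%N]%SET| < y.+1)%N.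
  rewrite -(pre u); apply/proper_card/properP; split.
    by apply/fintype.subsetP => x; rewrite !inE ltnS => /andP [].
  by exists c; rewrite !inE ?ltnS ?leqnn // ltnn.
lia.
Qed.

(** * The juggling word *)

(** The argument is [x + 1] because positions are counted from 1. *)
Lemma periodicE n (g : 'I_n -> int) (x : 'I_n) (d : nat) :
  periodic g (x.+1%:Z + (d * n)%:Z) = g x + (d * n)%:Z.
Proof.
have n0 : (0 < n)%N by case: n x {g} => // -[].
rewrite /periodic; have -> : x.+1%:Z + (d * n)%:Z - 1 = d%:Z * n%:Z + x%:Z by lia.
have nz : n%:Z != 0 by lia.
have xn : 0 <= x%:Z < `|n%:Z| by have := ltn_ord x; lia.
by rewrite modzMDl divzMDl // divz_small // modz_small //= valK addr0 PoszM.
Qed.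

Lemma periodic_base n (g : 'I_n -> int) (x : 'I_n) : periodic g x.+1%:Z = g x.
Proof. by have := periodicE g x 0; rewrite mul0n !addr0. Qed.

Lemma periodic_shift n (g : 'I_n -> int) (x : 'I_n) :
  periodic g (x.+1%:Z + n%:Z) = g x + n%:Z.
Proof. by have := periodicE g x 1; rewrite mul1n. Qed.

Lemma count_iota_card m (P : pred nat) : count P (iota 0 m) = #|[set s : 'I_m | P s]%SET|.
Proof. by rewrite -sum1_count -sum1dep_card -[m in iota 0 m]subn0 big_mkord. Qed.

Lemma filter_iota_interval m a b : (a <= b <= m)%N ->
  [seq i <- iota 1 m | (a < i <= b)%N] = iota a.+1 (b - a).
Proof.
move=> abm; apply: (irr_sorted_eq ltn_trans ltnn).
- by apply: sorted_filter; [apply: ltn_trans|apply: iota_ltn_sorted].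
- exact: iota_ltn_sorted.
- by move=> i; rewrite mem_filter !mem_iota; lia.
Qed.

Lemma drop_enum_ord m d : drop d (enum 'I_m) = [seq s : 'I_m <- enum 'I_m | (d <= s)%N].
Proof.
apply: (inj_map val_inj); rewrite map_drop val_enum_ord -(filter_map val (leq d)) val_enum_ord.
apply: (irr_sorted_eq ltn_trans ltnn).
- by apply: drop_sorted; apply: iota_ltn_sorted.
- by apply: sorted_filter; [apply: ltn_trans|apply: iota_ltn_sorted].
- by move=> i; rewrite drop_iota mem_filter !mem_iota; lia.
Qed.

Section JugglingWord.
Variables (k m : nat) (u w : 'S_(k + m)).
Hypothesis wG : grassmannian k w.
Hypothesis wu : forall s : 'I_m, (w (rshift k s) <= u (rshift k s))%N.
Implicit Types (s : 'I_m) (x y : 'I_(k + m)).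

Local Notation n := (k + m)%N.
Local Notation pivot t := (w (lshift m t)).
Local Notation free s := (w (rshift k s)).
Local Notation image s := (u (rshift k s)).
Local Notation jumps := (jump_set u w).
Local Notation p := (image_rank u w).
Local Notation q := (free_rank u w).
Local Notation f := (bounded_affine_perm k u w).

Lemma bounded_affine_permE x :
  f (w x).+1%:Z = (u x).+1%:Z + (if (x < k)%N then n%:Z else 0).
Proof.
rewrite /bounded_affine_perm /= /perm_ext /translation.
rewrite !periodic_base permK; case: ifP => _; first by rewrite periodic_shift.
by rewrite !addr0 periodic_base.
Qed.

Lemma bounded_affine_pivot (t : 'I_k) :
  f (pivot t).+1%:Z = (u (lshift m t)).+1%:Z + n%:Z.
Proof. by rewrite bounded_affine_permE /= ltn_ord. Qed.

Lemma bounded_affine_free s : f (free s).+1%:Z = (image s).+1%:Z.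
Proof. by rewrite bounded_affine_permE /= ltnNge leq_addr /= addr0. Qed.

Lemma mem_letter i : (i \in iota 1 n) -> exists x, i = (w x).+1.
Proof.
rewrite mem_iota => lin; have li : (i.-1 < n)%N by lia.
by exists (w^-1%g (Ordinal li)); rewrite permKV /=; lia.
Qed.

Lemma iseqE : iseq n f = [seq (pivot t).+1 | t <- enum 'I_k].
Proof.
apply: (irr_sorted_eq ltn_trans ltnn).
- by apply: sorted_filter; [apply: ltn_trans|apply: iota_ltn_sorted].
- rewrite sorted_map; apply: (sub_sorted (e := fun t t' : 'I_k => (t < t')%N)).
    by move=> t t' /(pivot_lt wG).
  by have := iota_ltn_sorted 0 k; rewrite -val_enum_ord sorted_map.
move=> i; rewrite mem_filter; apply/andP/mapP => [[fi /mem_letter [x xE]]|[t _ ->]].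
  rewrite xE in fi *; case: (split_ordP x) fi => [t|s] -> fi.
    by exists t; rewrite ?mem_enum.
  by move: fi; rewrite bounded_affine_free; have := ltn_ord (image s); lia.
by rewrite bounded_affine_pivot mem_iota; have := ltn_ord (pivot t); lia.
Qed.

Lemma jseqE : jseq n f = [seq (free s).+1 | s <- enum 'I_m].
Proof.
apply: (irr_sorted_eq ltn_trans ltnn).
- by apply: sorted_filter; [apply: ltn_trans|apply: iota_ltn_sorted].
- rewrite sorted_map; apply: (sub_sorted (e := fun s s' : 'I_m => (s < s')%N)).
    by move=> s s' /(free_lt wG).
  by have := iota_ltn_sorted 0 m; rewrite -val_enum_ord sorted_map.
move=> i; rewrite mem_filter; apply/andP/mapP => [[fi /mem_letter [x xE]]|[s _ ->]].
  rewrite xE in fi *; case: (split_ordP x) fi => [t|s] -> fi.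
    by move: fi; rewrite bounded_affine_pivot; lia.
  by exists s; rewrite ?mem_enum.
by rewrite bounded_affine_free mem_iota; have := ltn_ord (free s); have := ltn_ord (image s); lia.
Qed.

Lemma nth_iseq (t : 'I_k) : nth 0%N (iseq n f) t = (pivot t).+1.
Proof. by rewrite iseqE (nth_map t) ?size_enum_ord // nth_ord_enum. Qed.

Lemma nth_jseq s : nth 0%N (jseq n f) s = (free s).+1.
Proof. by rewrite jseqE (nth_map s) ?size_enum_ord // nth_ord_enum. Qed.

(** The characterization by ranks determines the permutation, and the inverse of
    the rank function satisfies it. *)
Lemma juggling_permE (t : 'I_k) :
  jump_row u w 0 ((juggling_perm n k f)^-1%g t) = u (lshift m t).
Proof.
pose above (t : 'I_k) := [set t' : 'I_k | (u (lshift m t) < u (lshift m t'))%N]%SET.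
have aboveE (t0 : 'I_k) : #|[set t1 : 'I_k | f (nth 0%N (iseq n f) t0)%:Z <
    f (nth 0%N (iseq n f) t1)%:Z]%SET| = #|above t0|.
  by apply: eq_card => t1; rewrite !inE !nth_iseq !bounded_affine_pivot; lia.
have rankE (t0 : 'I_k) : rank_above (jumps 0) (u (lshift m t0)) = #|above t0|.
  rewrite -(card_imset _ (inj_comp (@perm_inj _ u) (@lshift_inj k m))).
  apply: eq_card => x; rewrite in_above jump_set_bottom.
  apply/andP/imsetP => [[xk lx]|[t1 + ->]]; last first.
    by rewrite inE => lt; rewrite /= permK /=.
  exists (Ordinal xk); last by rewrite /= -[LHS](permKV u); congr (u _); apply: val_inj.
  rewrite inE (_ : u (lshift m (Ordinal xk)) = x) //.
  by rewrite -[RHS](permKV u); congr (u _); apply: val_inj.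
have inJ (t0 : 'I_k) : u (lshift m t0) \in jumps 0 by rewrite jump_set_bottom permK /=.
rewrite /juggling_perm; case: pickP => [pi /forallP piP|none].
  apply: (jump_row_rank wG wu) => //; rewrite rankE -aboveE.
  by have := piP (pi^-1%g t); rewrite permKV => /eqP.
have lk (t0 : 'I_k) : (#|above t0| < k)%N.
  by rewrite -rankE -[X in (_ < X)%N](card_jump_set wG wu (leq0n m)) rank_above_card.
have rk_inj : injective (fun t0 => Ordinal (lk t0)).
  move=> t0 t1 [E]; apply: (@lshift_inj k m); apply: (@perm_inj _ u).
  by apply: (rank_above_inj (inJ t0) (inJ t1)); rewrite !rankE.
have := none (perm rk_inj)^-1%g; move/negbT/negP; case; apply/forallP => i.
have E : perm rk_inj ((perm rk_inj)^-1%g i) = i by rewrite permKV.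
by rewrite aboveE; apply/eqP; rewrite -[RHS](congr1 val E) permE.
Qed.

(** Below a row [y] which is not above [free s], every row is a jump, except for
    the images of later positions. *)
Lemma rank_above_complement s y : (free s <= y)%N ->
  (rank_above (jumps s.+1) y + #|[set x : 'I_n | (y < x)%N && (k + s < u^-1%g x)%N]%SET|
    = n - y.+1)%N.
Proof.
move=> fy; rewrite -(card_ord_gt (ltn_ord y)).
rewrite -[RHS](cardsID [set x : 'I_n | (u^-1%g x <= k + s)%N]%SET).
congr (_ + _)%N; apply: eq_card => x; last first.
  by rewrite !inE -ltnNge andbC.
rewrite in_above !inE [RHS]andbC; have [lx|] := boolP (y < x)%N; last by rewrite !andbF.
rewrite !andbT addnS ltnS; case: (u^-1%g x <= k + s)%N => //=.
apply/negP => /andP [kx]; rewrite ltnS => xs.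
have l : (w^-1%g x - k < m)%N by have := ltn_ord (w^-1%g x); lia.
have xE : x = free (Ordinal l).
  by rewrite -[LHS](permKV w); congr (w _); apply: val_inj => /=; rewrite subnKC.
have : (Ordinal l <= s)%N by move: xs => /=; lia.
rewrite leq_eqVlt => /orP [/eqP/val_inj E|/(free_lt wG)]; last by rewrite -xE; lia.
by move: lx; rewrite xE E; lia.
Qed.

(** All images of later positions lie below [free s]. *)
Lemma free_rank_formula s : (q s + free s = k + s)%N.
Proof.
have := rank_above_complement (leqnn (free s)); rewrite -free_rankE.
have -> : #|[set x : 'I_n | (free s < x)%N && (k + s < u^-1%g x)%N]%SET| = (m - s.+1)%N.
  transitivity #|[set x : 'I_n | (k + s < u^-1%g x)%N]%SET|.
    apply: eq_card => x; rewrite !inE; apply: andb_idl => lx.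
    rewrite -(permKV u x); case: (split_ordP (u^-1%g x)) lx => [t|s'] -> /=.
      by have := ltn_ord t; lia.
    by rewrite ltn_add2l => /(free_lt wG) lt; apply: leq_trans (wu s').
  transitivity #|[set x : 'I_n | (k + s < x)%N]%SET|.
    by rewrite -[RHS](card_preimset _ (@perm_inj _ u^-1%g)); apply: eq_card => x; rewrite !inE.
  by rewrite card_ord_gt ?ltn_add2l //; have := ltn_ord s; lia.
by have := ltn_ord s; have := ltn_ord (free s); lia.
Qed.

Lemma inv_countE s : inv_count n f s.+1 =
  #|[set s' : 'I_m | (s < s')%N && (image s' < image s)%N]%SET|.
Proof.
rewrite /inv_count /= nth_jseq jseqE -map_drop drop_enum_ord count_map count_filter.
rewrite -sum1_count -sum1dep_card big_enum_cond /=; apply: eq_bigl => s'.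
by rewrite !bounded_affine_free ltz_nat ltnS andbC.
Qed.

(** The images of later positions are either below [image s], or counted as
    inversions. *)
Lemma image_rank_formula s : (p s + image s = k + s + inv_count n f s.+1)%N.
Proof.
have := rank_above_complement (wu s); rewrite -image_rankE.
set A := [set x : 'I_n | _]%SET.
have : (#|A| + inv_count n f s.+1 = m - s.+1)%N.
  rewrite -(card_ord_gt (ltn_ord s)) inv_countE.
  rewrite -[RHS](cardsID [set s' : 'I_m | (image s < image s')%N]%SET).
  congr (_ + _)%N.
    rewrite -[RHS](card_imset _ (inj_comp (@perm_inj _ u) (@rshift_inj k m))).
    apply: eq_card => x; rewrite !inE; apply/andP/imsetP => /= [[lx ux]|[s' + ->]].
      case: (split_ordP (u^-1%g x)) ux => [t|s'] e; rewrite e /=.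
        by have := ltn_ord t; lia.
      rewrite ltn_add2l => lt; exists s'; last by rewrite -e permKV.
      by rewrite !inE lt -e permKV lx.
    by rewrite !inE permK /= ltn_add2l => /andP [-> ->].
  apply: eq_card => s'; rewrite !inE -leqNgt.
  have [lt|] := ltnP s s'; last by rewrite !andbF.
  have : image s' != image s.
    by rewrite (inj_eq perm_inj) (inj_eq (@rshift_inj _ _)) -val_eqE gtn_eqF.
  by rewrite -val_eqE /=; lia.
by have := ltn_ord s; have := ltn_ord (image s); lia.
Qed.

Lemma juggling_blockE s : juggling_block n k f s.+1 = block p q s.
Proof.
rewrite /juggling_block /block /= nth_jseq bounded_affine_free filter_rev; congr rev.
have pq := image_free_rank wG wu (ltn_ord s).
have qE := free_rank_formula s; have pE := image_rank_formula s.
have [plt|ple] := leqP (q s) (p s).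
  rewrite (_ : (q s - p s).-1 = 0)%N /=; last by lia.
  rewrite -(filter_pred0 (iota 1 k.-1)); apply: eq_filter => i /=.
  by apply/negP; lia.
have -> : ((q s - p s).-1 = (q s).-1 - p s)%N by lia.
rewrite -(@filter_iota_interval k.-1); last by lia.
by apply: eq_filter => i /=; lia.
Qed.

Lemma juggling_blocksE :
  flatten [seq juggling_block n k f i | i <- iota 1 m] = blocks m p q 0.
Proof.
rewrite /blocks subn0 -[1%N]addn0 iotaDl -map_comp; congr flatten.
apply/eq_in_map => s; rewrite mem_iota => sm /=.
have lt : (s < m)%N by lia.
by rewrite add1n (juggling_blockE (Ordinal lt)).
Qed.

(** Pivot rows are sent beyond [n], and contribute no fixed points. *)
Lemma size_moved : (m - fixed_points n f)%N = size (moved u w).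
Proof.
have -> : fixed_points n f = #|[set s : 'I_m | free s == image s]%SET|.
  rewrite /fixed_points -[1%N]addn0 iotaDl count_map count_iota_card.
  rewrite -(card_preimset _ (@perm_inj _ w)).
  rewrite -[RHS](card_imset _ (@rshift_inj k m)); apply: eq_card => x; rewrite !inE /= add1n.
  apply/idP/imsetP => [|[s + ->]]; last first.
    by rewrite inE bounded_affine_free => /eqP ->.
  case: (split_ordP x) => [t|s] ->.
    by rewrite bounded_affine_pivot; have := ltn_ord (pivot t); lia.
  rewrite bounded_affine_free => /eqP E; exists s => //; rewrite inE.
  by apply/eqP; apply: val_inj => /=; lia.
rewrite /moved size_filter count_iota_card.
have -> : [set s : 'I_m | (p s < q s)%N]%SET = (~: [set s : 'I_m | free s == image s])%SET.
  by apply/setP => s; rewrite !inE (moved_rank wG wu).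
by rewrite [RHS]cardsCs card_ord finset.setCK.
Qed.

End JugglingWord.

(** * The theorem *)

Theorem theorem1p3 (R : realType) (n k : nat) (u w : 'S_n) (a b : seq nat) :
  (k <= n)%N ->
  bruhat_le u w ->
  grassmannian k w ->
  reduced_word a (compp u^-1%g (longest n)) ->
  reduced_word b (compp (longest n) (compp w (longest n))) ->
  let f := bounded_affine_perm k u w in
  let phi := fixed_points n f in
  isomorphic
    (subspace (open_positroid R[i] k u w))
    (subspace (braid_variety R[i] (a ++ b) (longest n)))
  /\
  (forall J : seq nat, juggling_word n k f J ->
     isomorphic
       (subspace (braid_variety R[i] (a ++ b) (longest n)))
       (subspace (affine_prod (braid_variety R[i] J (longest k))
                              (torus R[i] (n - k - phi))))).
Proof.
move=> kn uw wG ra rb; cbv zeta.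
have XR := braid_variety_richardson R[i] ra rb.
split.
  apply: isomorphic_trans (isomorphic_sym XR).
  exact: positroid_richardson.
move=> J; rewrite /juggling_word; case=> c rc JE.
apply: isomorphic_trans XR _; apply: isomorphic_sym.
have [m nE] : exists m, n = (k + m)%N by exists (n - k)%N; rewrite subnKC.
subst n; rewrite addKn in JE *.
have wu := bruhat_grassmannian_bounded wG uw.
rewrite (juggling_blocksE wG wu) in JE.
apply: (juggling_richardson _ wG wu (juggling_permE wG wu) rc JE).
exact: (size_moved wG wu).
Qed.
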